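(* Let $(\mathcal G,\mathcal S)$ satisfy Axioms (i)–(iv), (vi), (vii) and (viii) of the context and the condition $k_2$. Set $\mathcal D=\mathcal C^A(\mathcal G,\mathcal S)$ and $\mathcal E=\mathcal D_+=\mathcal D^+$. Let $G,H\in\mathcal G$ and let $U$ be an $A$-fibered $(G,H)$-biset all of whose stabilizing pairs are elements of $\mathcal S^+(G,H)=\mathcal S_+(G,H)$. Then for every $F\in\mathcal F^A_{\mathcal D,R}$ one has $$F^+([U])\circ m_{F,H}=m_{F,G}\circ F_+([U]):F_+(H)\to F^+(G).$$ In particular, the $R$-linear maps $m_{F,G}$, $G\in\mathcal G$, define a morphism $m_F:F_+\to F^+$ in $\mathcal F^A_{\mathcal E,R}$ (the mark morphism associated with $F$).
   Context: $A$ is a multiplicatively written abelian group (not necessarily finite), $R$ is a commutative ring with unity, all groups $G,H,K,\dots$ are finite. Pairs. $G^*=\mathrm{Hom}(G,A)$. $\mathcal M(G)$ is the set of pairs $(K,\kappa)$ with $K\le G$, $\kappa\in K^*$, ordered by $(L,\phi)\le(K,\kappa)$ iff $L\le K$ and $\phi=\kappa|_L$; $G$ acts by ${}^g(K,\kappa)=({}^gK,{}^g\kappa)$, ${}^gK=gKg^{-1}$, ${}^g\kappa(gkg^{-1})=\kappa(k)$. For $D\le G\times H$, $p_1,p_2$ are the projections, $k_1(D)=\{g:(g,1)\in D\}$, $k_2(D)=\{h:(1,h)\in D\}$. For $(D,\phi)\in\mathcal M(G\times H)$ put $\phi_1(g)=\phi(g,1)$ on $k_1(D)$ and $\phi_2(h)=\phi(1,h)^{-1}$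 on $k_2(D)$. For $V\le H\times K$, $D*V=\{(g,k):\exists h,\ (g,h)\in D,(h,k)\in V\}$; if $(V,\psi)\in\mathcal M(H\times K)$ and $\phi_2=\psi_1$ on $k_2(D)\cap k_1(V)$, then $(\phi*\psi)(g,k)=\phi(g,h)\psi(h,k)$ (any such $h$) and $(D,\phi)*(V,\psi)=(D*V,\phi*\psi)$. For $K\le H$, $D*K=\{g:\exists k\in K,(g,k)\in D\}$; for $K\le G$, $K*D=\{h:\exists k\in K,(k,h)\in D\}$. If $\lambda\in K^*$ with $K\le H$ and $\phi_2=\lambda$ on $k_2(D)\cap K$, then $(\phi*\lambda)(g)=\phi(g,k)\lambda(k)$ for any $k\in K$ with $(g,k)\in D$. $\Delta(K)=\{(k,k):k\in K\}$, $1$ is the trivial homomorphism. A pair $(D,\phi)$ is regarded as an element of $\mathcal M(G'\times H')$ for any $G',H'$ with $D\le G'\times H'$. Fibered bisets. An $A$-fibered $G$-set is a $(G\times A)$-set with finitely many $A$-orbits on which $A$ acts freely; morphisms are $(G\times A)$-equivariant maps. For $x$ in an $A$-fibered $G$-set, $(G_x,\phi_x)$ denotes the stabilizer of its $A$-orbit and the homomorphism with $gx=\phi_x(g)x$. An $A$-fibered $(G,H)$-biset is an $A$-fibered $(G\times H)$-set, with $gauhb=((g,h^{-1}),ab)u$; the stabilizing pair of $u$ is $((G\times H)_u,\phi_u)$. $B^A(G,H)$ is the Grothendieck group under disjoint union, $B^A_R(G,H)=R\otimes_{\mathbb Z} B^A(G,H)$. $\left[\frac{G\times H}{D,\phi}\right]$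 is the class of $(G\times H\times A)/\{(g,h,\phi(g,h)^{-1}):(g,h)\in D\}$. For an $A$-fibered $(G,H)$-biset $U$ and $(H,K)$-biset $V$, $U\otimes_{AH}V$ is the set of those $(H\times A)$-orbits $u\otimes v$ of $U\times V$ under $(h,a)(u,v)=(u(ha)^{-1},hav)$ on which the induced $A$-action is free; $U\otimes_{AH}X$ for an $A$-fibered $H$-set $X$ is the case $K=1$. $\mathcal C^A$ is the category with objects finite groups, $\mathrm{Hom}_{\mathcal C^A}(H,G)=B^A_R(G,H)$, composition induced by $\otimes_{AH}$, identities $\left[\frac{G\times G}{\Delta(G),1}\right]$. Data. $\mathcal G$ is a class of finite groups, $\Sigma_{\mathcal G}(G)=\{H\le G: H\in\mathcal G\}$, and $\mathcal S$ is a family of subsets $\mathcal S(G,H)\subseteq\mathcal M(G\times H)$, $G,H\in\mathcal G$. Axioms: (i) $(\Delta(G),1)\in\mathcal S(G,G)$ for $G\in\mathcal G$. (ii) $\mathcal S(G,H)$ is closed under $(G\times H)$-conjugation. (iii) For $(V,\phi)\in\mathcal S(G,H)$, $(U,\psi)\in\mathcal S(H,K)$ with $\phi_2=\psi_1$ on $k_2(V)\cap k_1(U)$: $(V*U,\phi*\psi)\in\mathcal S(G,K)$. (iv) For $(D,\phi)\in\mathcal S(G,H)$ and $K\in\Sigma_{\mathcal G}(H)$: $D*K\in\mathcal G$ and $(D,\phi)*(\Delta(K),1)\in\mathcal S(D*K,K)$. (vi) For $G\in\mathcal G$, $H\in\Sigma_{\mathcal G}(G)$: $(\Delta(H),1)\in\mathcal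 S(H,G)$. (vii) For $(D,\phi)\in\mathcal S(G,H)$: $p_2(D)\in\mathcal G$, and for all $K\in\Sigma_{\mathcal G}(p_2(D))$, $D*K\in\mathcal G$ and $(D,\phi)*(\Delta(K),1)\in\mathcal S(D*K,K)$. (viii) For $(D,\phi)\in\mathcal S(G,H)$: $p_1(D)\in\mathcal G$, and for all $K\in\Sigma_{\mathcal G}(p_1(D))$, $K*D\in\mathcal G$ and $(\Delta(K),1)*(D,\phi)\in\mathcal S(K,K*D)$. Condition $k_2$: $k_2(D)=\{1\}$ for all $G,H\in\mathcal G$, $(D,\phi)\in\mathcal S(G,H)$. For a pair satisfying (i)–(iii), $\mathcal C^A(\mathcal G,\mathcal S)$ is the subcategory of $\mathcal C^A$ with object class $\mathcal G$ in which the morphisms from $H$ to $G$ are the $R$-span of the $\left[\frac{G\times H}{D,\phi}\right]$ with $(D,\phi)\in\mathcal S(G,H)$. $\mathcal F^A_{\mathcal D,R}$ is the category of $R$-linear functors $\mathcal D\to R\text{-Mod}$. Define $\mathcal S_+(G,H)=\{(D,\phi): p_1(D)\in\mathcal G,\ (D,\phi)\in\mathcal S(p_1(D),H)\}$ and $\mathcal S^+(G,H)=\{(D,\phi): p_1(D),p_2(D)\in\mathcal G,\ (D,\phi)\in\mathcal S(p_1(D),p_2(D))\}$ (subsets of $\mathcal M(G\times H)$), $\mathcal D_+=\mathcal C^A(\mathcal G,\mathcal S_+)$, $\mathcal D^+=\mathcal C^A(\mathcal G,\mathcal S^+)$. Under the axioms assumed here $\mathcal S_+=\mathcal S^+$,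 hence $\mathcal D_+=\mathcal D^+$. The functor $F_+$. Let $F\in\mathcal F^A_{\mathcal D,R}$. For $g\in G$, $L\in\Sigma_{\mathcal G}(G)$, ${}^g:F(L)\to F({}^gL)$ is $F$ applied to $\left[\frac{{}^gL\times L}{\{(glg^{-1},l):l\in L\},1}\right]$. $\Gamma_F(G)$ has objects $(X,s)$ with $X$ an $A$-fibered $G$-set such that all $G_x\in\mathcal G$ and $s$ a function on $X$ with $s(x)\in F(G_x)$ and ${}^gs(g^{-1}ax)=s(x)$ for all $g\in G,a\in A,x\in X$; morphisms $(X,s)\to(Y,t)$ are morphisms $\alpha:X\to Y$ of $A$-fibered $G$-sets with $G_x=G_{\alpha(x)}$, $t(\alpha(x))=s(x)$. $F_+(G)$ is the free abelian group on isomorphism classes $\{X,s\}$ modulo all $\{X\sqcup Y,s\sqcup t\}-\{X,s\}-\{Y,t\}$ and $\{X,s+r\}-\{X,s\}-\{X,r\}$; the coset of $\{X,s\}$ is $[X,s]$, and $r[X,s]=[X,rs]$ for $r\in R$. For $U$ with stabilizing pairs in $\mathcal S_+(G,H)$, $F_+([U])([X,s])=[U\otimes_{AH}X,U(s)]$ with $U(s)(u\otimes x)=F\left(\left[\frac{G_{u\otimes x}\times H_x}{(G\times H_x)_u,\phi_{u,x}}\right]\right)(s(x))$, where $((G\times H_x)_u,\phi_{u,x})=((G\times H)_u,\phi_u)*(\Delta(H_x),1)$. The functor $F^+$. $\mathcal M'(G)=\{(K,\lambda):K\in\Sigma_{\mathcal G}(G),\lambda\in K^*\}$; $F^+(G)\le\bigoplus_{(K,\lambda)\in\mathcal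 M'(G)}F(K)$ consists of the families with ${}^gx_{(K,\lambda)}=x_{({}^gK,{}^g\lambda)}$ for all $g\in G$. With $K^u=K*(G\times H)_u$ and $(K\times H)_u=\{(k,h)\in(G\times H)_u:k\in K\}$, $F^+([U])$ sends $(x_{(L,\lambda)})$ to $(y_{(K,\alpha)})$, $y_{(K,\alpha)}=\sum F\left(\left[\frac{K\times K^u}{(K\times H)_u,\phi_u}\right]\right)(x_{(K^u,\lambda)})$, summed over $u$ in a set of representatives of the $(A,H)$-orbits of $U$ with $K\le p_1((G\times H)_u)$ and $\lambda\in(K^u)^*$ with $(\phi_u)_2=\lambda$ on $k_2((G\times H)_u)\cap K^u$ and $\phi_u|_{(K\times H)_u}*\lambda=\alpha$. The mark map. $m_{F,G}:F_+(G)\to F^+(G)$ is the $R$-linear map sending $[X,s]$ to $(a_{(L,\lambda)})$ with $a_{(L,\lambda)}=\sum F(\mathrm{Res}^{G_x}_L)(s(x))$, summed over $x$ in a set $[X/A]$ of representatives of the $A$-orbits of $X$ with $(L,\lambda)\le(G_x,\phi_x)$, where $\mathrm{Res}^{K}_L=\left[\frac{L\times K}{\Delta(L),1}\right]$. *)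

(* Defs.v *)
From HB Require Import structures.
From mathcomp Require Import all_boot all_algebra all_fingroup.
From mathcomp Require Import boolp classical_sets cardinality fsbigop.
Set Implicit Arguments.
Unset Strict Implicit.
Unset Printing Implicit Defensive.

Import GRing.Theory GroupScope.
Local Open Scope group_scope.

(* Abelian groups, written multiplicatively. MathComp's [groupType] and
   [zmodType] cannot be used here: all MathComp structures have their carriers
   in one and the same universe, whereas F_+(G) is an [lmodType] built on the
   large type of all A-fibered G-sets, whose carriers contain copies of A. *)
Record abgroup := AbGroup {
  abgroup_sort :> Type;
  amul : abgroup_sort -> abgroup_sort -> abgroup_sort;
  aone : abgroup_sort;
  ainv : abgroup_sort -> abgroup_sort;
  amulA : associative amul;
  amulC : commutative amul;
  amul1a : left_id aone amul;
  amulVa : left_inverse aone ainv amul }.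
Arguments aone {_}.

HB.instance Definition _ (A : abgroup) := gen_eqMixin A.
HB.instance Definition _ (A : abgroup) := gen_choiceMixin A.

Declare Scope abgroup_scope.
Delimit Scope abgroup_scope with ab.
Notation "a * b" := (amul a b) : abgroup_scope.
Notation "1" := aone : abgroup_scope.
Notation "a ^-1" := (ainv a) : abgroup_scope.

Section AbTheory.
Variable A : abgroup.
Implicit Types a b : A.

Lemma amula1 a : (a * 1)%ab = a.
Proof. by rewrite amulC amul1a. Qed.

Lemma amulaV a : (a * a^-1)%ab = 1%ab.
Proof. by rewrite amulC amulVa. Qed.

Lemma ainv1 : (1^-1)%ab = 1%ab :> A.
Proof. by rewrite -[LHS]amula1 amulVa. Qed.

Lemma ainvK a : (a^-1^-1)%ab = a.
Proof. by rewrite -[LHS]amula1 -(amulVa a) amulA amulVa amul1a. Qed.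

Lemma ainvM a b : ((a * b)^-1)%ab = (a^-1 * b^-1)%ab.
Proof.
have abV : (a * b * (a^-1 * b^-1) = 1)%ab.
  by rewrite -amulA (amulA b) (amulC b) -amulA amulaV amula1 amulaV.
by rewrite -[LHS]amula1 -abV amulA amulVa amul1a.
Qed.
End AbTheory.

(* Finite groups are the subgroups {group gT} of finite group types, so that a
   subgroup of a group is again an object. Subgroups of G x H are groups of
   type {group gT * hT} contained in [setX_group G H]. *)
Definition group_class := forall gT : finGroupType, {group gT} -> Prop.

Section GroupOps.
Variables gT hT kT : finGroupType.

Definition p1 (D : {group gT * hT}) : {group gT} := (@fst gT hT @* D)%G.
Definition p2 (D : {group gT * hT}) : {group hT} := (@snd gT hT @* D)%G.
Definition k1 (D : {group gT * hT}) : {set gT} := [set g | (g, 1) \in D].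
Definition k2 (D : {group gT * hT}) : {set hT} := [set h | (1, h) \in D].

Definition star_set (D : {group gT * hT}) (V : {group hT * kT}) : {set gT * kT} :=
  [set x | [exists h, ((x.1, h) \in D) && ((h, x.2) \in V)]].

Lemma star_group_set D V : group_set (star_set D V).
Proof.
apply/group_setP; split.
  by rewrite inE; apply/existsP; exists 1; rewrite !group1.
move=> x y; rewrite !inE => /existsP[h /andP[Dh Vh]] /existsP[h' /andP[Dh' Vh']].
by apply/existsP; exists (h * h'); rewrite (groupM Dh Dh') (groupM Vh Vh').
Qed.
Definition star_grp D V : {group gT * kT} := Group (star_group_set D V).

(* D * K for K <= H. *)
Definition img_set (D : {group gT * hT}) (K : {group hT}) : {set gT} :=
  [set g | [exists k in K, (g, k) \in D]].

Lemma img_group_set D K : group_set (img_set D K).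
Proof.
apply/group_setP; split.
  by rewrite inE; apply/existsP; exists 1; rewrite !group1.
move=> x y; rewrite !inE => /existsP[h /andP[Kh Dh]] /existsP[h' /andP[Kh' Dh']].
by apply/existsP; exists (h * h'); rewrite (groupM Kh Kh') (groupM Dh Dh').
Qed.
Definition img_grp D K : {group gT} := Group (img_group_set D K).

(* K * D for K <= G. *)
Definition coimg_set (K : {group gT}) (D : {group gT * hT}) : {set hT} :=
  [set h | [exists k in K, (k, h) \in D]].

Lemma coimg_group_set K D : group_set (coimg_set K D).
Proof.
apply/group_setP; split.
  by rewrite inE; apply/existsP; exists 1; rewrite !group1.
move=> x y; rewrite !inE => /existsP[h /andP[Kh Dh]] /existsP[h' /andP[Kh' Dh']].
by apply/existsP; exists (h * h'); rewrite (groupM Kh Kh') (groupM Dh Dh').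
Qed.
Definition coimg_grp K D : {group hT} := Group (coimg_group_set K D).

(* {(k, h) in D : k in K}. *)
Definition cut_set (K : {group gT}) (D : {group gT * hT}) : {set gT * hT} :=
  [set x in D | x.1 \in K].

Lemma cut_group_set K D : group_set (cut_set K D).
Proof.
apply/group_setP; split; first by rewrite !inE !group1.
by move=> x y; rewrite !inE => /andP[Dx Kx] /andP[Dy Ky]; rewrite !groupM.
Qed.
Definition cut_grp K D : {group gT * hT} := Group (cut_group_set K D).

End GroupOps.

Section DiagOps.
Variable gT : finGroupType.

(* {(g l g^-1, l) : l in L}; recall that x ^ y is y^-1 * x * y. *)
Definition conj_diag_set (g : gT) (L : {group gT}) : {set gT * gT} :=
  [set (l ^ g^-1, l) | l in L].

Lemma conj_diag_group_set g L : group_set (conj_diag_set g L).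
Proof.
apply/group_setP; split.
  by apply/imsetP; exists 1; rewrite ?group1 // conj1g.
move=> _ _ /imsetP[l Ll ->] /imsetP[l' Ll' ->].
by apply/imsetP; exists (l * l'); rewrite ?groupM // conjMg.
Qed.
Definition conj_diag g L : {group gT * gT} := Group (conj_diag_group_set g L).

Definition diag_set (L : {group gT}) : {set gT * gT} := [set (l, l) | l in L].

Lemma diag_group_set L : group_set (diag_set L).
Proof.
apply/group_setP; split; first by apply/imsetP; exists 1; rewrite ?group1.
move=> _ _ /imsetP[l Ll ->] /imsetP[l' Ll' ->].
by apply/imsetP; exists (l * l'); rewrite ?groupM.
Qed.
Definition diag L : {group gT * gT} := Group (diag_group_set L).
End DiagOps.

Implicit Types gT hT kT : finGroupType.

Section Pairs.
Variable A : abgroup.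

(* A homomorphism K -> A is represented by its extension by 1 to the ambient
   type, so that elements of K^* are equal iff they agree on K. *)
Definition gpair (gT : finGroupType) := ({group gT} * {ffun gT -> A})%type.

Definition is_hom gT (K : {group gT}) (f : {ffun gT -> A}) : Prop :=
  {in K &, forall x y, f (x * y) = (f x * f y)%ab} /\
  (forall x, x \notin K -> f x = 1%ab).

Definition in_M gT (G : {group gT}) (P : gpair gT) : Prop :=
  P.1 \subset G /\ is_hom P.1 P.2.

Definition pair_le gT (P Q : gpair gT) : Prop :=
  P.1 \subset Q.1 /\ {in P.1, P.2 =1 Q.2}.

(* The left conjugate ^g(K, kappa). *)
Definition conj_pair gT (g : gT) (P : gpair gT) : gpair gT :=
  ((P.1 :^ g^-1)%G, [ffun x => P.2 (x ^ g)]).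

Definition triv_pair gT (K : {group gT}) : gpair gT := (K, [ffun=> 1%ab]).

Definition phi1 gT hT (P : gpair (gT * hT)%type) (g : gT) : A := P.2 (g, 1).
Definition phi2 gT hT (P : gpair (gT * hT)%type) (h : hT) : A :=
  ((P.2 (1%g, h))^-1)%ab.

Definition star_compat gT hT kT (P : gpair (gT * hT)%type)
    (Q : gpair (hT * kT)%type) : Prop :=
  {in k2 P.1 :&: k1 Q.1, phi2 P =1 phi1 Q}.

(* (D, phi) * (V, psi); meaningful when [star_compat] holds. *)
Definition star gT hT kT (P : gpair (gT * hT)%type) (Q : gpair (hT * kT)%type) :
    gpair (gT * kT)%type :=
  (star_grp P.1 Q.1,
   [ffun x : gT * kT =>
      if [pick h | ((x.1, h) \in P.1) && ((h, x.2) \in Q.1)] is Some h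
      then (P.2 (x.1, h) * Q.2 (h, x.2))%ab else 1%ab]).

Definition lam_compat gT hT (P : gpair (gT * hT)%type) (Q : gpair hT) : Prop :=
  {in k2 P.1 :&: Q.1, phi2 P =1 Q.2}.

(* (D * K, phi * lambda); meaningful when [lam_compat] holds. *)
Definition star_lam gT hT (P : gpair (gT * hT)%type) (Q : gpair hT) : gpair gT :=
  (img_grp P.1 Q.1,
   [ffun g => if [pick k in Q.1 | (g, k) \in P.1] is Some k
              then (P.2 (g, k) * Q.2 k)%ab else 1%ab]).

(* The restriction of (D, phi) to {(k, h) in D : k in K}. *)
Definition cut_pair gT hT (K : {group gT}) (P : gpair (gT * hT)%type) :
    gpair (gT * hT)%type :=
  (cut_grp K P.1, [ffun x => if x.1 \in K then P.2 x else 1%ab]).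

End Pairs.
Arguments triv_pair {A gT} K.

(* A (G x A)-set: [fact g a x] is (g, a)x, and is meaningless for g outside G. *)
Record fibset (A : abgroup) (gT : finGroupType) (G : {group gT}) := FibSet {
  fcar :> Type;
  fact : gT -> A -> fcar -> fcar;
  fact1 : forall x, fact 1 1%ab x = x;
  factM : {in G &, forall g h a b x,
    fact (g * h) (a * b)%ab x = fact g a (fact h b x)};
  ffree : forall a x, fact 1 a x = x -> a = 1%ab;
  ffin : exists (n : nat) (r : 'I_n -> fcar),
    forall x, exists i a, x = fact 1 a (r i) }.
Arguments fact {A gT G f}.
Arguments FibSet {A gT G}.

(* An A-fibered (G, H)-biset is an A-fibered (G x H)-set; the two-sided action
   is g a u h b = ((g, h^-1), a b) u. *)
Notation biset A G H := (fibset A (setX_group G H)).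

Section FibTheory.
Variables (A : abgroup) (gT : finGroupType) (G : {group gT}).
Implicit Types X Y Z : fibset A G.

Lemma factA X g a b (x : X) : g \in G ->
  fact g (a * b)%ab x = fact g a (fact 1 b x).
Proof. by move=> Gg; rewrite -factM ?group1 // mulg1. Qed.

Lemma factAl X g a b (x : X) : g \in G ->
  fact g (a * b)%ab x = fact 1 a (fact g b x).
Proof. by move=> Gg; rewrite -factM ?group1 // mul1g. Qed.

Lemma factK X g a (x : X) : g \in G -> fact g^-1 (a^-1)%ab (fact g a x) = x.
Proof. by move=> Gg; rewrite -factM ?groupV // mulVg amulVa fact1. Qed.

Definition equivariant X Y (f : X -> Y) : Prop :=
  forall g a x, g \in G -> f (fact g a x) = fact g a (f x).

Definition fib_iso X Y : Prop :=
  exists f : X -> Y, equivariant f /\ bijective f.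

Definition stab_set X (x : X) : {set gT} :=
  [set g in G | `[< exists a, fact g 1%ab x = fact 1 a x >]].

Lemma stab_group_set X (x : X) : group_set (stab_set x).
Proof.
apply/group_setP; split.
  by rewrite inE group1; apply/asboolP; exists 1%ab.
move=> g h; rewrite !inE => /andP[Gg /asboolP[a ga]] /andP[Gh /asboolP[b hb]].
rewrite groupM //=; apply/asboolP; exists (b * a)%ab.
rewrite -{1}(amul1a 1%ab) factM // hb -factA // amul1a.
by rewrite -[b in LHS]amula1 factAl // ga -factA.
Qed.
Definition stab X (x : X) : {group gT} := Group (stab_group_set x).

(* phi_x, characterised on G_x by g x = phi_x(g) x. *)
Definition stab_char X (x : X) : {ffun gT -> A} :=
  [ffun g => if pselect (exists a, g \in stab x /\ fact g 1%ab x = fact 1 a x)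
               is left e then sval (cid e) else 1%ab].

Definition stab_pair X (x : X) : gpair A gT := (stab x, stab_char x).

(* Representatives of the A-orbits. *)
Definition orbit_reps X n (r : 'I_n -> X) : Prop :=
  (forall x, exists i a, x = fact 1 a (r i)) /\
  (forall i j a, r i = fact 1 a (r j) -> i = j).

Section SumFib.
Variables X Y : fibset A G.

Definition sum_act (g : gT) (a : A) (z : X + Y) : X + Y :=
  match z with inl x => inl (fact g a x) | inr y => inr (fact g a y) end.

Lemma sum_act1 z : sum_act 1 1%ab z = z.
Proof. by case: z => z /=; rewrite fact1. Qed.

Lemma sum_actM : {in G &, forall g h a b z,
  sum_act (g * h) (a * b)%ab z = sum_act g a (sum_act h b z)}.
Proof. by move=> g h Gg Gh a b [] z /=; rewrite factM. Qed.

Lemma sum_free a z : sum_act 1 a z = z -> a = 1%ab.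
Proof. by case: z => z /= [] /ffree. Qed.

Lemma sum_fin : exists (n : nat) (r : 'I_n -> X + Y),
  forall z, exists i a, z = sum_act 1 a (r i).
Proof.
have [n [r hr]] := ffin X; have [m [s hs]] := ffin Y.
exists (n + m)%N, (fun i => match split i with
                            inl j => inl (r j) | inr k => inr (s k) end).
case=> [x|y].
- have [i [a ->]] := hr x; exists (lshift m i), a.
  by have /= -> := unsplitK (inl i : 'I_n + 'I_m).
- have [i [a ->]] := hs y; exists (rshift n i), a.
  by have /= -> := unsplitK (inr i : 'I_n + 'I_m).
Qed.

Definition sum_fib : fibset A G := FibSet _ _ sum_act1 sum_actM sum_free sum_fin.
End SumFib.

End FibTheory.

(* Extension of an action by the identity outside G. *)
Section Extend.
Variables (A : abgroup) (gT : finGroupType) (G : {group gT}) (X : Type).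
Variable act : forall g, g \in G -> A -> X -> X.
Definition ext_act (g : gT) (a : A) (x : X) : X :=
  match @idP (g \in G) with ReflectT h => act h a x | _ => x end.
Lemma ext_actE g (h : g \in G) a x : ext_act g a x = act h a x.
Proof.
rewrite /ext_act; case: {-}_ / idP => [h'|//]; by rewrite (bool_irrelevance h h').
Qed.
End Extend.

(* (G x A) / {(d, phi(d)^-1) : d in D}; for G x H in place of G, its class is
   [(G x H) / (D, phi)]. Elements of gT are replaced by their indices in the
   enumeration of gT only to bring the carrier into a small enough universe. *)
Section Transitive.
Variables (A : abgroup) (gT : finGroupType) (G : {group gT}) (P : gpair A gT).

Definition code := (nat * A)%type.
Definition gindex (g : gT) : nat := index g (enum gT).
Definition gnth (i : nat) : gT := nth 1 (enum gT) i.

Lemma gindexK : cancel gindex gnth.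
Proof. by move=> g; rewrite /gnth nth_index ?mem_enum. Qed.

Definition coset_at (g : gT) (a : A) (p : code) : Prop :=
  exists2 d, d \in P.1 & p = (gindex (g * d), (a * (P.2 d)^-1)%ab).

Definition trans_car := {O : code -> Prop |
  exists g a, g \in G /\ O = coset_at g a}.

Definition shift_at (g : gT) (a : A) (O : code -> Prop) (p : code) : Prop :=
  exists2 q, O q & p = (gindex (g * gnth q.1), (a * q.2)%ab).

Lemma shift_coset g a h b :
  shift_at g a (coset_at h b) = coset_at (g * h) (a * b)%ab.
Proof.
apply: funext => p; apply: propext; split.
  by move=> [_ [d Dd ->] ->]; exists d; rewrite //= gindexK mulgA amulA.
move=> [d Dd ->].
exists (gindex (h * d), (b * (P.2 d)^-1)%ab); first by exists d.
by rewrite /= gindexK mulgA amulA.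
Qed.

Lemma trans_act_subproof g a (O : trans_car) : g \in G ->
  exists h b, h \in G /\ shift_at g a (sval O) = coset_at h b.
Proof.
move=> Gg; case: O => O /= [h [b [Gh ->]]].
by exists (g * h), (a * b)%ab; rewrite groupM // shift_coset.
Qed.

Definition trans_act := ext_act (fun g (Gg : g \in G) a (O : trans_car) =>
  exist _ (shift_at g a (sval O)) (trans_act_subproof a O Gg) : trans_car).

Lemma trans_actE g a O : g \in G ->
  sval (trans_act g a O) = shift_at g a (sval O).
Proof. by move=> Gg; rewrite /trans_act (ext_actE _ Gg). Qed.

Lemma trans_inj (O O' : trans_car) : sval O = sval O' -> O = O'.
Proof. by case: O O' => O h [O' h'] /= e; exact: eq_exist. Qed.

Hypothesis PG : in_M G P.

Lemma trans_act1 O : trans_act 1 1%ab O = O.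
Proof.
apply: trans_inj; rewrite trans_actE //; case: O => O /= [h [b [Gh ->]]].
by rewrite shift_coset mul1g amul1a.
Qed.

Lemma trans_actM : {in G &, forall g h a b O,
  trans_act (g * h) (a * b)%ab O = trans_act g a (trans_act h b O)}.
Proof.
move=> g h Gg Gh a b O; apply: trans_inj.
rewrite !trans_actE ?groupM //; case: O => O /= [k [c [Gk ->]]].
by rewrite !shift_coset mulgA amulA.
Qed.

Lemma trans_free a O : trans_act 1 a O = O -> a = 1%ab.
Proof.
move/(congr1 sval); rewrite trans_actE //; case: O => O /= [h [b [Gh ->]]].
rewrite shift_coset mul1g => eqO.
have [_ [homP _]] := PG.
have P1 : P.2 1 = 1%ab.
  have := homP 1 1 (group1 _) (group1 _); rewrite mulg1 => e.
  by rewrite -[LHS]amul1a -(amulVa (P.2 1)) -amulA -e.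
have : coset_at h (a * b)%ab (gindex h, (a * b)%ab).
  by exists 1; rewrite ?group1 // mulg1 P1 ainv1 amula1.
rewrite eqO => -[d _ [/(can_inj gindexK) hd]].
have -> : d = 1 by apply: (mulgI h); rewrite -hd mulg1.
rewrite P1 ainv1 amula1 => ab.
by rewrite -[a]amula1 -(amulaV b) amulA ab.
Qed.

Lemma trans_fin : exists (n : nat) (r : 'I_n -> trans_car),
  forall O, exists i a, O = trans_act 1 a (r i).
Proof.
have r0 (g : gT) : exists h b, h \in G /\
    coset_at (if g \in G then g else 1) 1%ab = coset_at h b.
  by case: ifP => Gg; [exists g, 1%ab | exists 1, 1%ab].
exists #|gT|, (fun i : 'I_#|gT| => exist _ _ (r0 (enum_val i)) : trans_car).
case=> O [h [b [Gh eO]]]; exists (enum_rank h), b; apply: trans_inj.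
by rewrite trans_actE //= enum_rankK Gh eO shift_coset mul1g amula1.
Qed.

Definition trans_fib : fibset A G :=
  FibSet _ _ trans_act1 trans_actM trans_free trans_fin.
End Transitive.

Section Tensor.
Variables (A : abgroup) (gT hT kT : finGroupType).
Variables (G : {group gT}) (H : {group hT}) (K : {group kT}).
Variables (U : biset A G H) (V : biset A H K).

(* The (H x A)-orbit of (u, v) under (h, a)(u, v) = (u (h a)^-1, h a v). *)
Definition tens_orb (u : U) (v : V) (p : U * V) : Prop :=
  exists h a, h \in H /\
    p = (fact (1%g, h) (a^-1)%ab u, fact (h, 1%g) a v).

Definition tens_free (u : U) (v : V) : Prop :=
  forall a, tens_orb (fact 1 a u) v = tens_orb u v -> a = 1%ab.

Definition tens_car := {O : U * V -> Prop |
  exists u v, tens_free u v /\ O = tens_orb u v}.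

Definition tens_shift (x : gT * kT) (a : A) (O : U * V -> Prop) (p : U * V) :=
  exists2 q, O q & p = (fact (x.1, 1) a q.1, fact (1, x.2) 1%ab q.2).

Let inX1 g : g \in G -> (g, 1) \in setX_group G H.
Proof. by move=> Gg; rewrite inE /= Gg group1. Qed.
Let in1X h : h \in H -> (1, h) \in setX_group G H.
Proof. by move=> Hh; rewrite inE /= Hh group1. Qed.
Let inY1 h : h \in H -> (h, 1) \in setX_group H K.
Proof. by move=> Hh; rewrite inE /= Hh group1. Qed.
Let in1Y k : k \in K -> (1, k) \in setX_group H K.
Proof. by move=> Kk; rewrite inE /= Kk group1. Qed.

Let fU1 (u : U) : fact (1%g, 1%g) 1%ab u = u := fact1 u.
Let fV1 (v : V) : fact (1%g, 1%g) 1%ab v = v := fact1 v.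

Lemma tens_orb_refl u v : tens_orb u v (u, v).
Proof.
by exists 1, 1%ab; rewrite group1 ainv1 fU1 fV1.
Qed.

Lemma tens_orbP u v p : tens_orb u v p -> tens_orb p.1 p.2 = tens_orb u v.
Proof.
move=> [h [a [Hh ->]]]; apply: funext => q; apply: propext; split => /=.
  move=> [h' [a' [Hh' ->]]]; exists (h' * h), (a' * a)%ab; rewrite groupM //.
  by rewrite -!factM ?in1X ?inY1 // ainvM; split=> //; congr (fact (_, _) _ _, fact (_, _) _ _); rewrite ?mulg1.
move=> [h' [a' [Hh' ->]]]; exists (h' * h^-1), (a' * a^-1)%ab.
rewrite groupM ?groupV //; split=> //.
rewrite -!factM ?in1X ?inY1 ?groupM ?groupV // ainvM ainvK.
rewrite -!amulA amulVa amulaV !amula1.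
by congr (fact (_, _) _ _, fact (_, _) _ _); rewrite ?mulg1 ?mulgKV.
Qed.

Lemma tens_shift_orb x a u v : x \in setX_group G K ->
  tens_shift x a (tens_orb u v) =
  tens_orb (fact (x.1, 1) a u) (fact (1, x.2) 1%ab v).
Proof.
case: x => g k /=; rewrite inE /= => /andP[Gg Kk].
have e h b : h \in H ->
    (fact (g, 1) a (fact (1, h) (b^-1)%ab u), fact (1, k) 1%ab (fact (h, 1) b v))
  = (fact (1, h) (b^-1)%ab (fact (g, 1) a u), fact (h, 1) b (fact (1, k) 1%ab v)).
  move=> Hh; rewrite -!factM ?inX1 ?in1X ?inY1 ?in1Y // amul1a amula1 amulC.
  by congr (fact (_, _) _ _, fact (_, _) _ _); rewrite ?mulg1 ?mul1g.
apply: funext => p; apply: propext; split.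
  by move=> [_ [h [b [Hh ->]]] ->]; exists h, b; rewrite e.
move=> [h [b [Hh ->]]]; rewrite -e //.
by exists (fact (1, h) (b^-1)%ab u, fact (h, 1) b v); first by exists h, b.
Qed.

Lemma tens_free_shift x a u v : x \in setX_group G K -> tens_free u v ->
  tens_free (fact (x.1, 1) a u) (fact (1, x.2) 1%ab v).
Proof.
case: x => g k; rewrite inE /= => /andP[Gg Kk] fr b.
rewrite -factM ?group1 ?inX1 // mul1g => eqO; apply: fr.
have GKi : (g^-1, k^-1) \in setX_group G K by rewrite inE /= !groupV Gg Kk.
move: (congr1 (tens_shift (g^-1, k^-1) (a^-1)%ab) eqO).
rewrite !tens_shift_orb //= -!factM ?inX1 ?in1Y ?groupV // ?groupV //.
rewrite (amulC b) amulA amulVa !amul1a.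
have -> : (g^-1, 1) * (g, 1) = 1 :> gT * hT.
  by congr (_, _); rewrite ?mulVg ?mulg1.
have -> : (1, k^-1) * (1, k) = 1 :> hT * kT.
  by congr (_, _); rewrite ?mulVg ?mulg1.
by rewrite !fact1.
Qed.

Lemma tens_act_subproof x a (O : tens_car) : x \in setX_group G K ->
  exists u v, tens_free u v /\ tens_shift x a (sval O) = tens_orb u v.
Proof.
move=> GKx; case: O => O /= [u [v [fr ->]]].
exists (fact (x.1, 1) a u), (fact (1, x.2) 1%ab v).
by rewrite tens_shift_orb //; split=> //; apply: tens_free_shift.
Qed.

Definition tens_act := ext_act (fun x (GKx : x \in setX_group G K) a (O : tens_car) =>
  exist _ (tens_shift x a (sval O)) (tens_act_subproof a O GKx) : tens_car).

Lemma tens_actE x a O : x \in setX_group G K ->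
  sval (tens_act x a O) = tens_shift x a (sval O).
Proof. by move=> GKx; rewrite /tens_act (ext_actE _ GKx). Qed.

Lemma tens_inj (O O' : tens_car) : sval O = sval O' -> O = O'.
Proof. by case: O O' => O h [O' h'] /= e; exact: eq_exist. Qed.

Lemma tens_act1 O : tens_act 1 1%ab O = O.
Proof.
apply: tens_inj; rewrite tens_actE ?group1 //; case: O => O /= [u [v [_ ->]]].
by rewrite tens_shift_orb ?group1 //= fU1 fV1.
Qed.

Lemma tens_actM : {in setX_group G K &, forall x y a b O,
  tens_act (x * y) (a * b)%ab O = tens_act x a (tens_act y b O)}.
Proof.
move=> [g k] [g' k'] xG yG a b O; have xyG := groupM xG yG.
apply: tens_inj; rewrite !tens_actE //; case: O => O /= [u [v [_ ->]]].
move: (xG) (yG); rewrite !inE /= => /andP[Gg Kk] /andP[Gg' Kk'].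
rewrite !tens_shift_orb //= -!factM ?inX1 ?in1Y // amul1a.
by congr (tens_orb (fact (_, _) _ _) (fact (_, _) _ _)); rewrite mulg1.
Qed.

Lemma tens_freeP a O : tens_act 1 a O = O -> a = 1%ab.
Proof.
move/(congr1 sval); rewrite tens_actE ?group1 //; case: O => O /= [u [v [fr ->]]].
by rewrite tens_shift_orb ?group1 //= fV1; apply: fr.
Qed.

Lemma tens_fin : exists (n : nat) (r : 'I_n -> tens_car),
  forall O, exists i a, O = tens_act 1 a (r i).
Proof.
have [n [r hr]] := ffin U; have [m [s hs]] := ffin V.
pose I := [the finType of ('I_n * 'I_m)%type].
have [[O0]|noO] := pselect (inhabited tens_car); last first.
  exists 0%N, (fun i : 'I_0 => False_rect _ (notF (ltn_ord i))).
  by move=> O; have [] := noO (inhabits O).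
pose t (i : I) : tens_car :=
  if pselect (tens_free (r i.1) (s i.2)) is left fr
  then exist _ (tens_orb (r i.1) (s i.2)) (ex_intro _ _ (ex_intro _ _ (conj fr erefl)))
  else O0.
exists #|I|, (fun i : 'I_#|I| => t (enum_val i)).
case=> O [u [v [fr eO]]].
have [i [a eu]] := hr u; have [j [b ev]] := hs v.
have orbE c : tens_orb (fact 1 c (r i)) (fact 1 b (s j)) =
              tens_orb (fact 1 (c * b)%ab (r i)) (s j).
  have h : tens_orb (fact 1 (c * b)%ab (r i)) (s j) (fact 1 c (r i), fact 1 b (s j)).
    exists 1, b; split; first exact: group1.
    congr (_, _); rewrite -[(1, 1)]/(1 : gT * hT) -factA ?group1 //.
    by rewrite (amulC c) amulA amulVa amul1a.
  exact: tens_orbP h.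
have frij : tens_free (r i) (s j).
  move=> c eqc; apply: fr; rewrite eu ev -factA ?group1 // !orbE.
  have sh d w w' : tens_orb w (s j) = tens_orb w' (s j) ->
      tens_orb (fact 1 d w) (s j) = tens_orb (fact 1 d w') (s j).
    move=> e; move: (congr1 (tens_shift 1 d) e).
    by rewrite !tens_shift_orb ?group1 //= fV1.
  have -> : (c * a * b)%ab = (a * b * c)%ab by rewrite -amulA amulC.
  by rewrite factA ?group1 //; apply: sh.
exists (enum_rank (i, j)), (a * b)%ab; apply: tens_inj.
rewrite tens_actE ?group1 //= enum_rankK /t.
case: pselect => // fr'; rewrite /= eO eu ev orbE.
by rewrite tens_shift_orb ?group1 //= fV1.
Qed.

Definition tens : biset A G K :=
  FibSet _ _ tens_act1 tens_actM tens_freeP tens_fin.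

Definition tens_pt u v (fr : tens_free u v) : tens :=
  exist _ (tens_orb u v) (ex_intro _ u (ex_intro _ v (conj fr erefl))).

(* y = u (x) v. *)
Definition is_tens (y : tens) (u : U) (v : V) : Prop := sval y = tens_orb u v.

End Tensor.
Arguments is_tens {A gT hT kT G H K U V}.


(* The R-module generated by T, subject to [x] = sum of the [y], y <- ys,
   whenever [rel x ys]. *)
Section Presented.
Variables (R : pzRingType) (T : Type) (rel : T -> seq T -> Prop).
Local Open Scope ring_scope.

Inductive term :=
| Tgen of T
| Tzero
| Topp of term
| Tadd of term & term
| Tscale of R & term.

Definition Tsum (ys : seq T) := foldr (fun y t => Tadd (Tgen y) t) Tzero ys.

Inductive teq : term -> term -> Prop :=
| teq_refl t : teq t t
| teq_sym t u : teq t u -> teq u t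
| teq_trans t u v : teq t u -> teq u v -> teq t v
| teq_opp t t' : teq t t' -> teq (Topp t) (Topp t')
| teq_add t t' u u' : teq t t' -> teq u u' -> teq (Tadd t u) (Tadd t' u')
| teq_scale r t t' : teq t t' -> teq (Tscale r t) (Tscale r t')
| teq_addA t u v : teq (Tadd t (Tadd u v)) (Tadd (Tadd t u) v)
| teq_addC t u : teq (Tadd t u) (Tadd u t)
| teq_add0 t : teq (Tadd Tzero t) t
| teq_addN t : teq (Tadd (Topp t) t) Tzero
| teq_scaleA r s t : teq (Tscale r (Tscale s t)) (Tscale (r * s) t)
| teq_scale1 t : teq (Tscale 1 t) t
| teq_scaleDr r t u : teq (Tscale r (Tadd t u)) (Tadd (Tscale r t) (Tscale r u))
| teq_scaleDl r s t : teq (Tscale (r + s) t) (Tadd (Tscale r t) (Tscale s t))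
| teq_rel x ys : rel x ys -> teq (Tgen x) (Tsum ys).

Definition presented := {C : term -> Prop | exists t, C = teq t}.

HB.instance Definition _ := gen_eqMixin presented.
HB.instance Definition _ := gen_choiceMixin presented.

Definition tcl (t : term) : presented := exist _ (teq t) (ex_intro _ t erefl).
Definition trep (c : presented) : term := sval (cid (svalP c)).

Lemma tcl_eq t u : teq t u -> tcl t = tcl u.
Proof.
move=> tu; apply: eq_exist; apply: funext => v; apply: propext.
by split; apply: teq_trans => //; apply: teq_sym.
Qed.

Lemma trepK c : tcl (trep c) = c.
Proof.
rewrite /trep; case: (cid _) => t /=; case: c => C hC /= e.
by apply: eq_exist; rewrite e.
Qed.

Lemma tcl_inv t u : tcl t = tcl u -> teq t u.
Proof. by move/(congr1 sval) => /= ->; exact: teq_refl. Qed.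

Lemma trep_tcl t : teq (trep (tcl t)) t.
Proof. by apply: tcl_inv; rewrite trepK. Qed.

Definition padd c d := tcl (Tadd (trep c) (trep d)).
Definition popp c := tcl (Topp (trep c)).
Definition pscale r c := tcl (Tscale r (trep c)).

Lemma padd_tcl t u : padd (tcl t) (tcl u) = tcl (Tadd t u).
Proof. by apply/tcl_eq/teq_add; exact: trep_tcl. Qed.
Lemma popp_tcl t : popp (tcl t) = tcl (Topp t).
Proof. by apply/tcl_eq/teq_opp; exact: trep_tcl. Qed.
Lemma pscale_tcl r t : pscale r (tcl t) = tcl (Tscale r t).
Proof. by apply/tcl_eq/teq_scale; exact: trep_tcl. Qed.

Lemma paddA : associative padd.
Proof.
move=> a b c; rewrite -(trepK a) -(trepK b) -(trepK c) !padd_tcl.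
exact/tcl_eq/teq_addA.
Qed.
Lemma paddC : commutative padd.
Proof.
by move=> a b; rewrite -(trepK a) -(trepK b) !padd_tcl; exact/tcl_eq/teq_addC.
Qed.
Lemma padd0 : left_id (tcl Tzero) padd.
Proof. by move=> a; rewrite -(trepK a) padd_tcl; exact/tcl_eq/teq_add0. Qed.
Lemma paddN : left_inverse (tcl Tzero) popp padd.
Proof.
by move=> a; rewrite -(trepK a) popp_tcl padd_tcl; exact/tcl_eq/teq_addN.
Qed.

HB.instance Definition _ := GRing.isZmodule.Build presented paddA paddC padd0 paddN.

Lemma pscaleA r s c : pscale r (pscale s c) = pscale (r * s) c.
Proof. by rewrite -(trepK c) !pscale_tcl; exact/tcl_eq/teq_scaleA. Qed.
Lemma pscale1 : left_id 1 pscale.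
Proof. by move=> c; rewrite -(trepK c) !pscale_tcl; exact/tcl_eq/teq_scale1. Qed.
Lemma pscaleDr : right_distributive pscale +%R.
Proof.
move=> r c d; rewrite -[c + d]/(padd c d) -[RHS]/(padd (pscale r c) (pscale r d)).
rewrite -(trepK c) -(trepK d) padd_tcl !pscale_tcl padd_tcl.
exact/tcl_eq/teq_scaleDr.
Qed.
Lemma pscaleDl c : {morph pscale^~ c : r s / r + s}.
Proof.
move=> r s; rewrite -[RHS]/(padd (pscale r c) (pscale s c)).
rewrite -(trepK c) !pscale_tcl padd_tcl.
exact/tcl_eq/teq_scaleDl.
Qed.

HB.instance Definition _ := GRing.Zmodule_isLmodule.Build R presented
  pscaleA pscale1 pscaleDr pscaleDl.

Definition pgen (x : T) : presented := tcl (Tgen x).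

Lemma tcl_add t u : tcl (Tadd t u) = tcl t + tcl u.
Proof. by rewrite [RHS]padd_tcl. Qed.
Lemma tcl_opp t : tcl (Topp t) = - tcl t.
Proof. by rewrite [RHS]popp_tcl. Qed.
Lemma tcl_scale r t : tcl (Tscale r t) = r *: tcl t.
Proof. by rewrite [RHS]pscale_tcl. Qed.

Lemma pgen_rel x ys : rel x ys -> pgen x = \sum_(y <- ys) pgen y.
Proof.
move=> xys; rewrite /pgen (tcl_eq (teq_rel xys)).
elim: ys {xys} => [|y ys IH] /=; first by rewrite big_nil.
by rewrite tcl_add IH big_cons.
Qed.

Lemma presented_ind (Q : presented -> Prop) :
  (forall x, Q (pgen x)) -> Q 0 -> (forall c d, Q c -> Q d -> Q (c + d)) ->
  (forall r c, Q c -> Q (r *: c)) -> forall c, Q c.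
Proof.
move=> Qg Q0 Qa Qs c; rewrite -(trepK c).
elim: (trep c) => [x||t Qt|t Qt u Qu|r t Qt].
- exact: Qg.
- exact: Q0.
- by rewrite tcl_opp -scaleN1r; exact: Qs.
- by rewrite tcl_add; exact: Qa.
- by rewrite tcl_scale; exact: Qs.
Qed.

Section Lift.
Variables (M : lmodType R) (f : T -> M).

Fixpoint teval (t : term) : M :=
  match t with
  | Tgen x => f x
  | Tzero => 0
  | Topp t => - teval t
  | Tadd t u => teval t + teval u
  | Tscale r t => r *: teval t
  end.

(* The linear extension of f, for f compatible with the relations. *)
Definition plift (c : presented) : M := teval (trep c).

Hypothesis frel : forall x ys, rel x ys -> f x = \sum_(y <- ys) f y.

Lemma teval_teq t u : teq t u -> teval t = teval u.
Proof.
elim=> {t u} //=.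
- by move=> t u v _ -> _ ->.
- by move=> t t' _ ->.
- by move=> t t' u u' _ -> _ ->.
- by move=> r t t' _ ->.
- by move=> t u v; rewrite addrA.
- by move=> t u; rewrite addrC.
- by move=> t; rewrite add0r.
- by move=> t; rewrite addNr.
- by move=> r s t; rewrite scalerA.
- by move=> t; rewrite scale1r.
- by move=> r t u; rewrite scalerDr.
- by move=> r s t; rewrite scalerDl.
- move=> x ys /frel ->; elim: ys => [|y ys IH] /=; first by rewrite big_nil.
  by rewrite big_cons IH.
Qed.

Lemma plift_tcl t : plift (tcl t) = teval t.
Proof. exact/teval_teq/trep_tcl. Qed.

Lemma plift_gen x : plift (pgen x) = f x.
Proof. exact: plift_tcl. Qed.

Lemma pliftD c d : plift (c + d) = plift c + plift d.
Proof. by rewrite -(trepK c) -(trepK d) -tcl_add !plift_tcl. Qed.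

Lemma pliftZ r c : plift (r *: c) = r *: plift c.
Proof. by rewrite -(trepK c) -tcl_scale !plift_tcl. Qed.

Lemma plift0 : plift 0 = 0.
Proof. exact: (plift_tcl Tzero). Qed.
End Lift.

End Presented.
Arguments pgen {R T} rel x.

Section BurnsideModule.
Variables (A : abgroup) (R : comPzRingType).

Inductive fib_rel (gT : finGroupType) (G : {group gT}) :
    fibset A G -> seq (fibset A G) -> Prop :=
| fib_rel_iso X Y : fib_iso X Y -> fib_rel X [:: Y]
| fib_rel_sum X Y : fib_rel (sum_fib X Y) [:: X; Y].

(* R (x) B^A(G, H): the R-module generated by the isomorphism classes of
   A-fibered (G, H)-bisets, subject to [U + V] = [U] + [V]. *)
Definition BR (gT hT : finGroupType) (G : {group gT}) (H : {group hT}) :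
    lmodType R := presented R (@fib_rel _ (setX_group G H)).

Definition cls gT hT (G : {group gT}) (H : {group hT}) (U : biset A G H) :
    BR G H := pgen (@fib_rel _ _) U.

(* [(G x H) / (D, phi)] for (D, phi) in M(G x H). *)
Definition tcls gT hT (G : {group gT}) (H : {group hT})
    (P : gpair A (gT * hT)%type) : BR G H :=
  if pselect (in_M (setX_group G H) P) is left PM then cls (trans_fib PM) else 0%R.

Definition idB gT (G : {group gT}) : BR G G := tcls G G (triv_pair (diag G)).

Definition compB gT hT kT (G : {group gT}) (H : {group hT}) (K : {group kT})
    (f : BR G H) (g : BR H K) : BR G K :=
  plift (fun U : biset A G H => plift (fun V : biset A H K => cls (tens U V)) g) f.
End BurnsideModule.

Section CompTheory.
Local Open Scope ring_scope.

Lemma inj_surj_bij (X Y : Type) (f : X -> Y) :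
  injective f -> (forall y, exists x, f x = y) -> bijective f.
Proof.
move=> fi fs; exists (fun y => sval (cid (fs y))) => [x|y].
  by apply: fi; exact: (svalP (cid (fs (f x)))).
exact: (svalP (cid (fs y))).
Qed.

Section TensMap.
Variables (A : abgroup) (gT hT kT : finGroupType).
Variables (G : {group gT}) (H : {group hT}) (K : {group kT}).
Variables (U U' : biset A G H) (V V' : biset A H K).
Variables (f : U -> U') (g : V -> V').
Hypotheses (fE : equivariant f) (gE : equivariant g).
Hypotheses (fI : injective f) (gI : injective g).

Definition img2 (O : U * V -> Prop) (p : U' * V') : Prop :=
  exists2 q, O q & p = (f q.1, g q.2).

Lemma img2_orb u v : img2 (tens_orb u v) = tens_orb (f u) (g v).
Proof.
have inU (h : hT) : h \in H -> (1%g, h) \in setX_group G H.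
  by move=> Hh; rewrite inE /= Hh group1.
have inV (h : hT) : h \in H -> (h, 1%g) \in setX_group H K.
  by move=> Hh; rewrite inE /= Hh group1.
apply: funext => p; apply: propext; split.
  by move=> [_ [h [a [Hh ->]]] ->]; exists h, a; rewrite /= fE ?inU // gE ?inV.
move=> [h [a [Hh ->]]].
exists (fact (1%g, h) (a^-1)%ab u, fact (h, 1%g) a v); first by exists h, a.
by rewrite /= fE ?inU // gE ?inV.
Qed.

Lemma img2_free u v : tens_free u v -> tens_free (f u) (g v).
Proof.
move=> fr a e; apply: fr.
have : tens_orb (f u) (g v) (fact 1%g a (f u), g v).
  by rewrite -e; exact: tens_orb_refl.
rewrite -fE ?group1 // -img2_orb => -[[u' v'] O' /= [/fI eu /gI ev]].
by rewrite -(tens_orbP O') /= eu ev.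
Qed.

Lemma tens_map_subproof (O : tens U V) :
  exists u v, tens_free u v /\ img2 (sval O) = tens_orb u v.
Proof.
case: O => O /= [u [v [fr ->]]]; exists (f u), (g v).
by rewrite img2_orb; split=> //; exact: img2_free.
Qed.

Definition tens_map (O : tens U V) : tens U' V' :=
  exist _ (img2 (sval O)) (tens_map_subproof O).

Lemma tens_map_equivariant : equivariant tens_map.
Proof.
move=> x a O xGK; apply: tens_inj; rewrite /= !tens_actE //=.
case: O => O /= [u [v [fr ->]]].
rewrite tens_shift_orb // !img2_orb tens_shift_orb //.
case: x xGK => x y /=; rewrite inE /= => /andP[Gx Ky].
by rewrite fE ?gE // inE /= ?Gx ?Ky group1.
Qed.

Lemma img2_inj O O' : img2 O = img2 O' -> O = O'.
Proof.
move=> e; apply: funext => -[u v]; apply: propext; split => Op.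
  have : img2 O (f u, g v) by exists (u, v).
  by rewrite e => -[[u' v'] O'p /= []] /fI -> /gI ->.
have : img2 O' (f u, g v) by exists (u, v).
by rewrite -e => -[[u' v'] O'p /= []] /fI -> /gI ->.
Qed.

Lemma tens_map_inj : injective tens_map.
Proof. by move=> O O' /(congr1 sval) /= /img2_inj /tens_inj. Qed.

Lemma tens_map_surj (f' : U' -> U) (g' : V' -> V) :
  cancel f' f -> cancel g' g -> forall O', exists O, tens_map O = O'.
Proof.
move=> f'K g'K [O' [u [v [fr eO]]]].
have fr' : tens_free (f' u) (g' v).
  move=> a e; apply: fr; move: (congr1 img2 e).
  by rewrite !img2_orb fE ?group1 // f'K g'K.
exists (tens_pt fr').
by apply: tens_inj; rewrite /= img2_orb f'K g'K eO.
Qed.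
End TensMap.

Section Distr.
Variables (A : abgroup) (gT hT kT : finGroupType).
Variables (G : {group gT}) (H : {group hT}) (K : {group kT}).

Lemma tens_iso (U U' : biset A G H) (V V' : biset A H K) :
  fib_iso U U' -> fib_iso V V' -> fib_iso (tens U V) (tens U' V').
Proof.
move=> [f [fE [f' fK f'K]]] [g [gE [g' gK g'K]]].
have fI := can_inj fK; have gI := can_inj gK.
exists (tens_map fE gE fI gI); split; first exact: tens_map_equivariant.
apply: inj_surj_bij; first exact: tens_map_inj.
exact: tens_map_surj f'K g'K.
Qed.

Lemma inl_equivariant (jT : finGroupType) (J : {group jT}) (X Y : fibset A J) :
  equivariant (inl : X -> sum_fib X Y).
Proof. by []. Qed.
Lemma inr_equivariant (jT : finGroupType) (J : {group jT}) (X Y : fibset A J) :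
  equivariant (inr : Y -> sum_fib X Y).
Proof. by []. Qed.
Lemma id_equivariant (jT : finGroupType) (J : {group jT}) (X : fibset A J) :
  equivariant (id : X -> X).
Proof. by []. Qed.

Lemma inl_inj' (X Y : Type) : injective (@inl X Y). Proof. by move=> x y []. Qed.
Lemma inr_inj' (X Y : Type) : injective (@inr X Y). Proof. by move=> x y []. Qed.
Lemma id_inj (X : Type) : injective (@id X). Proof. by []. Qed.

Lemma tens_suml (U U' : biset A G H) (V : biset A H K) :
  fib_iso (tens (sum_fib U U') V) (sum_fib (tens U V) (tens U' V)).
Proof.
pose i1 := tens_map (@inl_equivariant _ _ U U') (@id_equivariant _ _ V)
             (@inl_inj' _ _) (@id_inj _).
pose i2 := tens_map (@inr_equivariant _ _ U U') (@id_equivariant _ _ V)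
             (@inr_inj' _ _) (@id_inj _).
have o1 (u : U) (v : V) : img2 (inl : U -> sum_fib U U') (id : V -> V)
    (tens_orb u v) = tens_orb (inl u : sum_fib U U') v by exact: img2_orb.
have o2 (u : U') (v : V) : img2 (inr : U' -> sum_fib U U') (id : V -> V)
    (tens_orb u v) = tens_orb (inr u : sum_fib U U') v by exact: img2_orb.
pose i (z : sum_fib (tens U V) (tens U' V)) : tens (sum_fib U U') V :=
  match z with inl x => i1 x | inr x => i2 x end.
have iE : equivariant i.
  by move=> x a [] O xG; exact: tens_map_equivariant.
have iI : injective i.
  case=> x [] y; rewrite /i.
  - by move/tens_map_inj ->.
  - move/(congr1 sval) => /=; have [u [v [_ ->]]] := svalP x.
    rewrite o1 => e; have := tens_orb_refl (inl u : sum_fib U U') (v : V).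
    by rewrite e => -[? _ []].
  - move/(congr1 sval) => /=; have [u [v [_ ->]]] := svalP x.
    rewrite o2 => e; have := tens_orb_refl (inr u : sum_fib U U') (v : V).
    by rewrite e => -[? _ []].
  - by move/tens_map_inj ->.
have iS O : exists z, i z = O.
  case: O => O [[u|u] [v [fr eO]]].
  - have fr' : tens_free u v.
      move=> a e; apply: fr; move: (congr1 (img2 (inl : U -> sum_fib U U') (id : V -> V)) e).
      by rewrite !o1.
    exists (inl (tens_pt fr')).
    by apply: tens_inj; rewrite /= o1 eO.
  - have fr' : tens_free u v.
      move=> a e; apply: fr; move: (congr1 (img2 (inr : U' -> sum_fib U U') (id : V -> V)) e).
      by rewrite !o2.
    exists (inr (tens_pt fr')).
    by apply: tens_inj; rewrite /= o2 eO.
have [j ij ji] := inj_surj_bij iI iS.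
exists j; split; last by exists i.
by move=> x a O xG; apply: iI; rewrite iE // !ji.
Qed.

Lemma tens_sumr (U : biset A G H) (V V' : biset A H K) :
  fib_iso (tens U (sum_fib V V')) (sum_fib (tens U V) (tens U V')).
Proof.
pose i1 := tens_map (@id_equivariant _ _ U) (@inl_equivariant _ _ V V')
             (@id_inj _) (@inl_inj' _ _).
pose i2 := tens_map (@id_equivariant _ _ U) (@inr_equivariant _ _ V V')
             (@id_inj _) (@inr_inj' _ _).
have o1 (u : U) (v : V) : img2 (id : U -> U) (inl : V -> sum_fib V V')
    (tens_orb u v) = tens_orb u (inl v : sum_fib V V') by exact: img2_orb.
have o2 (u : U) (v : V') : img2 (id : U -> U) (inr : V' -> sum_fib V V')
    (tens_orb u v) = tens_orb u (inr v : sum_fib V V') by exact: img2_orb.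
pose i (z : sum_fib (tens U V) (tens U V')) : tens U (sum_fib V V') :=
  match z with inl x => i1 x | inr x => i2 x end.
have iE : equivariant i.
  by move=> x a [] O xG; exact: tens_map_equivariant.
have iI : injective i.
  case=> x [] y; rewrite /i.
  - by move/tens_map_inj ->.
  - move/(congr1 sval) => /=; have [u [v [_ ->]]] := svalP x.
    rewrite o1 => e; have := tens_orb_refl (u : U) (inl v : sum_fib V V').
    by rewrite e => -[? _ []].
  - move/(congr1 sval) => /=; have [u [v [_ ->]]] := svalP x.
    rewrite o2 => e; have := tens_orb_refl (u : U) (inr v : sum_fib V V').
    by rewrite e => -[? _ []].
  - by move/tens_map_inj ->.
have iS O : exists z, i z = O.
  case: O => O [u [[v|v] [fr eO]]].
  - have fr' : tens_free u v.
      move=> a e; apply: fr; move: (congr1 (img2 (id : U -> U) (inl : V -> sum_fib V V')) e).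
      by rewrite !o1.
    exists (inl (tens_pt fr')).
    by apply: tens_inj; rewrite /= o1 eO.
  - have fr' : tens_free u v.
      move=> a e; apply: fr; move: (congr1 (img2 (id : U -> U) (inr : V' -> sum_fib V V')) e).
      by rewrite !o2.
    exists (inr (tens_pt fr')).
    by apply: tens_inj; rewrite /= o2 eO.
have [j ij ji] := inj_surj_bij iI iS.
exists j; split; last by exists i.
by move=> x a O xG; apply: iI; rewrite iE // !ji.
Qed.

Lemma fib_iso_refl (jT : finGroupType) (J : {group jT}) (X : fibset A J) :
  fib_iso X X.
Proof. by exists id; split=> //; exists id. Qed.

Variable R : comPzRingType.
Implicit Types (f : BR A R G H) (g : BR A R H K).

Lemma cls_iso (jT lT : finGroupType) (J : {group jT}) (L : {group lT})
  (U V : biset A J L) : fib_iso U V -> cls R U = cls R V.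
Proof.
by move=> UV; rewrite [LHS](pgen_rel _ (fib_rel_iso UV)) big_seq1.
Qed.

Lemma cls_sum (jT lT : finGroupType) (J : {group jT}) (L : {group lT})
  (U V : biset A J L) : cls R (sum_fib U V) = cls R U + cls R V.
Proof.
by rewrite [LHS](pgen_rel _ (fib_rel_sum U V)) big_cons big_seq1.
Qed.

Lemma compB_relr (U : biset A G H) (V : biset A H K) Vs : fib_rel V Vs ->
  cls R (tens U V) = \sum_(W <- Vs) cls R (tens U W).
Proof.
case=> [{}V W VW|{}V W]; last first.
  by rewrite big_cons big_seq1 -cls_sum; exact/cls_iso/tens_sumr.
by rewrite big_seq1; apply/cls_iso/tens_iso; [exact: fib_iso_refl|].
Qed.

Lemma compB_rell (U : biset A G H) Us : fib_rel U Us -> forall g,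
  plift (fun V => cls R (tens U V)) g =
  \sum_(W <- Us) plift (fun V => cls R (tens W V)) g.
Proof.
move=> UUs; elim/presented_ind => [V||g g' IH IH'|r g IH].
- rewrite plift_gen; last exact: compB_relr.
  rewrite (eq_bigr (fun W => cls R (tens W V))); last first.
    by move=> W _; rewrite plift_gen //; exact: compB_relr.
  case: UUs => [{}U W UW|{}U W].
    by rewrite big_seq1; apply/cls_iso/tens_iso => //; exact: fib_iso_refl.
  by rewrite big_cons big_seq1 -cls_sum; exact/cls_iso/tens_suml.
- rewrite plift0; last exact: compB_relr.
  by rewrite big1 // => W _; rewrite plift0 //; exact: compB_relr.
- rewrite pliftD; last exact: compB_relr.
  rewrite IH IH' -big_split; apply: eq_bigr => W _.
  by rewrite pliftD //; exact: compB_relr.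
- rewrite pliftZ; last exact: compB_relr.
  rewrite IH scaler_sumr; apply: eq_bigr => W _.
  by rewrite pliftZ //; exact: compB_relr.
Qed.

(* Composition is the bilinear map induced by the tensor product. *)
Lemma compB_cls (U : biset A G H) (V : biset A H K) :
  compB (cls R U) (cls R V) = cls R (tens U V).
Proof.
rewrite /compB plift_gen; last by move=> ? ? /compB_rell.
by rewrite plift_gen //; exact: compB_relr.
Qed.

Lemma compBl r f f' g : compB (r *: f + f') g = r *: compB f g + compB f' g.
Proof. by rewrite /compB pliftD ?pliftZ // => ? ? /compB_rell. Qed.

Lemma compBr r f g g' : compB f (r *: g + g') = r *: compB f g + compB f g'.
Proof.
have e (c : BR A R H K) : forall (U : biset A G H) Us, fib_rel U Us ->
    plift (fun V : biset A H K => cls R (tens U V)) c =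
    \sum_(W <- Us) plift (fun V : biset A H K => cls R (tens W V)) c.
  by move=> U Us rUs; exact: (compB_rell rUs c).
rewrite /compB; elim/presented_ind: f => [U||f f' IH IH'|s f IH].
- rewrite !plift_gen ?pliftD ?pliftZ //; try exact: e; exact: compB_relr.
- by rewrite !plift0 ?scaler0 ?addr0 //; exact: e.
- rewrite !pliftD; try exact: e.
  by rewrite IH IH' scalerDr addrACA.
- rewrite !pliftZ; try exact: e.
  by rewrite IH scalerDr !scalerA [_ * r]mulrC.
Qed.
End Distr.
End CompTheory.

Section Families.
Variable A : abgroup.

Definition pair_family := forall gT hT : finGroupType,
  {group gT} -> {group hT} -> gpair A (gT * hT)%type -> Prop.

Variables (GG : group_class) (SS : pair_family).

Definition family_in_M : Prop :=
  forall gT hT (G : {group gT}) (H : {group hT}), GG G -> GG H ->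
  forall P, SS G H P -> in_M (setX_group G H) P.

Definition axiom_i : Prop :=
  forall gT (G : {group gT}), GG G -> SS G G (triv_pair (diag G)).

Definition axiom_ii : Prop :=
  forall gT hT (G : {group gT}) (H : {group hT}), GG G -> GG H ->
  forall P x, SS G H P -> x \in setX_group G H -> SS G H (conj_pair x P).

Definition axiom_iii : Prop :=
  forall gT hT kT (G : {group gT}) (H : {group hT}) (K : {group kT}),
  GG G -> GG H -> GG K ->
  forall P Q, SS G H P -> SS H K Q -> star_compat P Q -> SS G K (star P Q).

Definition axiom_iv : Prop :=
  forall gT hT (G : {group gT}) (H : {group hT}), GG G -> GG H ->
  forall P (K : {group hT}), SS G H P -> K \subset H -> GG K ->
  GG (img_grp P.1 K) /\ SS (img_grp P.1 K) K (star P (triv_pair (diag K))).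

Definition axiom_vi : Prop :=
  forall gT (G H : {group gT}), GG G -> H \subset G -> GG H ->
  SS H G (triv_pair (diag H)).

Definition axiom_vii : Prop :=
  forall gT hT (G : {group gT}) (H : {group hT}), GG G -> GG H ->
  forall P, SS G H P -> GG (p2 P.1) /\
  forall K : {group hT}, K \subset p2 P.1 -> GG K ->
  GG (img_grp P.1 K) /\ SS (img_grp P.1 K) K (star P (triv_pair (diag K))).

Definition axiom_viii : Prop :=
  forall gT hT (G : {group gT}) (H : {group hT}), GG G -> GG H ->
  forall P, SS G H P -> GG (p1 P.1) /\
  forall K : {group gT}, K \subset p1 P.1 -> GG K ->
  GG (coimg_grp K P.1) /\ SS K (coimg_grp K P.1) (star (triv_pair (diag K)) P).

Definition condition_k2 : Prop :=
  forall gT hT (G : {group gT}) (H : {group hT}), GG G -> GG H ->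
  forall P, SS G H P -> k2 P.1 = 1.

(* S_+ and S^+. *)
Definition S_lower : pair_family := fun gT hT G H P =>
  [/\ in_M (setX_group G H) P, GG (p1 P.1) & SS (p1 P.1) H P].

Definition S_upper : pair_family := fun gT hT G H P =>
  [/\ in_M (setX_group G H) P, GG (p1 P.1), GG (p2 P.1) &
      SS (p1 P.1) (p2 P.1) P].

Definition stab_in gT hT (G : {group gT}) (H : {group hT}) (U : biset A G H) :=
  forall u : U, SS G H (stab_pair u).

End Families.

Section Functors.
Variables (A : abgroup) (R : comPzRingType) (GG : group_class).
Local Open Scope ring_scope.

(* The morphisms from H to G in C^A(GG, SS). *)
Definition is_mor (SS : pair_family A) gT hT (G : {group gT}) (H : {group hT})
    (f : BR A R G H) : Prop :=
  exists (n : nat) (r : 'I_n -> R) (P : 'I_n -> gpair A (gT * hT)%type),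
    (forall i, SS gT hT G H (P i)) /\ f = \sum_(i < n) r i *: tcls R G H (P i).

Definition fun_obj := forall gT : finGroupType, {group gT} -> lmodType R.

Definition fun_mor (M : fun_obj) :=
  forall (gT hT : finGroupType) (G : {group gT}) (H : {group hT}),
  BR A R G H -> {linear M hT H -> M gT G}.

(* Functors are given by total functions; only their values at the objects and
   morphisms of C^A(GG, SS) are constrained and matter. *)
Record is_functor (SS : pair_family A) (M : fun_obj) (m : fun_mor M) : Prop := {
  functor_linear : forall gT hT (G : {group gT}) (H : {group hT}),
    GG G -> GG H -> forall r (f g : BR A R G H), is_mor SS f -> is_mor SS g ->
    forall x, m _ _ G H (r *: f + g) x = r *: m _ _ G H f x + m _ _ G H g x;
  functor_id : forall gT (G : {group gT}), GG G ->
    forall x, m _ _ G G (idB A R G) x = x;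
  functor_comp : forall gT hT kT (G : {group gT}) (H : {group hT})
    (K : {group kT}), GG G -> GG H -> GG K ->
    forall (f : BR A R G H) (g : BR A R H K), is_mor SS f -> is_mor SS g ->
    forall x, m _ _ G K (compB f g) x = m _ _ G H f (m _ _ H K g x) }.

Record functor (SS : pair_family A) := Functor {
  fobj : fun_obj;
  fmor : fun_mor fobj;
  functorP : is_functor SS fmor }.

Definition fmap SS (F : functor SS) gT hT (G : {group gT}) (H : {group hT})
    (P : gpair A (gT * hT)%type) : {linear fobj F H -> fobj F G} :=
  fmor F (tcls R G H P).

(* ^g : F(L) -> F(K) for K = ^gL. *)
Definition fconj SS (F : functor SS) gT (g : gT) (K L : {group gT}) :
    {linear fobj F L -> fobj F K} := fmap F K L (triv_pair (conj_diag g L)).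

Definition fres SS (F : functor SS) gT (L K : {group gT}) :
    {linear fobj F K -> fobj F L} := fmap F L K (triv_pair (diag L)).

End Functors.

Section FPlus.
Variables (A : abgroup) (R : comPzRingType) (GG : group_class).
Variables (SS : pair_family A) (F : functor R GG SS).
Local Open Scope ring_scope.

Section Gamma.
Variables (gT : finGroupType) (G : {group gT}).

Record gam := Gam {
  gset :> fibset A G;
  gsec : forall x : gset, fobj F (stab x);
  gam_stab : forall x : gset, GG (stab x);
  gam_eq : forall g a (x : gset), g \in G ->
    fconj F g (stab x) (stab (fact g^-1%g a x)) (gsec (fact g^-1%g a x)) =
    gsec x }.

(* The equality of dependent pairs says that G_x = G_{f x} and that the values
   of the two sections agree. *)
Definition gam_mor (X Y : gam) (f : X -> Y) : Prop :=
  equivariant f /\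
  forall x : X,
    existT (fun K : {group gT} => fobj F K) (stab x) (gsec x) =
    existT (fun K : {group gT} => fobj F K) (stab (f x)) (gsec (f x)).

Inductive gam_rel : gam -> seq gam -> Prop :=
| gam_rel_iso (X Y : gam) (f : X -> Y) :
    gam_mor f -> bijective f -> gam_rel X [:: Y]
(* Z is the disjoint union of X and Y. *)
| gam_rel_sum (X Y Z : gam) (i : X -> Z) (j : Y -> Z) :
    gam_mor i -> gam_mor j ->
    bijective (fun w : X + Y => match w with inl x => i x | inr y => j y end) ->
    gam_rel Z [:: X; Y]
| gam_rel_add (X : fibset A G) (s r t : forall x : X, fobj F (stab x))
    (sK rK tK : forall x : X, GG (stab x)) sE rE tE :
    (forall x, t x = s x + r x) ->
    gam_rel (@Gam X t tK tE) [:: @Gam X s sK sE; @Gam X r rK rE].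

(* The abelian group presented by the generators {X, s}. *)
Definition Fplus := presented int gam_rel.

HB.instance Definition _ := GRing.Zmodule.on Fplus.

Definition gam_cls (X : gam) : Fplus := pgen gam_rel X.

Lemma gam_scale_eq r (X : gam) : forall g a (x : X), g \in G ->
  fconj F g (stab x) (stab (fact g^-1%g a x)) (r *: gsec (fact g^-1%g a x)) =
  r *: gsec x.
Proof. by move=> g a x Gg; rewrite linearZ gam_eq. Qed.

(* (X, r s). *)
Definition gam_scale (r : R) (X : gam) : gam :=
  @Gam X (fun x => r *: gsec x) (@gam_stab X) (gam_scale_eq r (X := X)).

Definition fplus_scale (r : R) : Fplus -> Fplus :=
  plift (fun X => gam_cls (gam_scale r X)).

Lemma gam_mor_scale r (X Y : gam) (f : X -> Y) :
  gam_mor f -> gam_mor (f : gam_scale r X -> gam_scale r Y).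
Proof.
move=> [fE fs]; split=> // x /=.
have := congr1 (fun z : {K : {group gT} & fobj F K} =>
  existT (fun K : {group gT} => fobj F K) (tag z) (r *: tagged z)) (fs x).
by [].
Qed.

Lemma gam_scale_rel r (X : gam) Xs : gam_rel X Xs ->
  gam_cls (gam_scale r X) = \sum_(Y <- Xs) gam_cls (gam_scale r Y).
Proof.
have rel1 Z Zs : gam_rel Z Zs -> gam_cls Z = \sum_(Y <- Zs) gam_cls Y.
  by move=> h; rewrite [LHS](pgen_rel _ h).
case=> [{}X Y f fM fB|{}X Y Z i j iM jM ijB|{}X s t u sK tK uK sE tE uE e].
- rewrite big_seq1 [LHS](rel1 _ [:: gam_scale r Y]) ?big_seq1 //.
  exact: (gam_rel_iso (gam_mor_scale r fM)).
- rewrite [LHS](rel1 _ [:: gam_scale r X; gam_scale r Y]).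
    by rewrite !big_cons !big_nil.
  exact: (gam_rel_sum (gam_mor_scale r iM) (gam_mor_scale r jM)).
- rewrite [LHS](rel1 _ [:: gam_scale r (Gam sK sE); gam_scale r (Gam tK tE)]).
    by rewrite !big_cons !big_nil.
  by apply: gam_rel_add => x /=; rewrite e scalerDr.
Qed.

Lemma fplus_scale_cls r X : fplus_scale r (gam_cls X) = gam_cls (gam_scale r X).
Proof. by rewrite /fplus_scale plift_gen // => ? ? /gam_scale_rel. Qed.

Lemma fplus_scaleD r : {morph fplus_scale r : c d / c + d}.
Proof. by move=> c d; rewrite /fplus_scale pliftD // => ? ? /gam_scale_rel. Qed.

Lemma fplus_scale0 r : fplus_scale r 0 = 0.
Proof. by rewrite /fplus_scale plift0 // => ? ? /gam_scale_rel. Qed.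

Lemma fplus_scaleN r c : fplus_scale r (- c) = - fplus_scale r c.
Proof. by apply/eqP; rewrite -addr_eq0 -fplus_scaleD addNr fplus_scale0. Qed.

Lemma fplus_ind (Q : Fplus -> Prop) : (forall X, Q (gam_cls X)) -> Q 0 ->
  (forall c d, Q c -> Q d -> Q (c + d)) -> (forall c, Q c -> Q (- c)) ->
  forall c, Q c.
Proof.
move=> Qg Q0 Qa Qo; apply: presented_ind => // z c Qc.
have Qn (n : nat) : Q (c *+ n : presented int gam_rel).
  by elim: n => [|n IH]; rewrite ?mulr0n // mulrS; exact: Qa.
by case: z => n; rewrite -[X in X *: _]intz scaler_int ?NegzE ?mulrNz;
  [exact: Qn | exact/Qo/Qn].
Qed.

Lemma gam_ext (X : fibset A G) (s t : forall x : X, fobj F (stab x))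
    sK tK sE tE : (forall x, s x = t x) -> @Gam X s sK sE = @Gam X t tK tE.
Proof.
move=> e; have {}e : s = t by exact: functional_extensionality_dep.
by case: _ / e in tE *; congr Gam; exact: Prop_irrelevance.
Qed.

Lemma fplus_scaleA r s c : fplus_scale r (fplus_scale s c) = fplus_scale (r * s) c.
Proof.
elim/fplus_ind: c => [X||c d IH IH'|c IH].
- by rewrite !fplus_scale_cls; congr gam_cls; apply: gam_ext => x /=; rewrite scalerA.
- by rewrite !fplus_scale0.
- by rewrite !fplus_scaleD IH IH'.
- by rewrite !fplus_scaleN IH.
Qed.

Lemma fplus_scale1 : left_id 1 fplus_scale.
Proof.
elim/fplus_ind => [X||c d IH IH'|c IH].
- rewrite fplus_scale_cls; congr gam_cls; case: X => X s sK sE.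
  by apply: gam_ext => x /=; rewrite scale1r.
- exact: fplus_scale0.
- by rewrite fplus_scaleD IH IH'.
- by rewrite fplus_scaleN IH.
Qed.

Lemma fplus_scaleDl c : {morph fplus_scale^~ c : r s / r + s}.
Proof.
move=> r s; elim/fplus_ind: c => [X||c d IH IH'|c IH].
- rewrite !fplus_scale_cls.
  have h : gam_rel (gam_scale (r + s) X) [:: gam_scale r X; gam_scale s X].
    by apply: gam_rel_add => x; rewrite scalerDl.
  by rewrite /gam_cls (pgen_rel _ h) big_cons big_seq1.
- by rewrite !fplus_scale0 addr0.
- by rewrite !fplus_scaleD IH IH' addrACA.
- by rewrite !fplus_scaleN IH opprD.
Qed.

HB.instance Definition _ := GRing.Zmodule_isLmodule.Build R Fplus
  fplus_scaleA fplus_scale1 fplus_scaleD fplus_scaleDl.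

End Gamma.

Definition F_plus : fun_obj R := fun gT G => Fplus G.

End FPlus.

Section FUpper.
Variables (A : abgroup) (R : comPzRingType) (GG : group_class).
Variables (SS : pair_family A) (F : functor R GG SS).
Local Open Scope ring_scope.

Section Obj.
Variables (gT : finGroupType) (G : {group gT}).

Definition in_M' (P : gpair A gT) : Prop := in_M G P /\ GG P.1.

Record Fupper := FUpperFam {
  fu_val :> forall P : gpair A gT, fobj F P.1;
  fu_dom : forall P, ~ in_M' P -> fu_val P = 0;
  fu_fin : finite_set [set P | fu_val P <> 0]%classic;
  fu_inv : forall g P, g \in G -> in_M' P ->
    fconj F g (conj_pair g P).1 P.1 (fu_val P) = fu_val (conj_pair g P) }.

HB.instance Definition _ := gen_eqMixin Fupper.
HB.instance Definition _ := gen_choiceMixin Fupper.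

Lemma fu_ext (x y : Fupper) : (forall P, x P = y P) -> x = y.
Proof.
case: x y => [x x1 x2 x3] [y y1 y2 y3] /= e.
have {}e : x = y by exact: functional_extensionality_dep.
by case: _ / e in y1 y2 y3 *; congr FUpperFam; exact: Prop_irrelevance.
Qed.

Definition fu_zero : Fupper.
Proof.
refine (@FUpperFam (fun=> 0) (fun _ _ => erefl) _ (fun _ _ _ _ => linear0 _)).
by rewrite (_ : [set _ | _]%classic = set0) // -subset0 => P.
Defined.

Definition fu_add (x y : Fupper) : Fupper.
Proof.
refine (@FUpperFam (fun P => x P + y P) _ _ _).
- by move=> P nP; rewrite !fu_dom // addr0.
- apply: (@sub_finite_set _ _ ([set P | x P <> 0] `|` [set P | y P <> 0])%classic).
    move=> P /= xy; have [x0|] := pselect (x P = 0); last by left.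
    by right; move: xy; rewrite x0 add0r.
  by rewrite finite_setU; split; exact: fu_fin.
- by move=> g P Gg hP; rewrite linearD !fu_inv.
Defined.

Definition fu_scale (r : R) (x : Fupper) : Fupper.
Proof.
refine (@FUpperFam (fun P => r *: x P) _ _ _).
- by move=> P nP; rewrite fu_dom // scaler0.
- apply: (sub_finite_set _ (fu_fin x)) => P /= rx x0.
  by apply: rx; rewrite x0 scaler0.
- by move=> g P Gg hP; rewrite linearZ fu_inv.
Defined.

Definition fu_opp (x : Fupper) : Fupper := fu_scale (-1) x.

Lemma fu_addA : associative fu_add.
Proof. by move=> x y z; apply: fu_ext => P /=; rewrite addrA. Qed.
Lemma fu_addC : commutative fu_add.
Proof. by move=> x y; apply: fu_ext => P /=; rewrite addrC. Qed.
Lemma fu_add0 : left_id fu_zero fu_add.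
Proof. by move=> x; apply: fu_ext => P /=; rewrite add0r. Qed.
Lemma fu_addN : left_inverse fu_zero fu_opp fu_add.
Proof. by move=> x; apply: fu_ext => P /=; rewrite scaleN1r addNr. Qed.

HB.instance Definition _ := GRing.isZmodule.Build Fupper
  fu_addA fu_addC fu_add0 fu_addN.

Lemma fu_scaleA r s x : fu_scale r (fu_scale s x) = fu_scale (r * s) x.
Proof. by apply: fu_ext => P /=; rewrite scalerA. Qed.
Lemma fu_scale1 : left_id 1 fu_scale.
Proof. by move=> x; apply: fu_ext => P /=; rewrite scale1r. Qed.
Lemma fu_scaleDr : right_distributive fu_scale +%R.
Proof. by move=> r x y; apply: fu_ext => P /=; rewrite scalerDr. Qed.
Lemma fu_scaleDl x : {morph fu_scale^~ x : r s / r + s}.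
Proof. by move=> r s; apply: fu_ext => P /=; rewrite scalerDl. Qed.

HB.instance Definition _ := GRing.Zmodule_isLmodule.Build R Fupper
  fu_scaleA fu_scale1 fu_scaleDr fu_scaleDl.

End Obj.

Definition F_upper : fun_obj R := fun gT G => Fupper G.

End FUpper.

Section TensSet.
Variables (A : abgroup) (gT hT : finGroupType) (G : {group gT}) (H : {group hT}).

(* A-fibered H-sets as A-fibered (H, 1)-bisets, and conversely. *)
Section ToBiset.
Variable X : fibset A H.

Definition to_biset_act (x : hT * hT) (a : A) (y : X) : X := fact x.1 a y.

Lemma to_biset_act1 y : to_biset_act 1%g 1%ab y = y.
Proof. exact: fact1. Qed.

Lemma to_biset_actM : {in setX_group H 1%G &, forall x x' a b y,
  to_biset_act (x * x') (a * b)%ab y = to_biset_act x a (to_biset_act x' b y)}.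
Proof.
move=> [h k] [h' k']; rewrite !inE /= => /andP[Hh _] /andP[Hh' _] a b y.
exact: factM.
Qed.

Definition to_biset : biset A H (1%G : {group hT}) :=
  FibSet X to_biset_act to_biset_act1 to_biset_actM (@ffree _ _ _ X) (ffin X).
End ToBiset.

Section OfBiset.
Variable U : biset A G (1%G : {group hT}).

Definition of_biset_act (g : gT) (a : A) (u : U) : U := fact (g, 1%g) a u.

Lemma of_biset_act1 u : of_biset_act 1%g 1%ab u = u.
Proof. exact: fact1. Qed.

Lemma of_biset_actM : {in G &, forall g h a b u,
  of_biset_act (g * h) (a * b)%ab u = of_biset_act g a (of_biset_act h b u)}.
Proof.
move=> g h Gg Gh a b u; rewrite /of_biset_act -factM.
- by congr fact; congr (_, _); rewrite mulg1.
- by rewrite inE /= Gg group1.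
- by rewrite inE /= Gh group1.
Qed.

Definition of_biset : fibset A G :=
  FibSet U of_biset_act of_biset_act1 of_biset_actM (@ffree _ _ _ U) (ffin U).
End OfBiset.

Definition tens_fib (U : biset A G H) (X : fibset A H) : fibset A G :=
  of_biset (tens U (to_biset X)).

(* y = u (x) x. *)
Definition is_tens_fib (U : biset A G H) (X : fibset A H) (y : tens_fib U X)
    (u : U) (x : X) : Prop := @is_tens A _ _ _ _ _ _ U (to_biset X) y u x.

(* Representatives of the (A, H)-orbits of U. *)
Definition biset_orbit_reps (U : biset A G H) n (r : 'I_n -> U) : Prop :=
  (forall u, exists i h a, h \in H /\ u = fact (1%g, h) a (r i)) /\
  (forall i j h a, h \in H -> r i = fact (1%g, h) a (r j) -> i = j).

End TensSet.

Section Maps.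
Variables (A : abgroup) (R : comPzRingType) (GG : group_class).
Variables (SS : pair_family A) (F : functor R GG SS).
Variables (gT hT : finGroupType) (G : {group gT}) (H : {group hT}).
Local Open Scope ring_scope.

(* f = F_+([U]): f [X, s] = [U (x) X, U(s)]. *)
Definition is_Fplus_map (U : biset A G H)
    (f : F_plus F H -> F_plus F G) : Prop :=
  forall X : gam F H,
  exists (t : forall y : tens_fib U X, fobj F (stab y))
         (tK : forall y : tens_fib U X, GG (stab y)) tE,
    (forall (y : tens_fib U X) u x, is_tens_fib y u x ->
       t y = fmap F (stab y) (stab x)
               (star (stab_pair u) (triv_pair (diag (stab x)))) (gsec x)) /\
    f (gam_cls X) = gam_cls (@Gam _ _ _ _ F _ G (tens_fib U X) t tK tE).

(* f = F^+([U]). *)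
Definition is_Fupper_map (U : biset A G H)
    (f : F_upper F H -> F_upper F G) : Prop :=
  forall (x : F_upper F H) (P : gpair A gT), in_M' GG G P ->
  forall n (r : 'I_n -> U), biset_orbit_reps r ->
  f x P =
    \sum_(i < n | P.1 \subset p1 (stab (r i)))
      let Ku : {group hT} := coimg_grp P.1 (stab (r i)) in
      let D := cut_pair P.1 (stab_pair (r i)) in
      \sum_(l \in [set l : {ffun hT -> A} |
                   [/\ is_hom Ku l, lam_compat (stab_pair (r i)) (Ku, l) &
                       (star_lam D (Ku, l)).2 = P.2]]%classic)
        fmap F P.1 Ku D (x (Ku, l)).

End Maps.

(* f = m_{F, G}. *)
Definition is_mark_map (A : abgroup) (R : comPzRingType) (GG : group_class)
    (SS : pair_family A) (F : functor R GG SS)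
    (gT : finGroupType) (G : {group gT})
    (f : F_plus F G -> F_upper F G) : Prop :=
  forall (X : gam F G) (P : gpair A gT), in_M' GG G P ->
  forall n (r : 'I_n -> X), orbit_reps r ->
  f (gam_cls X) P =
    (\sum_(i < n | `[< pair_le P (stab_pair (r i)) >])
       fres F P.1 (stab (r i)) (gsec (r i)))%R.

(* Main.v *)
Require Import Defs.
From HB Require Import structures.
From mathcomp Require Import all_boot all_algebra all_fingroup.
From mathcomp Require Import boolp classical_sets cardinality fsbigop.

(** Under the condition k_2 = 1 every pair (D, phi) of S_+(G, H) is the graph of
    a homomorphism p_1(D) -> H together with phi. Hence, in a biset U with
    stabilizing pairs in S_+, the group H acts freely on the A-orbits, and two
    things happen.

    First, all products of standard basis elements that occur consist of a
    single double coset without any obstruction, so that F(P) o F(Q) = F(P * Q)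
    and every identity between values of F reduces to an identity of pairs.

    Second, if the u_i represent the (A, H)-orbits of U and the x_j the A-orbits
    of X, then the u_i (x) x_j represent the A-orbits of U (x) X. For a pair
    (K, alpha) and u in U there is at most one lambda as in the definition of
    F^+([U]), and (K, alpha) <= (G_y, phi_y) for y = u (x) x holds iff this
    lambda exists and (K^u, lambda) <= (H_x, phi_x). So both sides of the
    commutation are the same double sum over (i, j), term by term; the same
    computation with a biset V in place of X shows that F^+ is a functor. *)

Set Implicit Arguments.
Unset Strict Implicit.
Unset Printing Implicit Defensive.

Import GRing.Theory GroupScope.

(** * Pairs and stabilizing pairs *)

(** Three obstacles shape the code. A functor must give a map for every element of [BR A R G H],
    while the formulas for F_+([U]) and F^+([U]) make sense only if the stabilizing pairs of U lie
    in S_+. They are therefore proved for such U and then extended through [good U], the part of U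
    with stabilizing pairs in S_+. Passing to this part respects isomorphisms and disjoint unions,
    so the extension is linear on all of [BR], and it agrees with the formulas on bisets over S_+.
    Next, (D, phi) in S_+(G, H) is controlled only by S(p_1(D), H), so neither conjugation by G nor
    composition in S_+ is literally an instance of an axiom. The first is recovered by composing
    with conjugation isomorphisms, the second by cutting down to p_1 of the right factor before
    composing. Finally, pairs are functions on a whole ambient type, and [star] and [star_lam] are
    defined through [pick]. Every pair is replaced by its graph [prel], on which the star product is
    composition of relations; equalities of pairs are proved by comparing graphs with [prel_ext]. *)

Section Fib.
Local Open Scope group_scope.
Variable A : abgroup.
Implicit Types gT hT kT : finGroupType.

Lemma amul_inj (a b c : A) : (a * b = a * c)%ab -> b = c.
Proof. by move=> /(congr1 (amul (ainv a))); rewrite !amulA !amulVa !amul1a. Qed.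

Section One.
Variables (gT : finGroupType) (G : {group gT}) (X : fibset A G).
Implicit Types (x y : X) (a b : A).

Lemma fact_fact1 a b x : fact 1 a (fact 1 b x) = fact 1 (a * b)%ab x.
Proof. by rewrite -factM ?group1 // mulg1. Qed.

Lemma fact_mul1 g a x : g \in G -> fact g a x = fact 1 a (fact g 1%ab x).
Proof. by move=> Gg; rewrite -factAl // amula1. Qed.

Lemma factCA g a b x : g \in G -> fact g a (fact 1 b x) = fact 1 b (fact g a x).
Proof. by move=> Gg; rewrite -factA // -factAl // amulC. Qed.

Lemma fact_injA a b x : fact 1 a x = fact 1 b x -> a = b.
Proof.
move=> /(congr1 (fact 1 (ainv b))); rewrite !fact_fact1 amulVa fact1.
by move/ffree => /(congr1 (amul b)); rewrite amulA amulaV amul1a amula1.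
Qed.

Lemma fact_inj g a x y : g \in G -> fact g a x = fact g a y -> x = y.
Proof. by move=> Gg /(congr1 (fact g^-1 (ainv a))); rewrite !factK. Qed.
End One.

(** The graph of P as a relation between the group and A. In this form the choices made by [pick] in
    the products of pairs disappear. *)
Definition prel gT (P : gpair A gT) (x : gT) (a : A) : Prop :=
  x \in P.1 /\ P.2 x = a.

(** The convention on values off the subgroup, without which two pairs with the same graph could
    differ as functions on the ambient type. *)
Definition supported gT (P : gpair A gT) := forall x, x \notin P.1 -> P.2 x = 1%ab.

Lemma prel_ext gT (P Q : gpair A gT) : supported P -> supported Q ->
  (forall x a, prel P x a <-> prel Q x a) -> P = Q.
Proof.
case: P Q => [D f] [E g] sP sQ e.
have eD : D = E.
  apply/group_inj/setP => x; apply/idP/idP => h.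
    by have [] := (e x (f x)).1 (conj h erefl).
  by have [] := (e x (g x)).2 (conj h erefl).
congr (_, _) => //; apply/ffunP => x; case: (boolP (x \in D)) => h.
  by have [_ /= ->] := (e x (f x)).1 (conj h erefl).
by have /= -> := sP x h; have /= -> := sQ x; rewrite -?eD.
Qed.

Lemma prelI gT (P : gpair A gT) x : x \in P.1 -> prel P x (P.2 x).
Proof. by []. Qed.

Lemma prel_uniq gT (P : gpair A gT) x a b : prel P x a -> prel P x b -> a = b.
Proof. by move=> [_ <-] [_ <-]. Qed.

Lemma k2_inj gT hT (D : {group gT * hT}) g h h' : k2 D = 1 ->
  (g, h) \in D -> (g, h') \in D -> h = h'.
Proof.
move=> D1 gh gh'; have := groupM (groupVr gh) gh'.
rewrite -[_ * _]/(g^-1 * g, h^-1 * h') mulVg => h1.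
have : h^-1 * h' \in k2 D by rewrite inE.
by rewrite D1 => /set1gP/(canRL (mulKVg _)); rewrite mulg1.
Qed.

Lemma k2P gT hT (D : {group gT * hT}) : (forall h, (1, h) \in D -> h = 1) -> k2 D = 1.
Proof.
move=> h; apply/setP => x; rewrite inE; apply/idP/set1gP => [/h //|->].
exact: (group1 D).
Qed.

(** As k_2 = 1, the middle element h is determined by g, so [pick] has only one element to choose
    and [star] is the composition of relations. *)
Lemma star_prel gT hT kT (P : gpair A (gT * hT)%type) (Q : gpair A (hT * kT)%type)
    g k c : k2 P.1 = 1 ->
  prel (star P Q) (g, k) c <->
  exists h a b, [/\ prel P (g, h) a, prel Q (h, k) b & c = (a * b)%ab].
Proof.
move=> P1; rewrite /prel /star /= inE ffunE /=; case: pickP => [h /andP[Ph Qh]|no].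
  split=> [[_ <-]|[h' [a [b [[Ph' <-] [Qh' <-]] ->]]]].
    by exists h, (P.2 (g, h)), (Q.2 (h, k)).
  rewrite (k2_inj P1 Ph Ph'); split=> //.
  by apply/existsP; exists h'; rewrite Ph' Qh'.
split=> [[/existsP[h]]|[h [a [b [[Ph _] [Qh _] _]]]]]; first by rewrite no.
by have := no h; rewrite Ph Qh.
Qed.

Lemma star_supported gT hT kT (P : gpair A (gT * hT)%type)
  (Q : gpair A (hT * kT)%type) : supported (star P Q).
Proof.
move=> x; rewrite inE ffunE => /existsPn no; case: pickP => // h.
by rewrite (negbTE (no h)).
Qed.

Lemma triv_supported gT (K : {group gT}) : supported (triv_pair K : gpair A gT).
Proof. by move=> x _; rewrite ffunE. Qed.

Lemma in_M_supported gT (G : {group gT}) (P : gpair A gT) : in_M G P -> supported P.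
Proof. by case=> _ []. Qed.

Lemma mem_diag gT (L : {group gT}) x y : ((x, y) \in diag L) = (x == y) && (x \in L).
Proof.
apply/imsetP/andP => [[l Ll [-> ->]]|[/eqP-> Ly]]; first by rewrite eqxx.
by exists y.
Qed.

Lemma diag_prel gT (L : {group gT}) x y (a : A) :
  prel (triv_pair (diag L)) (x, y) a <-> [/\ x = y, x \in L & a = 1%ab].
Proof.
rewrite /prel mem_diag ffunE; split=> [[/andP[/eqP-> ->] <-] //|[-> -> ->]].
by rewrite eqxx.
Qed.

Lemma mem_conj_diag gT g (L : {group gT}) x y :
  ((x, y) \in conj_diag g L) = (x == y ^ g^-1) && (y \in L).
Proof.
apply/imsetP/andP => [[l Ll [-> ->]]|[/eqP-> Ly]]; first by rewrite eqxx.
by exists y.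
Qed.

Lemma conj_diag_prel gT g (L : {group gT}) x y (a : A) :
  prel (triv_pair (conj_diag g L)) (x, y) a <-> [/\ x = y ^ g^-1, y \in L & a = 1%ab].
Proof.
rewrite /prel mem_conj_diag ffunE; split=> [[/andP[/eqP-> ->] <-] //|[-> -> ->]].
by rewrite eqxx.
Qed.

Lemma k2_diag gT (L : {group gT}) : k2 (diag L) = 1.
Proof. by apply: k2P => h; rewrite mem_diag => /andP[/eqP]. Qed.

Lemma k2_conj_diag gT g (L : {group gT}) : k2 (conj_diag g L) = 1.
Proof.
apply: k2P => h; rewrite mem_conj_diag => /andP[/eqP e _].
by apply: (conjg_inj g^-1); rewrite -e conj1g.
Qed.

Lemma mem_cut gT hT K (D : {group gT * hT}) x :
  (x \in cut_grp K D) = (x \in D) && (x.1 \in K).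
Proof. by rewrite inE. Qed.

Lemma cut_prel gT hT K (P : gpair A (gT * hT)%type) x a :
  prel (cut_pair K P) x a <-> x.1 \in K /\ prel P x a.
Proof.
rewrite /prel inE ffunE; case: (boolP (x.1 \in K)) => Kx; last first.
  by rewrite andbF; split; case.
by rewrite andbT; split=> [[]|[_ []]].
Qed.

Lemma cut_supported gT hT K (P : gpair A (gT * hT)%type) :
  supported P -> supported (cut_pair K P).
Proof. by move=> sP x; rewrite inE ffunE; case: ifP => // _; rewrite andbT => /sP. Qed.

Lemma conj_prel gT (g : gT) (P : gpair A gT) x a :
  prel (conj_pair g P) x a <-> prel P (x ^ g) a.
Proof. by rewrite /prel /= ffunE mem_conjgV. Qed.

Lemma conj_supported gT (g : gT) (P : gpair A gT) :
  supported P -> supported (conj_pair g P).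
Proof. by move=> sP x; rewrite /= ffunE mem_conjgV => /sP. Qed.

Lemma stab_mem gT (G : {group gT}) (X : fibset A G) (x : X) g :
  reflect (g \in G /\ exists a, fact g 1%ab x = fact 1 a x) (g \in stab x).
Proof.
rewrite inE; apply: (iffP andP) => -[Gg] /asboolP h; split=> //.
Qed.

(** Freeness of the A-action makes the scalar unique, so the one chosen inside [stab_char] must be
    a. *)
Lemma stab_prel gT (G : {group gT}) (X : fibset A G) (x : X) g a :
  prel (stab_pair x) g a <-> g \in G /\ fact g 1%ab x = fact 1 a x.
Proof.
rewrite /prel ffunE; split=> [[/stab_mem[Gg [b hb]]]|[Gg h]].
  case: pselect => [e|]; last first.
    by case; exists b; split=> //; apply/stab_mem; split=> //; exists b.
  by case: (cid e) => c [_ hc] /= <-.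
have sg : g \in stab x by apply/stab_mem; split=> //; exists a.
split=> //; case: pselect => [e|]; last by case; exists a.
by case: (cid e) => c [_ hc] /=; apply: (@fact_injA _ _ X _ _ x); rewrite -hc.
Qed.

Lemma stab_supported gT (G : {group gT}) (X : fibset A G) (x : X) :
  supported (stab_pair x).
Proof.
move=> g /negP ng; rewrite ffunE; case: pselect => // e.
by case: (cid e) => c [].
Qed.

Lemma stab_sub gT (G : {group gT}) (X : fibset A G) (x : X) : stab x \subset G.
Proof. by apply/fintype.subsetP => g /stab_mem[]. Qed.

Lemma stab_in_M gT (G : {group gT}) (X : fibset A G) (x : X) : in_M G (stab_pair x).
Proof.
split; first exact: stab_sub.
split; last exact: stab_supported.
move=> g h sg sh /=.
have [Gg eg] := (stab_prel x g _).1 (prelI sg).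
have [Gh eh] := (stab_prel x h _).1 (prelI sh).
suff [] : prel (stab_pair x) (g * h) (stab_char x g * stab_char x h)%ab by [].
apply/stab_prel; rewrite groupM //; split=> //.
by rewrite -{1}(amul1a 1%ab) factM // eh factCA // eg fact_fact1 amulC.
Qed.

End Fib.

(** * Transitive fibered sets and tensor products *)

Section Trans.
Local Open Scope group_scope.
Variable A : abgroup.
Implicit Types gT hT kT : finGroupType.

Definition generates gT (G : {group gT}) (X : fibset A G) (x : X) :=
  forall y, exists g a, g \in G /\ y = fact g a x.

Lemma amulKV (a b : A) : (a * (ainv a * b))%ab = b.
Proof. by rewrite amulA amulaV amul1a. Qed.

Lemma fact_stabE gT (G : {group gT}) (X : fibset A G) (x : X) g a b : g \in G ->
  fact g a x = fact 1 b x <-> prel (stab_pair x) g (ainv a * b)%ab.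
Proof.
move=> Gg; rewrite stab_prel fact_mul1 //; split=> [e|[_ ->]].
  split=> //; rewrite -fact_fact1 -e fact_fact1 amulVa.
  by rewrite fact1.
by rewrite fact_fact1 amulKV.
Qed.

Lemma fact_eqE gT (G : {group gT}) (X : fibset A G) (x : X) g a h b :
  g \in G -> h \in G ->
  fact g a x = fact h b x <-> prel (stab_pair x) (h^-1 * g) (ainv a * b)%ab.
Proof.
move=> Gg Gh; rewrite -fact_stabE ?groupM ?groupV //; split=> e.
  apply: (@fact_inj _ _ _ _ h 1%ab) => //.
  by rewrite -!factM ?groupM ?group1 ?groupV // mulKVg mulg1 !amul1a.
have := congr1 (fact h 1%ab) e.
by rewrite -!factM ?groupM ?group1 ?groupV // mulKVg mulg1 !amul1a.
Qed.

(** The assignment g a x |-> g a y is well defined because, by [fact_eqE], coincidences among the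
    translates of x are read off from the graph of its stabilizing pair, which lies in that of y. *)
Lemma generated_map gT (G : {group gT}) (X Y : fibset A G) (x : X) (y : Y) :
  generates x -> (forall g a, prel (stab_pair x) g a -> prel (stab_pair y) g a) ->
  exists f : X -> Y, equivariant f /\ forall g a, g \in G -> f (fact g a x) = fact g a y.
Proof.
move=> gx sxy.
have [|f hf] := @boolp.choice X Y (fun z w => exists g a,
    [/\ g \in G, z = fact g a x & w = fact g a y]).
  by move=> z; have [g [a [Gg ez]]] := gx z; exists (fact g a y), g, a.
have fE g a : g \in G -> f (fact g a x) = fact g a y.
  move=> Gg; have [h [b [Gh e ->]]] := hf (fact g a x).
  by apply/fact_eqE => //; apply/sxy/fact_eqE.
exists f; split=> // g a z Gg; have [h [b [Gh ->]]] := gx z.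
by rewrite -factM // !fE ?groupM // factM.
Qed.

(** The orbit-stabilizer theorem for fibered sets. *)
Lemma generated_iso gT (G : {group gT}) (X Y : fibset A G) (x : X) (y : Y) :
  generates x -> generates y -> stab_pair x = stab_pair y -> fib_iso X Y.
Proof.
move=> gx gy e.
have [|f [fE fx]] := generated_map (y := y) gx; first by rewrite e.
have [|f' [_ fy]] := generated_map (y := x) gy; first by rewrite e.
exists f; split=> //; exists f' => z.
  by have [g [a [Gg ->]]] := gx z; rewrite fx // fy.
by have [g [a [Gg ->]]] := gy z; rewrite fy // fx.
Qed.

Section Base.
Variables (gT : finGroupType) (G : {group gT}) (P : gpair A gT) (PG : in_M G P).

Definition trans_base : trans_fib PG :=
  exist _ (coset_at P 1 1%ab) (ex_intro _ 1 (ex_intro _ 1%ab (conj (group1 G) erefl))).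

Lemma trans_base_act g a : g \in G -> sval (fact g a trans_base) = coset_at P g a.
Proof. by move=> Gg; rewrite trans_actE //= shift_coset mulg1 amula1. Qed.

Lemma trans_base_generates : generates trans_base.
Proof.
move=> [O [g [a [Gg eO]]]]; exists g, a; split=> //; apply: trans_inj.
by rewrite trans_base_act.
Qed.

Lemma hom1 : P.2 1 = 1%ab.
Proof.
have [_ [homP _]] := PG; have := homP 1 1 (group1 _) (group1 _); rewrite mulg1 => e.
by rewrite -[LHS]amul1a -(amulVa (P.2 1)) -amulA -e.
Qed.

(** The inverse in [coset_at] is what makes d in D act on the base point as phi(d) and not as its
    inverse. *)
Lemma stab_trans_base : stab_pair trans_base = P.
Proof.
apply: prel_ext; [exact: stab_supported|exact: (in_M_supported PG)|].
have [PsG [homP _]] := PG.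
move=> g b; rewrite stab_prel; split=> [[Gg]|[Pg <-]].
  move/(congr1 sval); rewrite !trans_base_act // => e.
  have : coset_at P g 1%ab (gindex g, 1%ab).
    by exists 1; rewrite ?group1 // mulg1 hom1 ainv1 amula1.
  rewrite e => -[d Pd [/(can_inj (gindexK (gT := gT))) ->]]; rewrite mul1g => e1.
  by split=> //; rewrite -[P.2 d]amul1a e1 -amulA amulVa amula1.
have Gg := fintype.subsetP PsG g Pg; split=> //; apply: trans_inj.
rewrite !trans_base_act //; apply: funext => p; apply: propext; split=> -[d Pd ->].
  exists (g * d); rewrite ?groupM // mul1g homP // ainvM.
  by rewrite amulA amulaV.
exists (g^-1 * d); rewrite ?groupM ?groupV // mulKVg mul1g amul1a.
congr (_, _).
have -> : P.2 d = (P.2 g * P.2 (g^-1 * d)%g)%ab by rewrite -homP ?groupM ?groupV // mulKVg.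
by rewrite ainvM amulA amulaV amul1a.
Qed.
End Base.

Section HFree.
Variables (gT hT : finGroupType) (G : {group gT}) (H : {group hT}).

(* Freeness of the action of H on the A-orbits of U. *)
Definition hfree (U : biset A G H) := forall u : U, k2 (stab u) = 1.

Lemma inX1 g : g \in G -> (g, 1) \in setX_group G H.
Proof. by move=> Gg; rewrite inE /= Gg group1. Qed.
Lemma in1X h : h \in H -> (1, h) \in setX_group G H.
Proof. by move=> Hh; rewrite inE /= Hh group1. Qed.

Variables (U : biset A G H) (kU : hfree U).

Lemma hfree_act (u : U) (h : hT) (a b : A) :
  h \in H -> fact (1, h) a u = fact 1 b u -> h = 1 /\ a = b.
Proof.
move=> Hh e.
suff h1 : h = 1 by move: e; rewrite h1 => /fact_injA.
have /fact_stabE[] := e; first exact: in1X.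
move=> s _; have : h \in k2 (stab u) by rewrite inE.
by rewrite kU => /set1gP.
Qed.

End HFree.

Section TensPt.
Variables (gT hT kT : finGroupType).
Variables (G : {group gT}) (H : {group hT}) (K : {group kT}).
Variables (U : biset A G H) (kU : hfree U) (V : biset A H K).

(** If a u (x) v = u (x) v, some (h, b) carries one pair to the other. Freeness of H on the A-orbits
    of U gives h = 1, then freeness of A on V gives b = 1, and so a = 1. Hence no orbit is discarded
    from the tensor product, and [tpt] is defined on all pairs (u, v). *)
Lemma hfree_tens_free (u : U) (v : V) : tens_free u v.
Proof.
move=> a e; have := tens_orb_refl (fact 1 a u) v.
rewrite e => -[h [b [Hh [eu ev]]]].
have [h1 eb] := hfree_act kU Hh (esym eu).
move: ev eb; rewrite h1 => /esym/ffree -> <-.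
by rewrite ainv1.
Qed.

Definition tpt (u : U) (v : V) : tens U V := tens_pt (@hfree_tens_free u v).

Lemma tpt_surj y : exists u v, y = tpt u v.
Proof.
case: y => O [u [v [fr eO]]]; exists u, v; apply: tens_inj; exact: eO.
Qed.

Lemma is_tens_tpt y u v : is_tens y u v <-> y = tpt u v.
Proof. by split=> [e|->] //; apply: tens_inj. Qed.

Lemma tpt_eq u v u' v' : tpt u v = tpt u' v' <->
  exists h a, [/\ h \in H, u' = fact (1, h) (ainv a) u & v' = fact (h, 1) a v].
Proof.
split=> [/(congr1 sval) /= e|[h [a [Hh -> ->]]]].
  have := tens_orb_refl u' v'; rewrite -e => -[h [a [Hh [-> ->]]]].
  by exists h, a.
apply: tens_inj => /=.
have := @tens_orbP _ _ _ _ _ _ _ U V u v (fact (1, h) (ainv a) u, fact (h, 1) a v).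
by move=> -> //; exists h, a.
Qed.

Lemma tpt_act g k a u v : g \in G -> k \in K ->
  fact (g, k) a (tpt u v) = tpt (fact (g, 1) a u) (fact (1, k) 1%ab v).
Proof.
move=> Gg Kk; have xGK : (g, k) \in setX_group G K by rewrite inE /= Gg Kk.
by apply: tens_inj; rewrite tens_actE //= tens_shift_orb.
Qed.

Lemma tpt_act1 a u v : fact 1 a (tpt u v) = tpt (fact 1 a u) v.
Proof.
rewrite [LHS](tpt_act a u v (group1 G) (group1 K)); congr tpt; exact: fact1.
Qed.

End TensPt.
End Trans.

(** * Stabilizing pairs of tensor products *)

Section TensStab.
Local Open Scope group_scope.
Variable A : abgroup.
Implicit Types gT hT kT : finGroupType.

Lemma pairM gT hT (g g' : gT) (h h' : hT) : (g, h) * (g', h') = (g * g', h * h').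
Proof. by []. Qed.

Lemma pairV gT hT (g : gT) (h : hT) : (g, h)^-1 = (g^-1, h^-1).
Proof. by []. Qed.

Lemma pair1 gT hT : 1 = (1, 1) :> gT * hT.
Proof. by []. Qed.

Definition pairE := (@pairV, @pairM, @invg1, @mul1g, @mulg1).

(** The element (g, k) preserves the A-orbit of u (x) v iff some h in H compensates the motion of u
    under g against that of v under k; the two scalars then multiply. *)
Lemma stab_tpt gT hT kT (G : {group gT}) (H : {group hT}) (K : {group kT})
    (U : biset A G H) (kU : hfree U) (V : biset A H K) (u : U) (v : V) :
  stab_pair (tpt kU u v) = star (stab_pair u) (stab_pair v).
Proof.
apply: prel_ext; [exact: stab_supported|exact: star_supported|].
move=> [g k] c; rewrite star_prel; last exact: kU.
have inG h : h \in H -> (1, h) \in setX_group G H by exact: in1X.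
have inH h : h \in H -> (h, 1) \in setX_group H K by exact: inX1.
have eu g' h d : g' \in G -> h \in H -> fact (g', 1) 1%ab u = fact (1, h) d u <->
    prel (stab_pair u) (g', h^-1) d.
  move=> Gg Hh; rewrite fact_eqE ?inG //; last exact: inX1.
  have -> : (1, h)^-1 * (g', 1) = (g', h^-1) :> gT * hT.
    by rewrite !pairE.
  by rewrite ainv1 amul1a.
have ev k' h d : k' \in K -> h \in H -> fact (1, k') 1%ab v = fact (h, 1) d v <->
    prel (stab_pair v) (h^-1, k') d.
  move=> Kk Hh; rewrite fact_eqE ?inH //; last exact: in1X.
  have -> : (h, 1)^-1 * (1, k') = (h^-1, k') :> hT * kT.
    by rewrite !pairE.
  by rewrite ainv1 amul1a.
rewrite stab_prel; split.
  case=> /setXP[Gg Kk].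
  rewrite tpt_act // tpt_act1 => /esym/tpt_eq[h [d [Hh]]].
  rewrite -factM ?inG ?group1 // mulg1 => /(eu _ _ _ Gg Hh) pu /(ev _ _ _ Kk Hh) pv.
  (* It is (1, h)^-1 (g, 1) = (g, h^-1) that stabilizes the A-orbit of u, so the middle element is
     h^-1. *)
  exists h^-1, (ainv d * c)%ab, d; split=> //.
  by rewrite amulC amulKV.
move=> [h [a [b [pu pv ->]]]].
have /stab_prel[/setXP[Gg Hh] _] := pu.
have /stab_prel[/setXP[_ Kk] _] := pv.
split; first exact/setXP.
rewrite tpt_act // tpt_act1; apply/esym/tpt_eq; exists h^-1, b; rewrite groupV Hh; split=> //.
  rewrite -factM ?inG ?groupV ?group1 // mulg1.
  by rewrite amulC -amulA amulaV amula1; apply/eu; rewrite ?groupV ?invgK.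
by apply/ev; rewrite ?groupV ?invgK.
Qed.

Section TensFib.
Variables (gT hT : finGroupType) (G : {group gT}) (H : {group hT}).
Variables (U : biset A G H) (kU : hfree U) (X : fibset A H).

Definition tp (u : U) (x : X) : tens_fib U X := tpt kU u (x : to_biset X).

Lemma tp_surj (y : tens_fib U X) : exists u x, y = tp u x.
Proof. exact: (tpt_surj kU y). Qed.

Lemma is_tens_tp (y : tens_fib U X) u x : is_tens_fib y u x <-> y = tp u x.
Proof. exact: (is_tens_tpt kU y u (x : to_biset X)). Qed.

Lemma tp_eq u x u' x' : tp u x = tp u' x' <->
  exists h a, [/\ h \in H, u' = fact (1, h) (ainv a) u & x' = fact h a x].
Proof. exact: (tpt_eq kU u (x : to_biset X) u' (x' : to_biset X)). Qed.

Lemma tp_act g a u x : g \in G -> fact g a (tp u x) = tp (fact (g, 1) a u) x.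
Proof.
move=> Gg; rewrite [LHS](tpt_act kU a u (x : to_biset X) Gg (group1 _)).
congr tpt; exact: fact1.
Qed.

Lemma tp_actA a u x : fact 1 a (tp u x) = tp u (fact 1 a x).
Proof.
rewrite tp_act //; apply/esym/tp_eq; exists 1, (ainv a); split=> //.
  by rewrite ainvK.
by rewrite fact_fact1 amulVa fact1.
Qed.

Lemma tp_inj u x x' : tp u x = tp u x' -> x = x'.
Proof.
move/tp_eq => [h [a [Hh e ->]]].
have [|-> /esym e1] := hfree_act kU (a := ainv a) (b := 1%ab) (u := u) Hh.
  by rewrite -e fact1.
by rewrite -[a]ainvK -e1 ainv1 fact1.
Qed.

Lemma stab_tp u x g c : prel (stab_pair (tp u x)) g c <->
  exists h a b, [/\ prel (stab_pair u) (g, h) a, prel (stab_pair x) h b & c = (a * b)%ab].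
Proof.
have e1 : prel (stab_pair (tp u x)) g c <-> prel (stab_pair (tpt kU u (x : to_biset X))) (g, 1) c.
  by rewrite !stab_prel inE /= group1 andbT.
rewrite e1 stab_tpt star_prel; last exact: kU.
have e2 h b : prel (stab_pair (x : to_biset X)) (h, 1) b <-> prel (stab_pair x) h b.
  by rewrite !stab_prel inE /= group1 andbT.
by split=> -[h [a [b [pu pv e]]]]; exists h, a, b; split=> //; apply/e2.
Qed.

End TensFib.

Lemma mem_p1 gT hT (D : {group gT * hT}) g : reflect (exists h, (g, h) \in D) (g \in p1 D).
Proof.
rewrite /p1 /= morphimEsub ?finset.subsetT //; apply: (iffP imsetP) => [[[a b] Dab ->]|[h Dgh]].
  by exists b.
by exists (g, h).
Qed.

Lemma mem_p2 gT hT (D : {group gT * hT}) h : reflect (exists g, (g, h) \in D) (h \in p2 D).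
Proof.
rewrite /p2 /= morphimEsub ?finset.subsetT //; apply: (iffP imsetP) => [[[a b] Dab ->]|[g Dgh]].
  by exists a.
by exists (g, h).
Qed.

Lemma stab_act gT (G : {group gT}) (X : fibset A G) (x : X) g a : g \in G ->
  stab_pair (fact g a x) = conj_pair g (stab_pair x).
Proof.
move=> Gg; apply: prel_ext; [exact: stab_supported|exact/conj_supported/stab_supported|].
move=> y b; rewrite conj_prel.
have e : y \in G ->
    fact y 1%ab (fact g a x) = fact 1 b (fact g a x) <-> prel (stab_pair x) (y ^ g) b.
  move=> Gy; rewrite -!factM ?group1 // fact_eqE ?groupM // mul1g amul1a.
  by rewrite (amulC b) amulA amulVa amul1a conjgE.
split=> [/stab_prel[Gy] /(e Gy) //|h]; apply/stab_prel.
have /stab_prel[+ _] := h; rewrite groupJr // => Gy.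
by split=> //; apply/e.
Qed.

Lemma trans_stab gT (G : {group gT}) (P : gpair A gT) (PG : in_M G P) (x : trans_fib PG) :
  exists2 g, g \in G & stab_pair x = conj_pair g P.
Proof.
have [g [a [Gg ->]]] := trans_base_generates x; exists g => //.
by rewrite stab_act // stab_trans_base.
Qed.

(** The Mackey formula with one term: since p_1(Q) is all of H, there is one double coset, so the
    tensor product of the base points generates. Its stabilizing pair is known from [stab_tpt], and
    [generated_iso] concludes. *)
Lemma tens_trans gT hT kT (G : {group gT}) (H : {group hT}) (K : {group kT})
    (P : gpair A (gT * hT)%type) (Q : gpair A (hT * kT)%type)
    (PM : in_M (setX_group G H) P) (QM : in_M (setX_group H K) Q)
    (SM : in_M (setX_group G K) (star P Q)) :
  (forall u : trans_fib PM, k2 (stab u) = 1) -> H \subset p1 Q.1 ->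
  fib_iso (tens (trans_fib PM) (trans_fib QM)) (trans_fib SM).
Proof.
move=> kU Q1; pose u := trans_base PM; pose v := trans_base QM.
apply: (@generated_iso _ _ _ _ _ (tpt (U := trans_fib PM) kU u v) (trans_base SM)); last first.
- by rewrite stab_tpt !stab_trans_base.
- exact: trans_base_generates.
move=> y; have [u' [v' ->]] := tpt_surj kU y.
have [[g h] [a [GHg eu']]] := trans_base_generates u'.
have [[h' k] [b [HKh ev']]] := trans_base_generates v'.
have /setXP[Gg Hh] := GHg; have /setXP[Hh' Kk] := HKh.
(* move the H-parts of u' and v' to v and absorb them in the stabilizer of v *)
have /(fintype.subsetP Q1)/mem_p1[l Ql] : h^-1 * h' \in H by rewrite groupM ?groupV.
have pv : prel (stab_pair v) (h^-1 * h', l) (Q.2 (h^-1 * h', l)).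
  by rewrite stab_trans_base.
set c := Q.2 _ in pv.
have /stab_prel[/setXP[_ Kl] ev] := pv.
(* Once h has been moved to the second factor, (h^-1 h', k) = (1, k l^-1)(h^-1 h', l) acts on v, and
   the last factor acts as the scalar c. *)
exists (g, k * l^-1), (a * b * c)%ab; split.
  by apply/setXP; rewrite Gg groupM ?groupV.
rewrite tpt_act ?groupM ?groupV //; apply/esym/tpt_eq; exists h, (b * c)%ab.
split=> //.
  rewrite eu' -factM; [|exact: in1X|exact: inX1].
  rewrite !pairE; congr fact.
  by rewrite amulC -(amulA a) -(amulA a) amulaV amula1.
have HKhl : (h^-1 * h', l) \in setX_group H K.
  by apply/setXP; rewrite Kl groupM ?groupV.
have HKk : (1, k * l^-1) \in setX_group H K by apply/in1X; rewrite groupM ?groupV.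
have HKh1 : (h, 1) \in setX_group H K by apply/inX1.
rewrite -factM // amula1 factA ?groupM // -ev ev' -factM ?groupM // amula1.
by rewrite !pairE mulKVg mulgKV.
Qed.
End TensStab.

(** * Systems of representatives *)

Section Reps.
Local Open Scope ring_scope.
Variables (X : Type) (E : X -> X -> Prop).

Definition reps (I : Type) (r : I -> X) : Prop :=
  (forall x, exists i, E x (r i)) /\ (forall i j, E (r i) (r j) -> i = j).

Hypotheses (E_sym : forall x y, E x y -> E y x)
  (E_trans : forall y x z, E x y -> E y z -> E x z).

(** From a list meeting every class, the entry of smallest index in each class is kept. *)
Lemma reps_exist n (r : 'I_n -> X) : (forall x, exists i, E x (r i)) ->
  exists m (s : 'I_m -> X), reps s.
Proof.
move=> rP.
pose first (i : 'I_n) := [forall j : 'I_n, (j < i)%N ==> `[< ~ E (r i) (r j) >]].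
have firstP i j : first i -> E (r i) (r j) -> (i <= j)%N.
  move=> /forallP/(_ j)/implyP h e; rewrite leqNgt; apply/negP => /h /asboolP; exact.
have first_ex x : exists i, first i /\ E x (r i).
  have [i0 e0] := rP x.
  have [i /asboolP ei imin] := @arg_minnP _ i0 (fun i => `[< E x (r i) >]) val (asboolT e0).
  exists i; split=> //; apply/forallP => j; apply/implyP => ji; apply/asboolP => e.
  by move: ji; rewrite ltnNge imin //; apply/asboolP; apply: E_trans e.
exists #|[pred i | first i]|, (fun k => r (enum_val k)); split=> [x|k l e].
  have [i [fi e]] := first_ex x; exists (enum_rank_in fi i).
  by rewrite enum_rankK_in.
have fk : first (enum_val k) := enum_valP k.
have fl : first (enum_val l) := enum_valP l.
apply/enum_val_inj/val_inj/eqP; rewrite eqn_leq.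
by rewrite (firstP _ _ fk e) (firstP _ _ fl (E_sym e)).
Qed.

(** Two systems of representatives are matched by a bijection of their index sets. The index types
    are arbitrary finite types so that pairs and disjoint unions of indices can serve later. *)
Lemma sum_reps (M : zmodType) (I J : finType) (r : I -> X) (s : J -> X)
    (P : X -> bool) (f : X -> M) : reps r -> reps s ->
  (forall x y, E x y -> P x = P y /\ f x = f y) ->
  \sum_(i | P (r i)) f (r i) = \sum_(j | P (s j)) f (s j).
Proof.
move=> [rE rI] [sE sI] fE.
have [h hP] := boolp.choice (fun j => rE (s j)).
have [k kP] := boolp.choice (fun i => sE (r i)).
rewrite (reindex h) /=; last first.
  exists k => i _.
    by apply: sI; apply: E_trans (E_sym (kP (h i))) (E_sym (hP i)).
  by apply: rI; apply: E_trans (E_sym (hP (k i))) (E_sym (kP i)).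
by apply: eq_big => [j|j _]; have [eP ef] := fE _ _ (hP j); rewrite ?eP ?ef.
Qed.
End Reps.

(** * Consequences of the axioms *)

Record admissible (A : abgroup) (GG : group_class) (SS : pair_family A) : Prop := {
  adm_M : family_in_M GG SS;
  adm_i : axiom_i GG SS; adm_ii : axiom_ii GG SS; adm_iii : axiom_iii GG SS;
  adm_iv : axiom_iv GG SS; adm_vi : axiom_vi GG SS; adm_vii : axiom_vii GG SS;
  adm_viii : axiom_viii GG SS; adm_k2 : condition_k2 GG SS }.

Section Adm.
Local Open Scope group_scope.
Variables (A : abgroup) (GG : group_class) (SS : pair_family A).
Hypothesis HS : admissible GG SS.
Implicit Types gT hT kT : finGroupType.
Notation SL := (S_lower GG SS).

Lemma eq_group gT (D E : {group gT}) : D =i E -> D = E.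
Proof. by move=> e; apply/val_inj/setP. Qed.

Lemma mem_conjG gT (L : {group gT}) x y : (y \in (L :^ x^-1)%G) = (y ^ x \in L).
Proof. exact: mem_conjgV. Qed.

Lemma conj_pairE (B : abgroup) gT (P : gpair B gT) g x :
  (conj_pair g P).2 x = P.2 (x ^ g).
Proof. exact: ffunE. Qed.

Lemma pairJ gT hT (g x : gT) (h y : hT) : (g, h) ^ (x, y) = (g ^ x, h ^ y).
Proof. by []. Qed.

Lemma mem_img gT hT (D : {group gT * hT}) (K : {group hT}) g :
  reflect (exists2 k, k \in K & (g, k) \in D) (g \in img_grp D K).
Proof. by rewrite inE; apply: exists_inP. Qed.

Lemma mem_coimg gT hT (D : {group gT * hT}) (K : {group gT}) h :
  reflect (exists2 k, k \in K & (k, h) \in D) (h \in coimg_grp K D).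
Proof. by rewrite inE; apply: exists_inP. Qed.

(** With k_2 = 1 the compatibility in axiom (iii) concerns only the element 1, where homomorphisms
    agree. *)
Lemma star_compat_k2 gT hT kT (P : gpair A (gT * hT)%type) (Q : gpair A (hT * kT)%type)
    G H K : in_M (setX_group G H) P -> in_M (setX_group H K) Q -> k2 P.1 = 1 ->
  star_compat P Q.
Proof.
move=> PM QM P1 h; rewrite inE P1 => /andP[/set1gP-> _].
by rewrite /phi2 /phi1 (hom1 PM) (hom1 QM) ainv1.
Qed.

Lemma SS_star gT hT kT (G : {group gT}) (H : {group hT}) (K : {group kT}) P Q :
  GG G -> GG H -> GG K -> SS G H P -> SS H K Q -> SS G K (star P Q).
Proof.
move=> gG gH gK SP SQ; apply: (adm_iii HS gG gH gK SP SQ).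
exact: star_compat_k2 (adm_M HS gG gH SP) (adm_M HS gH gK SQ) (adm_k2 HS gG gH SP).
Qed.

Lemma star_diagr gT hT (P : gpair A (gT * hT)%type) (K : {group hT}) :
  k2 P.1 = 1 -> supported P -> p2 P.1 \subset K -> star P (triv_pair (diag K)) = P.
Proof.
move=> P1 sP sK; apply: prel_ext => //; first exact: star_supported.
move=> [g k] c; rewrite star_prel //; split.
  by move=> [h [a [b [ph /diag_prel[<- _ ->] ->]]]]; rewrite amula1.
move=> ph; exists k, c, 1%ab; rewrite amula1; split=> //; apply/diag_prel; split=> //.
by apply: (fintype.subsetP sK); apply/mem_p2; exists g; case: ph.
Qed.

(** Translates between axiom (viii), which speaks of a star product with a diagonal, and the formula
    for F^+, which speaks of [cut_pair]. *)
Lemma cut_star gT hT (P : gpair A (gT * hT)%type) (K : {group gT}) :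
  supported P -> star (triv_pair (diag K)) P = cut_pair K P.
Proof.
move=> sP; apply: prel_ext; [exact: star_supported|exact: cut_supported|].
move=> [g k] c; rewrite star_prel ?k2_diag // cut_prel; split.
  by move=> [h [a [b [/diag_prel[<- Kg ->] ph ->]]]]; rewrite amul1a.
by move=> [/= Kg ph]; exists g, 1%ab, c; rewrite amul1a; split=> //; apply/diag_prel.
Qed.

Lemma p1_sub gT hT (G : {group gT}) (H : {group hT}) (P : gpair A (gT * hT)%type) :
  in_M (setX_group G H) P -> p1 P.1 \subset G.
Proof.
move=> [sP _]; apply/fintype.subsetP => g /mem_p1[h /(fintype.subsetP sP)].
by move=> /setXP[].
Qed.

Lemma p2_sub gT hT (G : {group gT}) (H : {group hT}) (P : gpair A (gT * hT)%type) :
  in_M (setX_group G H) P -> p2 P.1 \subset H.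
Proof.
move=> [sP _]; apply/fintype.subsetP => h /mem_p2[g /(fintype.subsetP sP)].
by move=> /setXP[].
Qed.

Section Lower.
Variables (gT hT : finGroupType) (G : {group gT}) (H : {group hT}).
Hypotheses (gG : GG G) (gH : GG H).
Implicit Types P : gpair A (gT * hT)%type.

Lemma SL_k2 P : SL G H P -> k2 P.1 = 1.
Proof. by move=> [_ g1 /(adm_k2 HS g1 gH)]. Qed.

(** From left to right, axiom (vii) for K = p_2(D) shrinks the target H to p_2(D) without changing
    the pair. Conversely, composing with the inclusion of p_2(D) into H, which is in S by (vi),
    enlarges the target again. *)
Lemma S_lower_upper P : SL G H P <-> S_upper GG SS G H P.
Proof.
split=> [[PM g1 SP]|[PM g1 g2 SP]].
  have [g2 /(_ _ (fintype.subxx _) g2)[gi Si]] := adm_vii HS g1 gH SP.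
  split=> //; move: Si; rewrite star_diagr //; last 2 first.
  - exact: (adm_k2 HS g1 gH SP).
  - exact: in_M_supported PM.
  congr (SS _ _ _); apply: eq_group => g; apply/mem_img/mem_p1 => [[k _ Pk]|[k Pk]].
    by exists k.
  by exists k => //; apply/mem_p2; exists g.
split=> //.
have := SS_star g1 g2 gH SP (adm_vi HS gH (p2_sub PM) g2).
rewrite star_diagr //; last exact: in_M_supported PM.
exact: (adm_k2 HS g1 g2 SP).
Qed.

Lemma SL_img P (K : {group hT}) : SL G H P -> K \subset H -> GG K ->
  GG (img_grp P.1 K) /\ SS (img_grp P.1 K) K (star P (triv_pair (diag K))).
Proof. by move=> [_ g1 SP]; exact: (adm_iv HS g1 gH SP). Qed.

Lemma SL_cut P (K : {group gT}) : SL G H P -> K \subset p1 P.1 -> GG K ->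
  GG (coimg_grp K P.1) /\ SS K (coimg_grp K P.1) (cut_pair K P).
Proof.
move=> [PM g1 SP] sK gK; rewrite -cut_star; last exact: in_M_supported PM.
by have [_ /(_ _ sK gK)] := adm_viii HS g1 gH SP.
Qed.
End Lower.

Lemma SS_conj_diag gT (G L : {group gT}) g : GG G -> L \subset G -> GG L -> g \in G ->
  GG (L :^ g^-1)%G /\ SS (L :^ g^-1)%G L (triv_pair (conj_diag g L)).
Proof.
move=> gG sL gL Gg.
(* axiom (vi) embeds L in G; conjugating the second factor then moves the image *)
have image (M : {group gT}) x : M \subset G -> GG M -> x \in G ->
    SS M G (triv_pair (conj_diag x^-1 (M :^ x^-1)%G)).
  move=> sM gM Gx; have SM := adm_vi HS gG sM gM.
  have := adm_ii HS gM gG (x := (1, x)) SM; rewrite inE /= group1 Gx => /(_ isT).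
  congr (SS _ _ _); apply: prel_ext.
  - exact/conj_supported/triv_supported.
  - exact: triv_supported.
  move=> [y z] a; rewrite conj_prel conj_diag_prel.
  rewrite pairJ conjg1 diag_prel invgK mem_conjgV.
  by split=> [[-> ? ->]|[-> ? ->]].
(* The range of this embedding is ^gL, which (vii) puts into [GG]. The corresponding embedding for
   ^gL and g^-1, cut down by (vii) to its range L, is the required isomorphism. *)
have S1 := image L g sL gL Gg.
have gLg : GG (L :^ g^-1)%G.
  have [+ _] := adm_vii HS gL gG S1; congr (GG _); apply: eq_group => y.
  apply/mem_p2/idP => [[z]|Ly]; first by rewrite mem_conj_diag => /andP[].
  by exists (y ^ g^-1^-1); rewrite mem_conj_diag eqxx.
have sLg : (L :^ g^-1)%G \subset G by rewrite /= -(conjGid (groupVr Gg)) conjSg.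
split=> //.
have := image _ g^-1 sLg gLg (groupVr Gg); rewrite !invgK.
have -> : ((L :^ g^-1) :^ g)%G = L by apply: val_inj; rewrite /= -conjsgM mulVg conjsg1.
move=> S2; have [_ /(_ L)[]//] := adm_vii HS gLg gG S2.
  apply/fintype.subsetP => y Ly; apply/mem_p2; exists (y ^ g^-1).
  by rewrite mem_conj_diag eqxx.
move=> gi; rewrite star_diagr ?k2_conj_diag //; last 2 first.
- exact: triv_supported.
- by apply/fintype.subsetP => y /mem_p2[z]; rewrite mem_conj_diag => /andP[].
congr (SS _ _ _); apply: eq_group => y; apply/mem_img/idP.
  by move=> [k Lk]; rewrite mem_conj_diag => /andP[/eqP-> _]; rewrite /= mem_conjgV conjgKV.
rewrite /= mem_conjgV => Ly; exists (y ^ g) => //.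
by rewrite mem_conj_diag conjgK eqxx.
Qed.

Section Lower2.
Variables (gT hT kT : finGroupType) (G : {group gT}) (H : {group hT}) (K : {group kT}).
Hypotheses (gG : GG G) (gH : GG H) (gK : GG K).

(** Axiom (ii) permits conjugation only within p_1(D) x H, whereas g ranges over G. So (ii) is used
    for (1, h) alone, and g is realised by composing with the conjugation isomorphism between p_1(D)
    and ^g p_1(D). *)
Lemma SL_conj (P : gpair A (gT * hT)%type) x : x \in setX_group G H ->
  SL G H P -> SL G H (conj_pair x P).
Proof.
case: x => g h /setXP[Gg Hh] SLP; have [PM g1 SP] := SLP.
have e : p1 (conj_pair (g, h) P).1 = (p1 P.1 :^ g^-1)%G.
  apply: eq_group => y; rewrite /= mem_conjgV; apply/mem_p1/mem_p1 => -[z].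
    by rewrite mem_conjgV => Pz; exists (z ^ h).
  move=> Pz; exists (z ^ h^-1); rewrite mem_conjgV.
  by rewrite pairJ conjgKV.
have [ge Se] := SS_conj_diag gG (p1_sub PM) g1 Gg.
have hM : in_M (setX_group G H) (conj_pair (g, h) P).
  have [sP [hP oP]] := PM; split.
    rewrite /= -(conjGid (groupVr (x := (g, h)) (G := setX_group G H) _)) ?conjSg //.
    exact/setXP.
  split=> [y z /=|]; last exact: conj_supported.
  by rewrite !mem_conjgV => Py Pz; rewrite !ffunE conjMg hP.
have s1 : (1, h) \in setX_group (p1 P.1) H by apply/setXP.
split=> //; rewrite e // .
have := SS_star ge g1 gH Se (adm_ii HS g1 gH SP s1).
congr (SS _ _ _); apply: prel_ext.
- exact: star_supported.
- exact: conj_supported (in_M_supported PM).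
move=> [y z] a; rewrite star_prel ?k2_conj_diag //.
split.
  move=> [w [b [c [/conj_diag_prel[-> Pw ->] /conj_prel]]]].
  rewrite pairJ conjg1 => pw ->; apply/conj_prel.
  by rewrite pairJ conjgKV amul1a.
move/conj_prel; rewrite pairJ => pw; exists (y ^ g), 1%ab, a.
rewrite amul1a; split=> //; last by apply/conj_prel; rewrite pairJ conjg1.
by apply/conj_diag_prel; rewrite conjgK; split=> //; apply/mem_p1; exists (z ^ h); case: pw.
Qed.

(** Q lies in S(p_1(Q), K), and p_1(Q) may be smaller than H. Axiom (iv) first cuts P down to
    p_1(Q); this does not change the product, and (iii) then applies. *)
Lemma SL_star (P : gpair A (gT * hT)%type) (Q : gpair A (hT * kT)%type) :
  in_M (setX_group G K) (star P Q) -> SL G H P -> SL H K Q -> SL G K (star P Q).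
Proof.
move=> SM SP [QM g1 SQ]; have [PM _ _] := SP.
have [gi Si] := SL_img gH SP (p1_sub QM) g1.
have P1 := SL_k2 gH SP.
have e : p1 (star P Q).1 = img_grp P.1 (p1 Q.1).
  apply: eq_group => g; apply/mem_p1/mem_img.
    move=> [k]; rewrite inE => /existsP[h /andP[Ph Qh]].
    by exists h => //; apply/mem_p1; exists k.
  move=> [h /mem_p1[k Qh] Ph]; exists k; rewrite inE; apply/existsP; exists h.
  exact/andP.
have S2 := SS_star gi g1 gK Si SQ.
split=> //; rewrite e //; move: S2; congr (SS _ _ _).
apply: prel_ext; [exact: star_supported|exact: star_supported|].
move=> [g k] c; rewrite !star_prel //; last exact: (adm_k2 HS gi g1 Si).
split=> [[h [a [b [/star_prel]]]]|[h [a [b [pP pQ ->]]]]].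
  move=> /(_ P1)[h' [a' [b' [pP /diag_prel[<- _ ->] ->]]]] pQ ->.
  by exists h', a', b; rewrite amula1.
exists h, a, b; split=> //; apply/star_prel => //; exists h, a, 1%ab.
rewrite amula1; split=> //; apply/diag_prel; split=> //; apply/mem_p1; exists k.
by case: pQ.
Qed.

Lemma SL_diag : SL G G (triv_pair (diag G)).
Proof.
have S1 := adm_i HS gG.
have e : p1 (diag G) = G.
  apply: eq_group => g; apply/mem_p1/idP => [[h]|Gg].
    by rewrite mem_diag => /andP[].
  by exists g; rewrite mem_diag eqxx.
by split; rewrite /= ?e //; exact: (adm_M HS gG gG S1).
Qed.

Lemma stab_in_trans (P : gpair A (gT * hT)%type) (PM : in_M (setX_group G H) P) :
  SL G H P -> stab_in SL (trans_fib PM).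
Proof. by move=> SP u; have [x Gx ->] := trans_stab u; exact: SL_conj. Qed.

Lemma stab_in_hfree (U : biset A G H) : stab_in SL U -> hfree U.
Proof. by move=> SU u; exact: (SL_k2 gH (SU u)). Qed.

Lemma stab_in_tens (U : biset A G H) (V : biset A H K) :
  stab_in SL U -> stab_in SL V -> stab_in SL (tens U V).
Proof.
move=> SU SV w; have kU := stab_in_hfree SU.
have [u [v ->]] := tpt_surj kU w.
by have := stab_in_M (tpt kU u v); rewrite stab_tpt => h; exact: SL_star.
Qed.
End Lower2.
End Adm.

(** * The maps F(P) and the section U(s) on a tensor product *)

Section FunctorBasics.
Local Open Scope ring_scope.
Variables (A : abgroup) (R : comPzRingType) (GG : group_class) (SS : pair_family A).
Hypothesis HS : admissible GG SS.
Variable F : functor R GG SS.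
Implicit Types gT hT kT : finGroupType.
Notation SL := (S_lower GG SS).

Lemma tclsE gT hT (G : {group gT}) (H : {group hT}) (P : gpair A (gT * hT)%type)
    (PM : in_M (setX_group G H) P) : tcls R G H P = cls R (trans_fib PM).
Proof.
by rewrite /tcls; case: pselect => // PM'; rewrite (Prop_irrelevance PM PM').
Qed.

Lemma is_mor_tcls (T : pair_family A) gT hT (G : {group gT}) (H : {group hT}) P :
  T gT hT G H P -> is_mor T (tcls R G H P).
Proof.
move=> SP; exists 1%N, (fun=> 1), (fun=> P); split=> //.
by rewrite big_ord1 scale1r.
Qed.

(** The functor law concerns tensor products of bisets; by [tens_trans] the product of these two
    transitive ones is again transitive, with pair [star P Q]. *)
Lemma fmapM gT hT kT (K : {group gT}) (L : {group hT}) (M : {group kT})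
    P Q T (x : fobj F M) : GG K -> GG L -> GG M -> SS K L P -> SS L M Q ->
  L \subset p1 Q.1 -> T = star P Q ->
  fmap F K L P (fmap F L M Q x) = fmap F K M T x.
Proof.
move=> gK gL gM SP SQ sL ->; have S2 := SS_star HS gK gL gM SP SQ.
have PM := adm_M HS gK gL SP; have QM := adm_M HS gL gM SQ.
have SM := adm_M HS gK gM S2.
rewrite /fmap -(functor_comp (functorP F)) //; try exact: is_mor_tcls.
congr (fmor _ _ _); rewrite (tclsE PM) (tclsE QM) (tclsE SM) compB_cls.
apply/cls_iso/tens_trans => // u; have [y KLy eu] := trans_stab u.
have := adm_k2 HS gK gL (adm_ii HS gK gL SP KLy); rewrite -eu; exact.
Qed.

Lemma fmap_id gT (K : {group gT}) (x : fobj F K) : GG K ->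
  fmap F K K (triv_pair (diag K)) x = x.
Proof. by move=> gK; exact: (functor_id (functorP F) gK). Qed.

Notation tagF K a := (existT (fun K : {group _} => fobj F K) K a).

(** Makes the equalities of dependent pairs in [gam_mor] usable: a map out of F(K) and F(L) brings
    both values into the same module. *)
Lemma tag_fmap gT kT (K L : {group gT}) (M : {group kT}) P (a : fobj F K)
  (b : fobj F L) : tagF K a = tagF L b -> fmap F M K P a = fmap F M L P b.
Proof. by move=> /(congr1 (fun z => fmap F M (tag z) P (tagged z))). Qed.

Lemma group_stab_act gT (G : {group gT}) (X : fibset A G) (x : X) g a :
  g \in G -> stab (fact g a x) = (stab x :^ g^-1)%G.
Proof. by move=> Gg; have := congr1 fst (stab_act x a Gg). Qed.

Lemma gsec_act gT (G : {group gT}) (X : gam F G) (x : X) g a : g \in G ->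
  gsec (fact g a x) = fconj F g (stab (fact g a x)) (stab x) (gsec x).
Proof.
move=> Gg; rewrite -(@gam_eq _ _ _ _ _ _ _ X g (ainv a) (fact g a x)) //.
by rewrite factK.
Qed.

Section Tens.
Variables (gT hT : finGroupType) (G : {group gT}) (H : {group hT}).
Hypotheses (gG : GG G) (gH : GG H).
Variables (U : biset A G H) (SU : stab_in SL U).
Let kU : hfree U := stab_in_hfree HS gH SU.
Notation sd u x := (star (stab_pair u) (triv_pair (diag (stab x)))).

Section Sec.
Variable X : gam F H.

Lemma stab_tp_img (u : U) (x : X) : stab (tp kU u x) = img_grp (stab u) (stab x).
Proof.
apply: eq_group => g; apply/idP/mem_img => [sg|[h sh sgh]].
  have /stab_tp[h [a [b [[pu _] [px _] _]]]] : prel (stab_pair (tp kU u x)) g _ := conj sg erefl.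
  by exists h.
have [//] : prel (stab_pair (tp kU u x)) g (stab_char u (g, h) * stab_char x h)%ab.
by apply/stab_tp; exists h, (stab_char u (g, h)), (stab_char x h).
Qed.

Lemma tp_SS (u : U) (x : X) :
  GG (stab (tp kU u x)) /\ SS (stab (tp kU u x)) (stab x) (sd u x).
Proof.
rewrite stab_tp_img.
exact: (SL_img HS gH (SU u) (stab_sub x) (gam_stab x)).
Qed.

Lemma sd_prel (u : U) (x : X) g h c :
  prel (sd u x) (g, h) c <-> prel (stab_pair u) (g, h) c /\ h \in stab x.
Proof.
rewrite star_prel; last exact: kU.
split=> [[k [a [b [pu /diag_prel[<- sk ->] ->]]]]|[pu sx]]; first by rewrite amula1.
by exists h, c, 1%ab; rewrite amula1; split=> //; apply/diag_prel.
Qed.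

Lemma sd_p1 (u : U) (x : X) : stab (tp kU u x) \subset p1 (sd u x).1.
Proof.
rewrite stab_tp_img; apply/fintype.subsetP => g /mem_img[h sh sgh].
apply/mem_p1; exists h; have [//] : prel (sd u x) (g, h) (stab_char u (g, h)).
by apply/sd_prel.
Qed.

(** The value U(s)(u (x) x). The group K is kept independent of u and x so that the values for
    different representations of one point lie in the same module. *)
Definition tens_val (K : {group gT}) (u : U) (x : X) : fobj F K :=
  fmap F K (stab x) (sd u x) (gsec x).

(** Two representations of a point differ by some h in H. The equivariance of s makes s(x') the
    h-conjugate of s(x), and composing the pair of (u', x') with this conjugation gives back the
    pair of (u, x). *)
Lemma tens_val_eq u x u' x' : tp kU u x = tp kU u' x' ->
  tens_val (stab (tp kU u x)) u x = tens_val (stab (tp kU u x)) u' x'.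
Proof.
move=> e; have [g1 S1] := tp_SS u' x'; rewrite -e in g1 S1.
have /tp_eq[h [a [Hh eu ex]]] := e.
have es : stab x' = (stab x :^ h^-1)%G by rewrite ex group_stab_act.
have [gx Sx] := SS_conj_diag HS gH (stab_sub x) (gam_stab x) Hh.
rewrite -es in gx Sx.
rewrite /tens_val (_ : gsec x' = fconj F h (stab x') (stab x) (gsec x)); last first.
  by move: es; rewrite ex => es; rewrite [LHS]gsec_act.
rewrite (fmapM _ g1 gx (gam_stab x) S1 Sx _ erefl); last first.
  rewrite es; apply/fintype.subsetP => y; rewrite mem_conjG => sy.
  by apply/mem_p1; exists (y ^ h)%g; rewrite mem_conj_diag conjgK eqxx.
congr (fmap _ _ _ _ _); apply: prel_ext; [exact: star_supported|exact: star_supported|].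
have H1h : (1%g, h) \in setX_group G H by exact: in1X.
move=> [g k] c; rewrite sd_prel star_prel; last exact: (adm_k2 HS g1 gx S1).
split=> [[pu sk]|[l [b [d [/sd_prel[pu sl] /conj_diag_prel[e1 sk ->] ->]]]]].
  exists (k ^ h^-1)%g, c, 1%ab; rewrite amula1; split=> //.
    rewrite sd_prel es mem_conjG conjgKV; split=> //.
    by rewrite eu stab_act // conj_prel pairJ conjg1 conjgKV.
  exact/conj_diag_prel.
rewrite amula1; split=> //; move: pu; rewrite e1 eu stab_act //.
by rewrite conj_prel pairJ conjg1 conjgKV.
Qed.

Lemma tsec_exists : exists t : forall y : tens_fib U X, fobj F (stab y),
  forall u x, t (tp kU u x) = tens_val _ u x.
Proof.
have h (y : tens_fib U X) : exists t : fobj F (stab y), forall u x,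
    y = tp kU u x -> t = tens_val _ u x.
  have [u [x ->]] := tp_surj kU y; exists (tens_val _ u x) => u' x' e.
  exact: tens_val_eq.
exists (fun y => sval (cid (h y))) => u x.
exact: (svalP (cid (h (tp kU u x)))).
Qed.

Definition tsec : forall y : tens_fib U X, fobj F (stab y) := sval (cid tsec_exists).

Lemma tsec_tp u x : tsec (tp kU u x) = tens_val _ u x.
Proof. exact: (svalP (cid tsec_exists)). Qed.

Lemma tsec_stab (y : tens_fib U X) : GG (stab y).
Proof. by have [u [x ->]] := tp_surj kU y; have [] := tp_SS u x. Qed.

Lemma tsec_gam_eq g a (y : tens_fib U X) : g \in G ->
  fconj F g (stab y) (stab (fact g^-1%g a y)) (tsec (fact g^-1%g a y)) = tsec y.
Proof.
move=> Gg; have Gg' : g^-1%g \in G by rewrite groupV.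
have G1g : (g^-1%g, 1%g) \in setX_group G H by exact: inX1.
have [u [x ->]] := tp_surj kU y.
have gw := tsec_stab (fact g^-1%g a (tp kU u x)).
have es := group_stab_act (tp kU u x) a Gg'.
have [g1 S1] := tp_SS u x.
have := SS_conj_diag HS gG (stab_sub (fact g^-1%g a (tp kU u x))) gw Gg.
have -> : ((stab (fact g^-1%g a (tp kU u x))) :^ g^-1)%G = stab (tp kU u x).
  by apply: val_inj; rewrite es /= invgK -conjsgM mulgV conjsg1.
case=> _ Sc.
rewrite tp_act // in gw es Sc *.
have [g2 S2] := tp_SS (fact (g^-1%g, 1%g) a u) x.
rewrite !tsec_tp /tens_val (fmapM _ g1 gw (gam_stab x) Sc S2 _ erefl); last exact: sd_p1.
congr (fmap _ _ _ _ _); apply: prel_ext; [exact: star_supported|exact: star_supported|].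
move=> [k h] c; rewrite star_prel ?k2_conj_diag // sd_prel.
have ep l : prel (stab_pair (fact (g^-1%g, 1%g) a u)) (l, h) c <->
            prel (stab_pair u) ((l ^ g^-1)%g, h) c.
  by rewrite stab_act // conj_prel pairJ conjg1.
split.
  move=> [l [b [d [/conj_diag_prel[-> _ ->] /sd_prel[pu sh] ->]]]].
  by rewrite amul1a; split=> //; move: pu; rewrite stab_act // conj_prel pairJ conjg1.
move=> [pu sh]; exists (k ^ g)%g, 1%ab, c; rewrite amul1a; split=> //.
  apply/conj_diag_prel; rewrite conjgK es mem_conjG conjgK; split=> //.
  by rewrite stab_tp_img; apply/mem_img; exists h => //; case: pu.
by apply/sd_prel; split=> //; apply/ep; rewrite conjgK.
Qed.

(** The object (U (x) X, U(s)), whose class is F_+([U])([X, s]). *)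
Definition tgam : gam F G := Gam tsec_stab tsec_gam_eq.
End Sec.
End Tens.
End FunctorBasics.

(** * The functor F_+ *)

Section PointMap.
Variables (I Y Z : Type) (p : I -> Y) (q : I -> Z).
Hypothesis pS : forall y, exists i, y = p i.

(** Defines maps on tensor products by representatives: p is (u, x) |-> u (x) x, or its analogue for
    triples. *)
Lemma point_map : (forall i j, p i = p j -> q i = q j) ->
  exists T : Y -> Z, forall i, T (p i) = q i.
Proof.
move=> wd; have [T TP] := boolp.choice (fun y => pS y).
by exists (fun y => q (T y)) => i; apply/wd/esym/TP.
Qed.

Lemma point_map_inj (T : Y -> Z) : (forall i, T (p i) = q i) ->
  (forall i j, q i = q j -> p i = p j) -> injective T.
Proof.
move=> TE qi y y'; have [i ->] := pS y; have [j ->] := pS y'.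
by rewrite !TE => /qi.
Qed.
End PointMap.

Section Plus.
Local Open Scope ring_scope.
Variables (A : abgroup) (R : comPzRingType) (GG : group_class) (SS : pair_family A).
Hypothesis HS : admissible GG SS.
Variable F : functor R GG SS.
Implicit Types gT hT kT : finGroupType.
Notation SL := (S_lower GG SS).
Notation tagF K a := (existT (fun K : {group _} => fobj F K) K a).

Lemma stab_pair_inj gT (G : {group gT}) (X Y : fibset A G) (f : X -> Y) (x : X) :
  equivariant f -> injective f -> stab_pair (f x) = stab_pair x.
Proof.
move=> fE fI; apply: prel_ext; try exact: stab_supported.
move=> g a; rewrite !stab_prel; split=> -[Gg e]; split=> //.
  by apply: fI; rewrite !fE.
by rewrite -!fE // e.
Qed.

Lemma tag_cong gT hT (K K' : {group gT}) (L : {group hT}) P P' (s : fobj F L) :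
  K = K' -> P = P' -> tagF K (fmap F K L P s) = tagF K' (fmap F K' L P' s).
Proof. by move=> -> ->. Qed.

Lemma gam_rel_cls gT (G : {group gT}) (X : gam F G) Xs : gam_rel X Xs ->
  gam_cls X = \sum_(Y <- Xs) gam_cls Y.
Proof. by move=> h; rewrite [LHS](pgen_rel _ h). Qed.

Section Two.
Variables (gT hT : finGroupType) (G : {group gT}) (H : {group hT}).
Hypotheses (gG : GG G) (gH : GG H).
Notation tg SU X := (tgam HS gG gH SU X).
Notation kf SU := (stab_in_hfree HS gH SU).
Notation pt SU u x := (tp (kf SU) u x).

(** Functoriality of U (x) X in both arguments. Injectivity of f preserves the stabilizing pairs in
    U, on which the section U(s) depends. *)
Lemma tgam_map (U U' : biset A G H) (SU : stab_in SL U) (SU' : stab_in SL U')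
    (X X' : gam F H) (f : U -> U') (i : X -> X') :
  equivariant f -> injective f -> gam_mor i ->
  exists T : tg SU X -> tg SU' X', [/\ gam_mor T,
    (forall u x, T (pt SU u x) = pt SU' (f u) (i x)) & injective i -> injective T].
Proof.
move=> fE fI [iE iT].
pose p (w : U * X) : tg SU X := pt SU w.1 w.2.
pose q (w : U * X) : tg SU' X' := pt SU' (f w.1) (i w.2).
have pS y : exists w, y = p w.
  by have [u [x ->]] := tp_surj (kf SU) y; exists (u, x).
have [T TE] : exists T : tg SU X -> tg SU' X', forall w, T (p w) = q w.
  apply: point_map => // -[u x] [u' x'] /tp_eq[h [a [Hh /= -> ->]]].
  by apply/tp_eq; exists h, a; rewrite fE ?iE //; exact: in1X.
have TE' u x : T (pt SU u x) = pt SU' (f u) (i x) by exact: (TE (u, x)).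
exists T; split=> //; last first.
  move=> iI; apply: (point_map_inj pS TE) => -[u x] [u' x'] /tp_eq[h [a [Hh /=]]].
  rewrite -fE; last exact: in1X.
  by rewrite -iE // => /fI -> /iI ->; apply/tp_eq; exists h, a.
split=> [g a y Gg|y].
  have [[u x] ->] := pS y; rewrite TE [LHS](_ : _ = T (pt SU (fact (g, 1%g) a u) x)).
    by rewrite TE' fE ?tp_act //; exact: inX1.
  by congr T; exact: tp_act.
have [[u x] ->] := pS y; rewrite TE /p /q /=.
rewrite !tsec_tp.
have e := stab_pair_inj u fE fI.
have es : stab (f u) = stab u by exact: (congr1 fst e).
have ex := congr1 (fun z => tag z) (iT x); rewrite /= in ex.
have eK : stab (pt SU u x) = stab (pt SU' (f u) (i x)).
  by rewrite !stab_tp_img es -ex.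
rewrite /tens_val e -eK.
(* The group and the value over it can only be replaced together, so the equality [iT x] is pushed
   through a function of the whole dependent pair. *)
exact: (congr1 (fun z => existT _ (stab (pt SU u x)) (fmap F (stab (pt SU u x)) (tag z)
    (star (stab_pair u) (triv_pair (diag (tag z)))) (tagged z))) (iT x)).
Qed.

Lemma tgam_scale (U : biset A G H) (SU : stab_in SL U) r (X : gam F H) :
  tg SU (gam_scale r X) = gam_scale r (tg SU X).
Proof.
apply: gam_ext => y /=; have [u [x ->]] := tp_surj (kf SU) y.
rewrite [LHS](tsec_tp HS gH SU (X := gam_scale r X)).
by rewrite [in RHS]tsec_tp /tens_val linearZ.
Qed.

Lemma id_gam_mor gT' (G' : {group gT'}) (X : gam F G') : gam_mor (id : X -> X).
Proof. by []. Qed.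

(** Tensoring with U preserves isomorphisms and disjoint unions, and the maps F(P) are additive;
    these are the three relations. *)
Lemma tgam_rel (U : biset A G H) (SU : stab_in SL U) (X : gam F H) Xs :
  gam_rel X Xs -> gam_cls (tg SU X) = \sum_(Y <- Xs) gam_cls (tg SU Y).
Proof.
case=> [{}X Y f fM fB|{}X Y Z i j iM jM ijB|{}X s r t sK rK tK sE rE tE e].
- have [T [TM TE TI]] := tgam_map SU SU (@id_equivariant _ _ _ U) (@id_inj _) fM.
  rewrite big_seq1 [LHS](gam_rel_cls (gam_rel_iso TM _)) ?big_seq1 //.
  apply: inj_surj_bij => [|y]; first exact: TI (bij_inj fB).
  have [u [x ->]] := tp_surj (kf SU) y; have [g fK gK] := fB.
  by exists (pt SU u (g x)); rewrite TE gK.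
- have [T [TM TE TI]] := tgam_map SU SU (@id_equivariant _ _ _ U) (@id_inj _) iM.
  have [T' [TM' TE' TI']] := tgam_map SU SU (@id_equivariant _ _ _ U) (@id_inj _) jM.
  rewrite [LHS](gam_rel_cls (gam_rel_sum TM TM' _)) ?big_cons ?big_nil //.
  have ijI := bij_inj ijB; have [ij _ ijK] := ijB.
  have iI : injective i by move=> x x' e; have [] : inl x = inl x' :> X + Y by apply: ijI.
  have jI : injective j by move=> x x' e; have [] : inr x = inr x' :> X + Y by apply: ijI.
  have disj y y' : T y <> T' y'.
    have [u [x ->]] := tp_surj (kf SU) y; have [u' [x' ->]] := tp_surj (kf SU) y'.
    rewrite TE TE' => /tp_eq[h [a [Hh _]]]; have [iE _] := iM; rewrite -iE // => e'.
    by have : inl (fact h a x) = inr x' :> X + Y by apply: ijI.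
  apply: inj_surj_bij => [[y|y] [y'|y']|y].
  + by move=> /(TI iI) ->.
  + by move=> /disj.
  + by move=> /esym/disj.
  + by move=> /(TI' jI) ->.
  have [u [x ->]] := tp_surj (kf SU) y; rewrite -(ijK x).
  by case: (ij x) => z; [exists (inl (pt SU u z))|exists (inr (pt SU u z))];
    rewrite ?TE ?TE'.
- rewrite [LHS](@gam_rel_cls _ _ _ [:: tg SU (Gam sK sE); tg SU (Gam rK rE)]).
    by rewrite !big_cons !big_nil.
  suff h y : tsec HS gH SU (X := Gam tK tE) y =
      tsec HS gH SU (X := Gam sK sE) y + tsec HS gH SU (X := Gam rK rE) y.
    by apply: gam_rel_add h.
  have [u [x ->]] := tp_surj (kf SU) y.
  rewrite (tsec_tp HS gH SU (X := Gam tK tE)) (tsec_tp HS gH SU (X := Gam sK sE)).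
  by rewrite (tsec_tp HS gH SU (X := Gam rK rE)) /tens_val /= e linearD.
Qed.

(** The lift is taken over the integers because F_+ is presented as an abelian group; compatibility
    with R is [plus_mapZ]. *)
Definition plus_map (U : biset A G H) (SU : stab_in SL U) (c : F_plus F H) : F_plus F G :=
  plift (fun X => gam_cls (tg SU X) : presented int (@gam_rel _ _ _ _ F _ G)) c.

Section OneMap.
Variables (U : biset A G H) (SU : stab_in SL U).
Let rel := @tgam_rel U SU.

Lemma plus_map_cls X : plus_map SU (gam_cls X) = gam_cls (tg SU X).
Proof. by rewrite /plus_map [LHS]plift_gen // => ? ? /rel. Qed.

Lemma plus_mapD : {morph plus_map SU : c d / c + d}.
Proof. by move=> c d; rewrite /plus_map [LHS]pliftD // => ? ? /rel. Qed.

Lemma plus_map0 : plus_map SU 0 = 0.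
Proof. by rewrite /plus_map [LHS]plift0 // => ? ? /rel. Qed.

Lemma plus_mapN c : plus_map SU (- c) = - plus_map SU c.
Proof. by apply/eqP; rewrite -addr_eq0 -plus_mapD addNr plus_map0. Qed.

Lemma scale_cls gT' (G' : {group gT'}) r (X : gam F G') :
  r *: (gam_cls X : F_plus F G') = gam_cls (gam_scale r X).
Proof. exact: fplus_scale_cls. Qed.

Lemma plus_mapZ r c : plus_map SU (r *: c) = r *: plus_map SU c.
Proof.
elim/fplus_ind: c => [X||c d IH IH'|c IH].
- by rewrite scale_cls !plus_map_cls scale_cls tgam_scale.
- by rewrite scaler0 plus_map0 scaler0.
- by rewrite scalerDr !plus_mapD IH IH' scalerDr.
- by rewrite scalerN !plus_mapN IH scalerN.
Qed.
End OneMap.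

Lemma plus_map_iso (U U' : biset A G H) (SU : stab_in SL U) (SU' : stab_in SL U') c :
  fib_iso U U' -> plus_map SU c = plus_map SU' c.
Proof.
move=> [f [fE [f' fK f'K]]]; have fI := can_inj fK.
elim/fplus_ind: c => [X||c d IH IH'|c IH].
- rewrite !plus_map_cls.
  have [T [TM TE TI]] := tgam_map SU SU' fE fI (id_gam_mor X).
  rewrite [LHS](gam_rel_cls (gam_rel_iso TM _)) ?big_seq1 //.
  apply: inj_surj_bij => [|y]; first exact: TI.
  have [u [x ->]] := tp_surj (kf SU') y.
  by exists (pt SU (f' u) x); rewrite TE f'K.
- by rewrite !plus_map0.
- by rewrite !plus_mapD IH IH'.
- by rewrite !plus_mapN IH.
Qed.

Lemma plus_map_sum (U V : biset A G H) (SU : stab_in SL U) (SV : stab_in SL V)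
    (SUV : stab_in SL (sum_fib U V)) c :
  plus_map SUV c = plus_map SU c + plus_map SV c.
Proof.
elim/fplus_ind: c => [X||c d IH IH'|c IH].
- rewrite !plus_map_cls.
  have [T [TM TE TI]] := tgam_map SU SUV (@inl_equivariant _ _ _ U V)
    (@inl_inj' _ _) (id_gam_mor X).
  have [T' [TM' TE' TI']] := tgam_map SV SUV (@inr_equivariant _ _ _ U V)
    (@inr_inj' _ _) (id_gam_mor X).
  rewrite [LHS](gam_rel_cls (gam_rel_sum TM TM' _)) ?big_cons ?big_nil ?addr0 //.
  have disj y y' : T y <> T' y'.
    have [u [x ->]] := tp_surj (kf SU) y; have [u' [x' ->]] := tp_surj (kf SV) y'.
    by rewrite TE TE' => /tp_eq[h [a [Hh]]].
  apply: inj_surj_bij => [[y|y] [y'|y']|y].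
  + by move=> /TI ->.
  + by move=> /disj.
  + by move=> /esym/disj.
  + by move=> /TI' ->.
  have [[u|v] [x ->]] := tp_surj (kf SUV) y.
    by exists (inl (pt SU u x)); rewrite TE.
  by exists (inr (pt SV v x)); rewrite TE'.
- by rewrite !plus_map0 addr0.
- by rewrite !plus_mapD IH IH' addrACA.
- by rewrite !plus_mapN IH opprD.
Qed.
End Two.

(** The isomorphism is x |-> u0 (x) x. As (g, g) fixes u0, it is equivariant; and (g, h) u0 = (g
    h^-1, 1) u0 gives surjectivity. *)
Lemma plus_map_id gT (G : {group gT}) (gG : GG G) (U : biset A G G)
    (SU : stab_in SL U) (u0 : U) c : generates u0 ->
  stab_pair u0 = triv_pair (diag G) -> plus_map gG gG SU c = c.
Proof.
move=> u0G u0S; pose kU := stab_in_hfree HS gG SU.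
have u0E g : g \in G -> fact (g, g) 1%ab u0 = u0.
  move=> Gg; have /stab_prel[_ ->] : prel (stab_pair u0) (g, g) 1%ab.
    by rewrite u0S; apply/diag_prel.
  exact: fact1.
elim/fplus_ind: c => [X||c d IH IH'|c IH].
- rewrite plus_map_cls; pose T (x : X) : tgam HS gG gG SU X := tp kU u0 x.
  have TE : equivariant T.
    move=> g a x Gg; rewrite /T [RHS](tp_act kU a u0 x Gg).
    apply/esym/tp_eq; exists g, a; split=> //.
    rewrite -factM; [|exact: in1X|exact: inX1].
    by rewrite amulVa !pairE u0E.
  have TM : gam_mor T.
    split=> // x; rewrite [in RHS]/T [in RHS](_ : gsec _ = tens_val _ u0 x); last exact: tsec_tp.
    rewrite -[in LHS](fmap_id (gsec x) (gam_stab x)); apply: tag_cong.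
      rewrite stab_tp_img; apply: eq_group => g.
      have -> : stab u0 = diag G by exact: (congr1 fst u0S).
      apply/idP/mem_img => [sg|[h sh]]; last by rewrite mem_diag => /andP[/eqP->].
      by exists g => //; rewrite mem_diag eqxx (fintype.subsetP (stab_sub x)).
    apply: prel_ext; [exact: triv_supported|exact: star_supported|].
    move=> [g h] a; rewrite sd_prel // u0S !diag_prel.
    split=> [[-> sh ->]|[[-> _ ->] sh]] //; split=> //; split=> //.
    exact: (fintype.subsetP (stab_sub x)).
  rewrite [RHS](gam_rel_cls (gam_rel_iso TM _)) ?big_seq1 //.
  apply: inj_surj_bij => [x x' /tp_inj //|y].
  have [u [x ->]] := tp_surj kU y; have [[g h] [a [/setXP[Gg Gh] ->]]] := u0G u.
  exists (fact (g * h^-1)%g a x); rewrite TE ?groupM ?groupV // [LHS]tp_act ?groupM ?groupV //.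
  congr tp; rewrite -[in LHS](u0E h) // -factM ?amula1.
  + by rewrite !pairE mulgKV.
  + by apply: inX1; rewrite groupM ?groupV.
  + exact/setXP.
- exact: plus_map0.
- by rewrite plus_mapD IH IH'.
- by rewrite plus_mapN IH.
Qed.

Section Comp.
Variables (gT hT kT : finGroupType) (G : {group gT}) (H : {group hT}) (K : {group kT}).
Hypotheses (gG : GG G) (gH : GG H) (gK : GG K).
Variables (U : biset A G H) (V : biset A H K).
Variables (SU : stab_in SL U) (SV : stab_in SL V) (SW : stab_in SL (tens U V)).
Let kU := stab_in_hfree HS gH SU.
Let kV := stab_in_hfree HS gK SV.
Let kW := stab_in_hfree HS gK SW.

(** Associativity on representatives: the two maps from triples to the iterated tensor products have
    the same fibres, so [point_map] turns them into a bijection. *)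
Lemma tp_tpt_eq (X : fibset A K) u v (x : X) u' v' x' :
  tp kW (tpt kU u v) x = tp kW (tpt kU u' v') x' <->
  tp kU u (tp kV v x) = tp kU u' (tp kV v' x').
Proof.
have in1U h : h \in H -> (1%g, h) \in setX_group G H by exact: in1X.
have inV1 h : h \in H -> (h, 1%g) \in setX_group H K by exact: inX1.
have in1V k : k \in K -> (1%g, k) \in setX_group H K by exact: in1X.
split=> /tp_eq.
  move=> [k [b [Kk + ->]]].
  rewrite [fact _ _ _](tpt_act kU (ainv b) u v (group1 G) Kk) => /esym/tpt_eq[h [a [Hh -> ->]]].
  apply/tp_eq; exists h, (a * b)%ab; split=> //.
    by rewrite ainvM -factM ?in1U ?group1 // mulg1.
  rewrite tp_act //; apply/esym/tp_eq; exists k, b; split=> //.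
  by rewrite -!factM ?in1V ?inV1 // !pairE amula1 (amulC _ (a * b)%ab) -amulA amulaV amula1.
move=> [h [d [Hh -> e]]]; move: e; rewrite tp_act // => /esym/tp_eq[k [b [Kk -> ->]]].
apply/tp_eq; exists k, b; split=> //.
rewrite [RHS](tpt_act kU (ainv b) u v (group1 G) Kk).
apply/esym/tpt_eq; exists h, (d * ainv b)%ab; split=> //.
  by rewrite -factM ?in1U ?group1 // mulg1 ainvM ainvK -amulA amulaV amula1.
by rewrite -!factM ?in1V ?inV1 // !pairE amula1 amulC.
Qed.

Lemma plus_map_comp c :
  plus_map gG gK SW c = plus_map gG gH SU (plus_map gH gK SV c).
Proof.
elim/fplus_ind: c => [X||c d IH IH'|c IH].
- rewrite !plus_map_cls.
  pose p (w : U * V * X) : tgam HS gG gK SW X := tp kW (tpt kU w.1.1 w.1.2) w.2.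
  pose q (w : U * V * X) : tgam HS gG gH SU (tgam HS gH gK SV X) :=
    tp kU w.1.1 (tp kV w.1.2 w.2).
  have pS y : exists w, y = p w.
    have [w [x ->]] := tp_surj kW y; have [u [v ->]] := tpt_surj kU w.
    by exists (u, v, x).
  have [T TE] : exists T, forall w, T (p w) = q w.
    by apply: point_map => // -[[u v] x] [[u' v'] x'] /tp_tpt_eq.
  rewrite [LHS](gam_rel_cls (gam_rel_iso (f := T) _ _)) ?big_seq1 //; last first.
    apply: inj_surj_bij => [|y].
      by apply: (point_map_inj pS TE) => -[[u v] x] [[u' v'] x'] /tp_tpt_eq.
    have [u [w ->]] := tp_surj kU y; have [v [x ->]] := tp_surj kV w.
    by exists (p (u, v, x)).
  split=> [g a y Gg|y]; have [[[u v] x] ->] := pS y; rewrite TE.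
    rewrite [X in T X](_ : _ = p (fact (g, 1%g) a u, v, x)).
      by rewrite TE; exact/esym/tp_act.
    rewrite [LHS](tp_act kW) // /p /=; congr tp.
    rewrite [LHS](tpt_act kU a u v Gg (group1 K)); congr tpt; exact: fact1.
  rewrite /p /q /=.
  rewrite (tsec_tp HS gK SW) (tsec_tp HS gH SU (X := tgam HS gH gK SV X) u (tp kV v x)).
  rewrite /tens_val /= tsec_tp /tens_val.
  have [g1 S1] := tp_SS HS gH SU (X := tgam HS gH gK SV X) u (tp kV v x).
  have [g2 S2] := tp_SS HS gK SV v x.
  rewrite (fmapM HS _ g1 g2 (gam_stab x) S1 S2 _ erefl); last exact: sd_p1.
  apply: tag_cong.
    apply: eq_group => g; apply/idP/idP => sg.
      have : prel (stab_pair (tp kW (tpt kU u v) x)) g _ := conj sg erefl.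
      move=> /stab_tp[k [a [b [+ px _]]]]; rewrite stab_tpt star_prel; last exact: kU.
      move=> [h [a' [b' [pu pv _]]]].
      have [//] : prel (stab_pair (tp kU u (tp kV v x))) g (a' * (b' * b))%ab.
      by apply/stab_tp; exists h, a', (b' * b)%ab; split=> //; apply/stab_tp; exists k, b', b.
    have : prel (stab_pair (tp kU u (tp kV v x))) g _ := conj sg erefl.
    move=> /stab_tp[h [a [b [pu /stab_tp[k [a' [b' [pv px _]]]] _]]]].
    have [//] : prel (stab_pair (tp kW (tpt kU u v) x)) g (a * a' * b')%ab.
    apply/stab_tp; exists k, (a * a')%ab, b'; split=> //.
    by rewrite stab_tpt star_prel; [exists h, a, a'|exact: kU].
  apply: prel_ext; [exact: star_supported|exact: star_supported|].
  move=> [g k] c; rewrite sd_prel // stab_tpt [in X in _ <-> X]star_prel; last first.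
    exact: (adm_k2 HS g1 g2 S1).
  rewrite star_prel; last exact: kU.
  split=> [[[h [a [b [pu pv ->]]]] sk]|[h [a [b [p1 p2 ->]]]]]; last first.
    move/(sd_prel HS gH SU (X := tgam HS gH gK SV X)): p1 => [pu _].
    move/(sd_prel HS gK SV): p2 => [pv sk].
    by split=> //; exists h, a, b.
  exists h, a, b; split=> //.
    apply/(sd_prel HS gH SU (X := tgam HS gH gK SV X)); split=> //.
    by rewrite stab_tp_img; apply/mem_img; exists k => //; case: pv.
  exact/(sd_prel HS gK SV).
- by rewrite !plus_map0.
- by rewrite !plus_mapD IH IH'.
- by rewrite !plus_mapN IH.
Qed.
End Comp.
End Plus.

(** * The functor F^+ *)

Section Lift.
Local Open Scope group_scope.
Variable A : abgroup.
Implicit Types gT hT kT : finGroupType.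

(* Q = (K^u, lambda) for P = (K, alpha) and lambda as in the definition of F^+:
   the last condition is phi_u * lambda = alpha. *)
Definition lifts_to gT hT (G : {group gT}) (H : {group hT}) (U : biset A G H)
    (P : gpair A gT) (u : U) (Q : gpair A hT) : Prop :=
  [/\ P.1 \subset p1 (stab u), Q.1 = coimg_grp P.1 (stab u), is_hom Q.1 Q.2 &
      forall k h a, k \in P.1 -> prel (stab_pair u) (k, h) a ->
        P.2 k = (a * Q.2 h)%ab].

Lemma hom_ext gT (K : {group gT}) (f g : {ffun gT -> A}) :
  is_hom K f -> is_hom K g -> {in K, f =1 g} -> f = g.
Proof.
move=> [_ f1] [_ g1] e; apply/ffunP => x.
by have [/e //|nx] := boolP (x \in K); rewrite f1 ?g1.
Qed.

Lemma restr_hom gT (L : {group gT}) (W : gpair A gT) : is_hom W.1 W.2 ->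
  L \subset W.1 -> exists Q : gpair A gT,
  [/\ Q.1 = L, is_hom Q.1 Q.2 & {in L, Q.2 =1 W.2}].
Proof.
move=> [Wh _] sL; exists (L, [ffun x => if x \in L then W.2 x else 1%ab]).
have e : {in L, [ffun x => if x \in L then W.2 x else 1%ab] =1 W.2}.
  by move=> x Lx; rewrite ffunE Lx.
split=> //; split=> [x y /= Lx Ly|x /= /negbTE nx]; last by rewrite ffunE nx.
by rewrite !e ?groupM // Wh // (fintype.subsetP sL).
Qed.

Section One.
Variables (gT hT : finGroupType) (G : {group gT}) (H : {group hT}).
Variables (U : biset A G H) (kU : hfree U).

(** Each k determines its h, so phi_u(k, h) W(h) is a function of k, namely the product of phi_u and
    W. It supplies the middle pair in [lift_tpt]. *)
Lemma pull_hom (u : U) (L : {group gT}) (W : gpair A hT) :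
  is_hom W.1 W.2 -> L \subset p1 (stab u) -> coimg_grp L (stab u) \subset W.1 ->
  exists Q : gpair A gT, [/\ Q.1 = L, is_hom Q.1 Q.2 &
    forall k h a, k \in L -> prel (stab_pair u) (k, h) a -> Q.2 k = (a * W.2 h)%ab].
Proof.
move=> [Wh _] sL sW.
pose q k := if [pick h | (k, h) \in stab u] is Some h
            then (stab_char u (k, h) * W.2 h)%ab else 1%ab.
have qE k h a : prel (stab_pair u) (k, h) a -> q k = (a * W.2 h)%ab.
  move=> [su <-]; rewrite /q; case: pickP => [h' su'|/(_ h)]; last by rewrite su.
  by rewrite (k2_inj (kU u) su' su).
exists (L, [ffun k => if k \in L then q k else 1%ab]); split=> //; last first.
  by move=> k h a Lk pu; rewrite ffunE Lk; exact: qE pu.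
split=> [k k' /= Lk Lk'|k /= /negbTE nk]; last by rewrite ffunE nk.
rewrite !ffunE groupM // Lk Lk'.
have /mem_p1[h su] := fintype.subsetP sL k Lk.
have /mem_p1[h' su'] := fintype.subsetP sL k' Lk'.
have [_ [uh _]] := stab_in_M u.
have Wm l m : l \in L -> (l, m) \in stab u -> m \in W.1.
  by move=> Ll sm; apply: (fintype.subsetP sW); apply/mem_coimg; exists l.
rewrite (@qE (k * k') (h * h') (stab_char u (k, h) * stab_char u (k', h'))%ab).
  rewrite (qE k h _ (conj su erefl)) (qE k' h' _ (conj su' erefl)).
  rewrite Wh ?(Wm k h) ?(Wm k' h') // -!amulA; congr amul.
  by rewrite !amulA (amulC (W.2 h)).
split; first exact: (groupM su su').
exact: uh su su'.
Qed.

End One.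

Section Two.
Variables (gT hT : finGroupType) (G : {group gT}) (H : {group hT}).
Variables (U : biset A G H) (kU : hfree U).

(** Every h in K^u has a partner k in K, and then lambda(h) must be phi_u(k, h)^-1 alpha(k). *)
Lemma lift_uniq P (u : U) Q Q' : lifts_to P u Q -> lifts_to P u Q' -> Q = Q'.
Proof.
case: Q Q' => [K f] [K' f'] [/= sP eK hf e] [/= _ eK' hf' e'].
rewrite eK' -eK in hf' *; congr (_, _); apply: hom_ext hf hf' _ => h.
rewrite eK => /mem_coimg[k Pk su].
by have := e k h _ Pk (conj su erefl); rewrite (e' k h _ Pk (conj su erefl)) => /amul_inj.
Qed.

Lemma conj_hom gT' (g : gT') (P : gpair A gT') :
  is_hom P.1 P.2 -> is_hom (conj_pair g P).1 (conj_pair g P).2.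
Proof.
move=> [Ph P1]; split=> [x y|]; last exact: conj_supported.
by rewrite !mem_conjG !ffunE conjMg => Px Py; rewrite Ph.
Qed.

Lemma lift_conj P (u : U) Q g h a : g \in G -> h \in H -> lifts_to P u Q ->
  lifts_to (conj_pair g P) (fact (g, h) a u) (conj_pair h Q).
Proof.
move=> Gg Hh [sP eQ hQ e].
have GHg : (g, h) \in setX_group G H by exact/setXP.
have eu k l b : prel (stab_pair (fact (g, h) a u)) (k, l) b <->
                prel (stab_pair u) (k ^ g, l ^ h) b.
  by rewrite stab_act // conj_prel pairJ.
have es k l : ((k, l) \in stab (fact (g, h) a u)) = ((k ^ g, l ^ h) \in stab u).
  by rewrite group_stab_act // mem_conjG.
split.
- apply/fintype.subsetP => k; rewrite mem_conjG => /(fintype.subsetP sP)/mem_p1[l su].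
  by apply/mem_p1; exists (l ^ h^-1); rewrite es conjgKV.
- apply: eq_group => l; rewrite mem_conjG eQ; apply/mem_coimg/mem_coimg => -[k Pk su].
    by exists (k ^ g^-1); rewrite ?mem_conjG ?es conjgKV.
  by exists (k ^ g); [rewrite -mem_conjG|rewrite -es].
- exact: conj_hom.
- move=> k l b; rewrite mem_conjG => Pk /eu pu; rewrite !ffunE.
  exact: e Pk pu.
Qed.

Lemma conj_pairK gT' (g : gT') (P : gpair A gT') : conj_pair g^-1 (conj_pair g P) = P.
Proof.
case: P => K f; congr (_, _); first by apply: val_inj; rewrite /= invgK -conjsgM mulVg conjsg1.
by apply/ffunP => x; rewrite !ffunE -conjgM mulVg conjg1.
Qed.

Lemma conj_pair1 gT' (P : gpair A gT') : conj_pair 1 P = P.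
Proof.
case: P => K f; congr (_, _); first by apply: val_inj; rewrite /= invg1 conjsg1.
by apply/ffunP => x; rewrite !ffunE conjg1.
Qed.

Lemma lift_conj_iff P (u : U) g h a : g \in G -> h \in H ->
  (exists Q, lifts_to (conj_pair g P) (fact (g, h) a u) Q) -> exists Q, lifts_to P u Q.
Proof.
move=> Gg Hh [Q lQ]; exists (conj_pair h^-1 Q).
have := lift_conj (ainv a) (groupVr Gg) (groupVr Hh) lQ.
rewrite conj_pairK -[(g^-1, h^-1)]/((g, h)^-1) factK //; exact/setXP.
Qed.

Variables (X : fibset A H).

(** From left to right, lambda is the restriction of phi_x to K^u. This makes sense because some
    partner of k lies in H_x, and k has only one partner, so that K^u is contained in H_x. *)
Lemma lift_tp P (u : U) (x : X) :
  pair_le P (stab_pair (tp kU u x)) <->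
  exists Q, lifts_to P u Q /\ pair_le Q (stab_pair x).
Proof.
split=> [[sP eP]|[Q [[sP eQ hQ e] [sQ eQx]]]].
  have st k h a : k \in P.1 -> prel (stab_pair u) (k, h) a ->
      h \in stab x /\ P.2 k = (a * stab_char x h)%ab.
    move=> Pk [su eua]; have sk := fintype.subsetP sP k Pk.
    have /stab_tp[h' [a' [b [[su' eu'] [sx ex] eab]]]] :=
      conj sk (erefl ((stab_pair (tp kU u x)).2 k)).
    rewrite (k2_inj (kU u) su su'); split=> //.
    by rewrite eP // eab -ex -eu' -eua (k2_inj (kU u) su su').
  have [|Q [eQ hQ eQx]] := @restr_hom _ (coimg_grp P.1 (stab u)) (stab_pair x) (stab_in_M x).2.
    apply/fintype.subsetP => h /mem_coimg[k Pk su].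
    by have [] := st k h _ Pk (conj su erefl).
  exists Q; split; split; rewrite ?eQ //.
  - apply/fintype.subsetP => k Pk; have sk := fintype.subsetP sP k Pk.
    have /stab_tp[h [a [b [[su _] _ _]]]] := conj sk (erefl ((stab_pair (tp kU u x)).2 k)).
    by apply/mem_p1; exists h.
  - by rewrite -eQ.
  - move=> k h a Pk pu; have [_ ->] := st k h a Pk pu; rewrite eQx //.
    by apply/mem_coimg; exists k => //; case: pu.
  - apply/fintype.subsetP => h /mem_coimg[k Pk su].
    by have [] := st k h _ Pk (conj su erefl).
have st k : k \in P.1 -> prel (stab_pair (tp kU u x)) k (P.2 k).
  move=> Pk; have /mem_p1[h su] := fintype.subsetP sP k Pk.
  have Qh : h \in Q.1 by rewrite eQ; apply/mem_coimg; exists k.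
  apply/stab_tp; exists h, (stab_char u (k, h)), (stab_char x h).
  split=> //; first by split=> //; exact: (fintype.subsetP sQ).
  by rewrite (e k h _ Pk (conj su erefl)) (eQx h Qh).
split; first by apply/fintype.subsetP => k /st[].
by move=> k /st[].
Qed.

Variables (kT : finGroupType) (K : {group kT}) (V : biset A H K) (kV : hfree V).

(** Lifting is transitive since the subgroup attached to u (x) v is (K^u)^v. From left to right the
    middle pair lives on K^u and is pulled back from W along v by [pull_hom]. *)
Lemma lift_tpt P (u : U) (v : V) W :
  lifts_to P (tpt kU u v) W <-> exists Q, lifts_to P u Q /\ lifts_to Q v W.
Proof.
have pE k l c : prel (stab_pair (tpt kU u v)) (k, l) c <-> exists h a b,
    [/\ prel (stab_pair u) (k, h) a, prel (stab_pair v) (h, l) b & c = (a * b)%ab].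
  by rewrite stab_tpt star_prel //; exact: kU.
have sE k l h : (k, h) \in stab u -> (h, l) \in stab v -> (k, l) \in stab (tpt kU u v).
  move=> su sv.
  have [//] : prel (stab_pair (tpt kU u v)) (k, l) (stab_char u (k, h) * stab_char v (h, l))%ab.
  by apply/pE; exists h, (stab_char u (k, h)), (stab_char v (h, l)).
have sE' k l : (k, l) \in stab (tpt kU u v) -> exists h, (k, h) \in stab u /\ (h, l) \in stab v.
  move=> s; have /pE[h [a [b [[su _] [sv _] _]]]] :=
    conj s (erefl ((stab_pair (tpt kU u v)).2 (k, l))).
  by exists h.
split=> [[sP eW hW e]|[Q [[sP eQ hQ e] [sQ eW hW e']]]].
  have sPu : P.1 \subset p1 (stab u).
    apply/fintype.subsetP => k /(fintype.subsetP sP)/mem_p1[l /sE'[h [su _]]].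
    by apply/mem_p1; exists h.
  have sL : coimg_grp P.1 (stab u) \subset p1 (stab v).
    apply/fintype.subsetP => h /mem_coimg[k Pk su].
    have /mem_p1[l /sE'[h' [su' sv]]] := fintype.subsetP sP k Pk.
    by apply/mem_p1; exists l; rewrite (k2_inj (kU u) su su').
  have eL : coimg_grp (coimg_grp P.1 (stab u)) (stab v) = W.1.
    rewrite eW; apply: eq_group => l; apply/mem_coimg/mem_coimg.
      by move=> [h /mem_coimg[k Pk su] sv]; exists k => //; exact: sE su sv.
    move=> [k Pk /sE'[h [su sv]]]; exists h => //.
    by apply/mem_coimg; exists k.
  have [|Q [eQ hQ eQv]] := pull_hom kV (L := coimg_grp P.1 (stab u)) hW sL.
    by rewrite eL.
  exists Q; split; split; rewrite ?eQ // -?eQ //.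
  move=> k h a Pk pu.
  have hL : h \in coimg_grp P.1 (stab u) by apply/mem_coimg; exists k => //; case: pu.
  have /mem_p1[l sv] := fintype.subsetP sL h hL.
  rewrite (eQv h l _ hL (conj sv erefl)) amulA; apply: (e k l) => //.
  by apply/pE; exists h, a, (stab_char v (h, l)).
have Qm k h : k \in P.1 -> (k, h) \in stab u -> h \in Q.1.
  by move=> Pk su; rewrite eQ; apply/mem_coimg; exists k.
split=> //.
- apply/fintype.subsetP => k Pk; have /mem_p1[h su] := fintype.subsetP sP k Pk.
  have /mem_p1[l sv] := fintype.subsetP sQ h (Qm _ _ Pk su).
  by apply/mem_p1; exists l; exact: sE su sv.
- rewrite eW; apply: eq_group => l; apply/mem_coimg/mem_coimg.
    by rewrite eQ => -[h /mem_coimg[k Pk su] sv]; exists k => //; exact: sE su sv.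
  by move=> [k Pk /sE'[h [su sv]]]; exists h => //; exact: Qm Pk su.
- move=> k l c Pk /pE[h [a [b [pu pv ->]]]].
  rewrite (e k h a Pk pu) -amulA; congr amul.
  by apply: (e' h l b) => //; apply: Qm Pk _; case: pu.
Qed.
End Two.
End Lift.

(** * Construction of the maps F^+([U]) *)

Section Upper.
Local Open Scope ring_scope.
Variables (A : abgroup) (R : comPzRingType) (GG : group_class) (SS : pair_family A).
Hypothesis HS : admissible GG SS.
Variable F : functor R GG SS.
Implicit Types gT hT kT : finGroupType.
Notation SL := (S_lower GG SS).

(* [orbit_reps] and [biset_orbit_reps] are [reps] for these relations. *)
Definition aorb gT (G : {group gT}) (X : fibset A G) (x y : X) : Prop :=
  exists a, x = fact 1 a y.
Definition horb gT hT (G : {group gT}) (H : {group hT}) (U : biset A G H) (u v : U) :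
  Prop := exists h a, h \in H /\ u = fact (1%g, h) a v.

Lemma aorb_sym gT (G : {group gT}) (X : fibset A G) (x y : X) : aorb x y -> aorb y x.
Proof. by move=> [a ->]; exists (ainv a); rewrite fact_fact1 amulVa fact1. Qed.

Lemma aorb_trans gT (G : {group gT}) (X : fibset A G) (y x z : X) :
  aorb x y -> aorb y z -> aorb x z.
Proof. by move=> [a ->] [b ->]; exists (a * b)%ab; rewrite fact_fact1. Qed.

Section HOrb.
Variables (gT hT : finGroupType) (G : {group gT}) (H : {group hT}) (U : biset A G H).
Implicit Types u v w : U.

Lemma horb_sym u v : horb u v -> horb v u.
Proof.
move=> [h [a [Hh ->]]]; exists h^-1%g, (ainv a); rewrite groupV; split=> //.
by rewrite -factM ?in1X ?groupV // !pairE mulVg amulVa -pair1 fact1.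
Qed.

Lemma horb_trans v u w : horb u v -> horb v w -> horb u w.
Proof.
move=> [h [a [Hh ->]]] [k [b [Hk ->]]]; exists (h * k)%g, (a * b)%ab.
by rewrite groupM // -factM ?in1X // !pairE.
Qed.

Lemma biset_repsE n (r : 'I_n -> U) : biset_orbit_reps r <-> reps (@horb _ _ _ _ U) r.
Proof.
split=> -[rS rI]; split=> //.
  by move=> i j [h [a [Hh e]]]; exact: rI Hh e.
by move=> i j h a Hh e; apply: rI; exists h, a.
Qed.

Lemma horb_reps_exist : exists n (r : 'I_n -> U), reps (@horb _ _ _ _ U) r.
Proof.
have [n [r rS]] := ffin U.
apply: (reps_exist horb_sym horb_trans (r := r)) => u.
by have [i [a ->]] := rS u; exists i, 1%g, a.
Qed.
End HOrb.

Lemma orbit_repsE gT (G : {group gT}) (X : fibset A G) n (r : 'I_n -> X) :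
  orbit_reps r <-> reps (@aorb _ _ X) r.
Proof.
split=> -[rS rI]; split=> //; first by move=> i j [a e]; exact: rI e.
by move=> i j a e; apply: rI; exists a.
Qed.

Lemma aorb_reps_exist gT (G : {group gT}) (X : fibset A G) :
  exists n (r : 'I_n -> X), reps (@aorb _ _ X) r.
Proof.
have [n [r rS]] := ffin X.
exact: (reps_exist (@aorb_sym _ _ X) (@aorb_trans _ _ X) (r := r)).
Qed.

Section Term.
Variables (gT hT : finGroupType) (G : {group gT}) (H : {group hT}).
Hypotheses (gG : GG G) (gH : GG H).
Variables (U : biset A G H) (SU : stab_in SL U).
Let kU := stab_in_hfree HS gH SU.
Implicit Types (P : gpair A gT) (Q : gpair A hT) (u : U) (x : F_upper F H).

Definition upper_inner P u x : fobj F P.1 :=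
  let Ku : {group hT} := coimg_grp P.1 (stab u) in
  let D := cut_pair P.1 (stab_pair u) in
  \sum_(l \in [set l : {ffun hT -> A} |
               [/\ is_hom Ku l, lam_compat (stab_pair u) (Ku, l) &
                   (star_lam D (Ku, l)).2 = P.2]]%classic)
    fmap F P.1 Ku D (x (Ku, l)).

(** The contribution of one representative u. The default 0 replaces the condition K <= p_1 on the
    outer sum, so that sums run over all representatives. *)
Definition upper_term P u x : fobj F P.1 :=
  if P.1 \subset p1 (stab u) then upper_inner P u x else 0.

Lemma lift_star_lam P u Q : is_hom P.1 P.2 -> lifts_to P u Q ->
  (star_lam (cut_pair P.1 (stab_pair u)) Q).2 = P.2.
Proof.
move=> hP [sP eQ hQ e]; apply/ffunP => k; rewrite ffunE.
case: pickP => [h /andP[Qh]|no].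
  rewrite mem_cut => /andP[su Pk]; rewrite ffunE Pk.
  by rewrite (e k h _ Pk (conj su erefl)).
have [Pk|Pk] := boolP (k \in P.1); last by rewrite hP.2.
have /mem_p1[h su] := fintype.subsetP sP k Pk.
have := no h; rewrite eQ mem_cut su Pk andbT.
by have -> : h \in coimg_grp P.1 (stab u) by apply/mem_coimg; exists k.
Qed.

(** Each k in K has exactly one partner h, so [pick] in [star_lam] returns it and the equality of
    functions becomes the pointwise condition in [lifts_to]. The compatibility condition concerns h
    = 1 only. *)
Lemma liftE P u l : is_hom P.1 P.2 -> P.1 \subset p1 (stab u) ->
  lifts_to P u (coimg_grp P.1 (stab u), l) <->
  [/\ is_hom (coimg_grp P.1 (stab u)) l,
      lam_compat (stab_pair u) (coimg_grp P.1 (stab u), l) &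
      (star_lam (cut_pair P.1 (stab_pair u)) (coimg_grp P.1 (stab u), l)).2 = P.2].
Proof.
move=> hP sP; split=> [lQ|[hl _ el]].
  have [_ _ hl _] := lQ; split=> //; last exact: lift_star_lam.
  move=> h; rewrite inE kU => /andP[/set1gP-> _].
  rewrite /phi2 -[(1, 1)%g]/(1%g : gT * hT) (hom1 (stab_in_M u)) ainv1.
  by have := hom1 (G := coimg_grp P.1 (stab u)) (P := (_, l)) (conj (fintype.subxx _) hl).
split=> // k h a Pk [su ea]; rewrite -el ffunE.
have Qh : h \in coimg_grp P.1 (stab u) by apply/mem_coimg; exists k.
case: pickP => [h' /andP[_]|/(_ h)]; last by rewrite Qh mem_cut su Pk.
rewrite mem_cut => /andP[su' _]; rewrite ffunE Pk (k2_inj (kU u) su' su).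
by congr amul.
Qed.

Lemma lift_in_M' P u Q : in_M' GG G P -> lifts_to P u Q -> in_M' GG H Q.
Proof.
move=> [PM gP] [sP eQ hQ _]; have [gQ _] := SL_cut HS gH (SU u) sP gP.
split; last by rewrite eQ.
split=> //; rewrite eQ; apply/fintype.subsetP => h /mem_coimg[k _].
by move=> /(fintype.subsetP (stab_sub u))/setXP[].
Qed.

Lemma lift_SS P u Q : in_M' GG G P -> lifts_to P u Q ->
  SS P.1 Q.1 (cut_pair P.1 (stab_pair u)).
Proof.
by move=> [PM gP] [sP -> _ _]; have [_] := SL_cut HS gH (SU u) sP gP.
Qed.

(** By [lift_uniq] the inner index set is a singleton. *)
Lemma upper_term_lift P u x Q : in_M' GG G P -> lifts_to P u Q ->
  upper_term P u x = fmap F P.1 Q.1 (cut_pair P.1 (stab_pair u)) (x Q).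
Proof.
move=> [[_ hP] gP] lQ; have [sP eQ _ _] := lQ; rewrite /upper_term sP.
case: Q eQ lQ => L l /= -> lQ; rewrite /upper_inner.
rewrite (_ : [set _ | _]%classic = [set l]%classic) ?fsbig_set1 //.
apply/seteqP; split=> l' /=; first by move=> /(liftE _ hP sP) /(lift_uniq lQ) [].
by move=> ->; apply/liftE.
Qed.

Lemma upper_term_none P u x : in_M' GG G P -> ~ (exists Q, lifts_to P u Q) ->
  upper_term P u x = 0.
Proof.
move=> [[_ hP] gP] no; rewrite /upper_term; case: ifP => // sP.
rewrite /upper_inner (_ : [set _ | _]%classic = set0) ?fsbig_set0 //.
apply/seteqP; split=> l' //= /(liftE _ hP sP) lQ; apply: no.
by exists (coimg_grp P.1 (stab u), l').
Qed.

Lemma upper_term_linear P u r x y : in_M' GG G P ->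
  upper_term P u (r *: x + y) = r *: upper_term P u x + upper_term P u y.
Proof.
move=> MP; have [[Q lQ]|no] := pselect (exists Q, lifts_to P u Q).
  by rewrite !(upper_term_lift _ MP lQ) -linearP.
by rewrite !upper_term_none // scaler0 addr0.
Qed.

Lemma conj_in_M' gT' (G' : {group gT'}) (P : gpair A gT') g : GG G' -> g \in G' ->
  in_M' GG G' P -> in_M' GG G' (conj_pair g P).
Proof.
move=> gG' Gg [[sP hP] gP]; have [gg _] := SS_conj_diag HS gG' sP gP Gg.
split=> //; split; last exact: conj_hom.
by rewrite /= -(conjGid (groupVr Gg)) conjSg.
Qed.

(** One identity for two purposes: g = 1 gives independence of the representative of an (A,
    H)-orbit, h = 1 gives the G-invariance of the resulting family. *)
Lemma upper_term_conj P u x g h a : in_M' GG G P -> g \in G -> h \in H ->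
  upper_term (conj_pair g P) (fact (g, h) a u) x =
  fconj F g (conj_pair g P).1 P.1 (upper_term P u x).
Proof.
move=> MP Gg Hh; have MgP := conj_in_M' gG Gg MP.
have [ex|no] := pselect (exists Q, lifts_to P u Q); last first.
  rewrite (upper_term_none _ MP no) linear0; apply: upper_term_none => // ex.
  exact: no (lift_conj_iff Gg Hh ex).
have [Q lQ] := ex; have lgQ := lift_conj a Gg Hh lQ.
have MQ := lift_in_M' MP lQ; have MhQ := lift_in_M' MgP lgQ.
rewrite (upper_term_lift _ MP lQ) (upper_term_lift _ MgP lgQ).
rewrite -(fu_inv x Hh MQ).
have [[sP _] gP] := MP; have [[sQ _] gQ] := MQ; have [_ ggP] := MgP; have [_ ghQ] := MhQ.
have [_ Sg] := SS_conj_diag HS gG sP gP Gg.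
have [_ Sh] := SS_conj_diag HS gH sQ gQ Hh.
have [PQ1 eQ _ _] := lQ.
rewrite (fmapM HS _ ggP ghQ gQ (lift_SS MgP lgQ) Sh _ erefl); last first.
  apply/fintype.subsetP => y; rewrite mem_conjG => Qy; apply/mem_p1.
  by exists (y ^ h)%g; rewrite mem_conj_diag conjgK eqxx.
rewrite (fmapM HS _ ggP gP gQ Sg (lift_SS MP lQ) _ erefl); last first.
  apply/fintype.subsetP => k Pk; have /mem_p1[l su] := fintype.subsetP PQ1 k Pk.
  by apply/mem_p1; exists l; rewrite mem_cut su.
congr (fmap _ _ _ _ _); apply: prel_ext; [exact: star_supported|exact: star_supported|].
have GHg : (g, h) \in setX_group G H by exact/setXP.
have k2c : k2 (cut_pair (conj_pair g P).1 (stab_pair (fact (g, h) a u))).1 = 1%g.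
  exact: (adm_k2 HS ggP ghQ (lift_SS MgP lgQ)).
move=> [k l] c; rewrite !star_prel ?k2_conj_diag //; split.
  move=> [m [b [d [/cut_prel[]]]]]; rewrite stab_act // conj_prel pairJ mem_conjG /=.
  move=> Pk pu /conj_diag_prel[em Ql ->] ->; exists (k ^ g)%g, 1%ab, b.
  rewrite amul1a amula1; split=> //; first by apply/conj_diag_prel; rewrite conjgK.
  by apply/cut_prel; split=> //; move: pu; rewrite em conjgKV.
move=> [m [b [d [/conj_diag_prel[ek Pm ->] /cut_prel[_ pu] ->]]]].
exists (l ^ h^-1)%g, d, 1%ab; rewrite amul1a amula1; split=> //.
  by apply/cut_prel; rewrite stab_act // conj_prel pairJ conjgKV /= mem_conjG ek conjgKV.
apply/conj_diag_prel; split=> //; rewrite eQ; apply/mem_coimg; exists m => //.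
by case: pu.
Qed.

Lemma fconj1 gT' (K : {group gT'}) (y : fobj F K) : GG K -> fconj F 1%g K K y = y.
Proof.
move=> gK; rewrite /fconj (_ : conj_diag 1 K = diag K) ?fmap_id //.
by apply: eq_group => -[k l]; rewrite mem_conj_diag mem_diag invg1 conjg1;
  apply/andP/andP => -[/eqP->].
Qed.

Lemma upper_term_act P u x h a : in_M' GG G P -> h \in H ->
  upper_term P (fact (1%g, h) a u) x = upper_term P u x.
Proof.
move=> MP Hh; have := upper_term_conj u x a MP (group1 G) Hh.
by rewrite conj_pair1 fconj1 //; case: MP.
Qed.

Definition upper_reps := cid (horb_reps_exist U).
Let n := sval upper_reps.
Let rr := cid (svalP upper_reps).
Let r : 'I_n -> U := sval rr.
Let rP : reps (@horb _ _ _ _ U) r := svalP rr.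

Lemma upper_sum_reps P x (I J : finType) (s : I -> U) (t : J -> U) : in_M' GG G P ->
  reps (@horb _ _ _ _ U) s -> reps (@horb _ _ _ _ U) t ->
  \sum_i upper_term P (s i) x = \sum_j upper_term P (t j) x.
Proof.
move=> MP sP tP.
apply: (sum_reps (@horb_sym _ _ _ _ U) (@horb_trans _ _ _ _ U) (P := xpredT)
  (f := fun u => upper_term P u x) sP tP) => u v [h [a [Hh ->]]].
by rewrite upper_term_act.
Qed.

Definition upper_val x P : fobj F P.1 :=
  if pselect (in_M' GG G P) then \sum_i upper_term P (r i) x else 0.

Lemma upper_valE x P (J : finType) (t : J -> U) : in_M' GG G P ->
  reps (@horb _ _ _ _ U) t -> upper_val x P = \sum_j upper_term P (t j) x.
Proof.
by move=> MP tP; rewrite /upper_val; case: pselect => [?|//]; exact: upper_sum_reps.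
Qed.

Lemma upper_val_out x P : ~ in_M' GG G P -> upper_val x P = 0.
Proof. by move=> nP; rewrite /upper_val; case: pselect. Qed.

(** Hom(K, A) may be infinite. A nonzero component at P = (K, alpha) comes from a representative r_i
    and a Q in the support of x, and alpha is recovered as the product of phi and lambda; so
    finitely many triples (K, i, Q) account for all such P. *)
Lemma upper_val_fin x : finite_set [set P | upper_val x P <> 0]%classic.
Proof.
pose f (p : {group gT} * 'I_n) (Q : gpair A hT) : gpair A gT :=
  (p.1, (star_lam (cut_pair p.1 (stab_pair (r p.2))) Q).2).
apply: (@sub_finite_set _ _ [set f p Q | p in setT & Q in [set Q | x Q <> 0]]%classic); last first.
  by apply: finite_image2; [exact: finite_finset|exact: fu_fin].
move=> P /= nz; have MP : in_M' GG G P by apply: contrapT => /(upper_val_out x).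
move: nz; rewrite (upper_valE _ MP rP) => nz.
have [i nzi] : exists i, upper_term P (r i) x <> 0.
  by apply: contrapT => no; apply: nz; rewrite big1 // => i _;
    apply: contrapT => e; apply: no; exists i.
have [Q lQ] : exists Q, lifts_to P (r i) Q.
  by apply: contrapT => no; apply: nzi; exact: upper_term_none.
exists (P.1, i) => //; exists Q => /=.
  by move=> xQ; apply: nzi; rewrite (upper_term_lift _ MP lQ) xQ linear0.
have -> : f (P.1, i) Q = (P.1, (star_lam (cut_pair P.1 (stab_pair (r i))) Q).2) by [].
by rewrite (lift_star_lam _ lQ); [case: (P)|case: MP => -[]].
Qed.

Lemma upper_val_inv x g P : g \in G -> in_M' GG G P ->
  fconj F g (conj_pair g P).1 P.1 (upper_val x P) = upper_val x (conj_pair g P).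
Proof.
move=> Gg MP; have MgP := conj_in_M' gG Gg MP; rewrite (upper_valE _ MP rP) linear_sum.
have Gg1 : (g, 1%g) \in setX_group G H by exact: inX1.
(* The action of (g, 1) commutes with that of H and so permutes the (A, H)-orbits; the translates of
   the r_i represent them as well. *)
have tP : reps (@horb _ _ _ _ U) (fun i => fact (g, 1%g) 1%ab (r i)).
  have [rS rI] := rP.
  have com h a u : h \in H ->
      fact (g, 1%g) 1%ab (fact (1%g, h) a u) = fact (1%g, h) a (fact (g, 1%g) 1%ab u).
    by move=> Hh; rewrite -!factM ?in1X // !pairE amul1a amula1.
  split=> [u|i j [h [a [Hh]]]].
    have [i [h [a [Hh e]]]] := rS (fact (g, 1%g)^-1%g 1%ab u).
    exists i, h, a; split=> //; rewrite -com // -e -factM ?groupV // mulgV amul1a.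
    by rewrite fact1.
  by rewrite -com // => /(fact_inj Gg1) e; apply: rI; exists h, a.
rewrite (upper_valE _ MgP tP); apply: eq_bigr => i _.
by rewrite upper_term_conj.
Qed.

Definition upper_map x : F_upper F G :=
  FUpperFam (@upper_val_out x) (@upper_val_fin x) (@upper_val_inv x).

Lemma upper_mapE x P (J : finType) (t : J -> U) : in_M' GG G P ->
  reps (@horb _ _ _ _ U) t -> upper_map x P = \sum_j upper_term P (t j) x.
Proof. exact: upper_valE. Qed.

Lemma fupper_eq gT' (G' : {group gT'}) (x y : Fupper F G') :
  (forall P : gpair A gT', in_M' GG G' P -> x P = y P) -> x = y.
Proof.
move=> e; apply: fu_ext => P; have [/e //|nP] := pselect (in_M' GG G' P).
by rewrite !fu_dom.
Qed.

Lemma upper_map_linear a x y : upper_map (a *: x + y) = a *: upper_map x + upper_map y.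
Proof.
apply: fupper_eq => P MP; rewrite /= !(upper_valE _ MP rP).
rewrite (eq_bigr _ (fun i _ => upper_term_linear (r i) a x y MP)).
by rewrite big_split scaler_sumr.
Qed.
End Term.
End Upper.

(** * Functoriality of F^+ *)

Section UpperFun.
Local Open Scope ring_scope.
Variables (A : abgroup) (R : comPzRingType) (GG : group_class) (SS : pair_family A).
Hypothesis HS : admissible GG SS.
Variable F : functor R GG SS.
Implicit Types gT hT kT : finGroupType.
Notation SL := (S_lower GG SS).

Lemma equiv_horb gT hT (G : {group gT}) (H : {group hT}) (U U' : biset A G H)
    (f : U -> U') u v : equivariant f -> injective f -> horb (f u) (f v) <-> horb u v.
Proof.
move=> fE fI; split=> -[h [a [Hh e]]]; exists h, a; split=> //.
  by apply: fI; rewrite fE //; exact: in1X.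
by rewrite e fE //; exact: in1X.
Qed.

Section Two.
Variables (gT hT : finGroupType) (G : {group gT}) (H : {group hT}).
Hypotheses (gG : GG G) (gH : GG H).
Implicit Types (P : gpair A gT) (x : F_upper F H).

Lemma upper_term_stab (U U' : biset A G H) (u : U) (u' : U') P x :
  stab_pair u = stab_pair u' -> upper_term P u x = upper_term P u' x.
Proof.
move=> e; have es : stab u = stab u' by exact: (congr1 fst e).
by rewrite /upper_term /upper_inner es e.
Qed.

Lemma upper_map_iso (U U' : biset A G H) (SU : stab_in SL U) (SU' : stab_in SL U') x :
  fib_iso U U' -> upper_map HS gG gH SU x = upper_map HS gG gH SU' x.
Proof.
move=> [f [fE [f' fK f'K]]]; have fI := can_inj fK.
apply: fupper_eq => P MP; have [n [r rP]] := horb_reps_exist U.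
have fr : reps (@horb _ _ _ _ _ U') (f \o r).
  have [rS rI] := rP; split=> [u|i j /(equiv_horb _ _ fE fI)/rI //].
  by have [i e] := rS (f' u); exists i; rewrite -(f'K u); apply/equiv_horb.
rewrite (upper_mapE _ _ _ _ _ MP rP) (upper_mapE _ _ _ _ _ MP fr).
by apply: eq_bigr => i _; apply/upper_term_stab/esym/stab_pair_inj.
Qed.

Lemma upper_map_sum (U V : biset A G H) (SU : stab_in SL U) (SV : stab_in SL V)
    (SUV : stab_in SL (sum_fib U V)) x :
  upper_map HS gG gH SUV x = upper_map HS gG gH SU x + upper_map HS gG gH SV x.
Proof.
apply: fupper_eq => P MP; have [n [r rP]] := horb_reps_exist U.
have [m [s sP]] := horb_reps_exist V.
pose t (k : 'I_n + 'I_m) : sum_fib U V :=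
  match k with inl i => inl (r i) | inr j => inr (s j) end.
have tP : reps (@horb _ _ _ _ _ (sum_fib U V)) t.
  have [rS rI] := rP; have [sS sI] := sP; split.
    case=> [u|v].
      by have [i [h [a [Hh ->]]]] := rS u; exists (inl i), h, a.
    by have [j [h [a [Hh ->]]]] := sS v; exists (inr j), h, a.
  move=> [i|j] [i'|j'] [h [a [Hh]]] //= [e].
    by congr inl; apply: rI; exists h, a.
  by congr inr; apply: sI; exists h, a.
rewrite (upper_mapE _ _ _ _ _ MP tP) big_sumType.
rewrite [RHS](_ : _ = upper_map HS gG gH SU x P + upper_map HS gG gH SV x P) //.
rewrite (upper_mapE _ _ _ _ _ MP rP) (upper_mapE _ _ _ _ _ MP sP).
congr (_ + _); apply: eq_bigr => i _; apply: upper_term_stab.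
  exact: (stab_pair_inj (Y := sum_fib U V) (r i) (@inl_equivariant _ _ _ U V) (@inl_inj' _ _)).
exact: (stab_pair_inj (Y := sum_fib U V) (s i) (@inr_equivariant _ _ _ U V) (@inr_inj' _ _)).
Qed.
End Two.

(** There is a single orbit, represented by u0, and through u0 every pair P lifts to itself. *)
Lemma upper_map_id gT (G : {group gT}) (gG : GG G) (U : biset A G G)
    (SU : stab_in SL U) (u0 : U) (x : F_upper F G) : generates u0 ->
  stab_pair u0 = triv_pair (diag G) -> upper_map HS gG gG SU x = x.
Proof.
move=> u0G u0S; apply: fupper_eq => P MP.
have [[sP hP] gP] := MP.
have rP : reps (@horb _ _ _ _ _ U) (fun _ : 'I_1 => u0).
  split=> [u|i j _]; last by rewrite !ord1.
  have [[g h] [a [/setXP[Gg Gh] ->]]] := u0G u.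
  exists ord0, (h * g^-1)%g, a; rewrite groupM ?groupV //; split=> //.
  have e : fact (g, g) 1%ab u0 = u0.
    have /stab_prel[_ ->] : prel (stab_pair u0) (g, g) 1%ab.
      by rewrite u0S; apply/diag_prel.
    exact: fact1.
  rewrite -[in RHS]e -factM ?amula1.
  - by rewrite !pairE mulgKV.
  - by apply: in1X; rewrite groupM ?groupV.
  - exact/setXP.
have lP : lifts_to P u0 P.
  have es : stab u0 = diag G by exact: (congr1 fst u0S).
  split=> //.
  - apply/fintype.subsetP => k Pk; apply/mem_p1; exists k.
    by rewrite es mem_diag eqxx (fintype.subsetP sP).
  - apply: eq_group => k; rewrite es; apply/idP/mem_coimg => [Pk|[l Pl]].
      by exists k => //; rewrite mem_diag eqxx (fintype.subsetP sP).
    by rewrite mem_diag => /andP[/eqP<-].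
  - by move=> k h a Pk; rewrite u0S => /diag_prel[-> _ ->]; rewrite amul1a.
rewrite (upper_mapE _ _ _ _ _ MP rP) big_ord1 (upper_term_lift _ _ _ _ MP lP) //.
rewrite u0S (_ : cut_pair _ _ = triv_pair (diag P.1)) ?fmap_id //.
apply: prel_ext; [exact/cut_supported/triv_supported|exact: triv_supported|].
move=> [k l] a; rewrite cut_prel !diag_prel.
split=> [[/= Pk [<- _ ->]]|[-> Pl ->]]; split=> //.
by split=> //; exact: (fintype.subsetP sP).
Qed.

Section Comp.
Variables (gT hT kT : finGroupType) (G : {group gT}) (H : {group hT}) (K : {group kT}).
Hypotheses (gG : GG G) (gH : GG H) (gK : GG K).
Variables (U : biset A G H) (V : biset A H K).
Variables (SU : stab_in SL U) (SV : stab_in SL V) (SW : stab_in SL (tens U V)).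
Let kU := stab_in_hfree HS gH SU.
Let kV := stab_in_hfree HS gK SV.
Let kW := stab_in_hfree HS gK SW.

Lemma tpt_actr (k : kT) (b : A) (u : U) (v : V) : k \in K ->
  fact (1%g, k) b (tpt kU u v) = tpt kU u (fact (1%g, k) b v).
Proof.
move=> Kk; rewrite tpt_act //; apply/esym/tpt_eq; exists 1%g, (ainv b).
rewrite ainvK; split=> //.
by rewrite -factM ?inX1 ?in1X // !pairE amulVa.
Qed.

(* Since H acts freely on the A-orbits of U, fixing the representative of the
   first factor leaves only scalars to move to the second one. *)
Lemma tens_horb_reps (I J : finType) (r : I -> U) (s : J -> V) :
  reps (@horb _ _ _ _ _ U) r -> reps (@horb _ _ _ _ _ V) s ->
  reps (@horb _ _ _ _ _ (tens U V)) (fun p => tpt kU (r p.1) (s p.2)).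
Proof.
move=> [rS rI] [sS sI]; split=> [y|[i j] [i' j'] [k [b [Kk]]]].
  have [u [v ->]] := tpt_surj kU y; have [i [h [a [Hh eu]]]] := rS u.
  have [j [k [b [Kk ev]]]] := sS (fact (h^-1%g, 1%g) a v).
  exists (i, j), k, b; split=> //; rewrite [RHS]tpt_actr // -ev.
  apply/tpt_eq; exists h^-1%g, a; rewrite groupV; split=> //.
  by rewrite eu -factM ?in1X ?groupV // !pairE mulVg amulVa -pair1 fact1.
rewrite tpt_actr // => /esym/tpt_eq[h [a [Hh /= ei ej]]].
have ii' : i = i' by apply: rI; exists h, (ainv a).
rewrite -ii' in ei *; have [|h1 a1] := hfree_act kU (a := ainv a) (b := 1%ab) (u := r i) Hh.
  by rewrite -ei fact1.
have ea : a = 1%ab by rewrite -[a]ainvK a1 ainv1.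
rewrite ea h1 -pair1 fact1 in ej.
by congr (_, _); apply: sI; exists k, b.
Qed.

Lemma upper_term_tens P (u : U) (v : V) (x : F_upper F K) Q :
  in_M' GG G P -> lifts_to P u Q ->
  upper_term P (tpt kU u v) x =
  fmap F P.1 Q.1 (cut_pair P.1 (stab_pair u)) (upper_term Q v x).
Proof.
move=> MP lQ; have MQ := lift_in_M' HS gH SU MP lQ.
have [[W lW]|no] := pselect (exists W, lifts_to Q v W); last first.
  rewrite (upper_term_none HS gK SV _ MQ no) linear0.
  apply: (upper_term_none HS gK SW) => // -[W /lift_tpt[//|Q' [lQ' lW]]].
  by apply: no; exists W; rewrite (lift_uniq lQ lQ').
have lPW : lifts_to P (tpt kU u v) W by apply/lift_tpt => //; exists Q.
have MW := lift_in_M' HS gK SV MQ lW.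
rewrite (upper_term_lift HS gK SV _ MQ lW) (upper_term_lift HS gK SW _ MP lPW).
have [_ gP] := MP; have [_ gQ] := MQ; have [_ gW] := MW.
have [sQ _ _ _] := lW; have [sP eQ _ _] := lQ.
have S1 := lift_SS HS gH SU MP lQ.
rewrite (fmapM HS _ gP gQ gW S1 (lift_SS HS gK SV MQ lW) _ erefl); last first.
  apply/fintype.subsetP => h Qh; have /mem_p1[l sv] := fintype.subsetP sQ h Qh.
  by apply/mem_p1; exists l; rewrite mem_cut sv.
congr (fmap _ _ _ _ _); apply: prel_ext.
- exact/cut_supported/stab_supported.
- exact: star_supported.
move=> [k l] c; rewrite cut_prel stab_tpt star_prel; last exact: kU.
rewrite star_prel; last exact: (adm_k2 HS gP gQ S1).
split=> [[/= Pk [h [a [b [pu pv ->]]]]]|[h [a [b [/cut_prel[Pk pu] /cut_prel[_ pv] ->]]]]].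
  exists h, a, b; split=> //; apply/cut_prel; split=> //=.
  by rewrite eQ; apply/mem_coimg; exists k => //; case: pu.
by split=> //; exists h, a, b.
Qed.

Lemma upper_map_comp (x : F_upper F K) :
  upper_map HS gG gK SW x = upper_map HS gG gH SU (upper_map HS gH gK SV x).
Proof.
apply: fupper_eq => P MP; have [n [r rP]] := horb_reps_exist U.
have [m [s sP]] := horb_reps_exist V.
rewrite (upper_mapE _ _ _ _ _ MP (tens_horb_reps rP sP)) (upper_mapE _ _ _ _ _ MP rP).
rewrite -(pair_bigA _ (fun i j => upper_term P (tpt kU (r i) (s j)) x)) /=.
apply: eq_bigr => i _; have [[Q lQ]|no] := pselect (exists Q, lifts_to P (r i) Q).
  rewrite (upper_term_lift HS gH SU _ MP lQ).
  have MQ := lift_in_M' HS gH SU MP lQ.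
  rewrite (upper_mapE _ _ _ _ _ MQ sP) linear_sum; apply: eq_bigr => j _.
  exact: upper_term_tens.
rewrite (upper_term_none HS gH SU _ MP no) big1 // => j _.
apply: (upper_term_none HS gK SW) => // -[W /lift_tpt[//|Q [lQ _]]].
by apply: no; exists Q.
Qed.
End Comp.
End UpperFun.

(** * The mark morphism *)

Lemma linear_morph (S : pzRingType) (M N : lmodType S) (f : M -> N) :
  (forall a x y, f (a *: x + y) = a *: f x + f y)%R ->
  [/\ f 0 = 0, forall x y, f (x + y) = f x + f y & forall x, f (- x) = - f x]%R.
Proof.
move=> fl; have fD x y : (f (x + y) = f x + f y)%R by have := fl 1%R x y; rewrite !scale1r.
have f0 : (f 0 = 0)%R by have /eqP := fD 0%R 0%R; rewrite addr0 -subr_eq subrr => /eqP.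
by split=> // x; apply/eqP; rewrite -addr_eq0 -fD addNr f0.
Qed.

Section Mark.
Local Open Scope ring_scope.
Variables (A : abgroup) (R : comPzRingType) (GG : group_class) (SS : pair_family A).
Hypothesis HS : admissible GG SS.
Variable F : functor R GG SS.
Implicit Types gT hT kT : finGroupType.
Notation SL := (S_lower GG SS).

Section Obj.
Variables (gT : finGroupType) (G : {group gT}).
Hypothesis gG : GG G.
Implicit Types (P : gpair A gT).

Definition mark_term (X : gam F G) P (x : X) : fobj F P.1 :=
  if `[< pair_le P (stab_pair x) >] then fres F P.1 (stab x) (gsec x) else 0.

Lemma pair_le_conj (X : fibset A G) P (x : X) g a : g \in G ->
  pair_le (conj_pair g P) (stab_pair (fact g a x)) <-> pair_le P (stab_pair x).
Proof.
move=> Gg; rewrite stab_act //; split=> -[sP e].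
  have {}sP : P.1 \subset (stab_pair x).1 by move: sP; rewrite /= conjSg.
  by split=> // k; have := e (k ^ g^-1)%g; rewrite mem_conjG !conj_pairE conjgKV.
split; first by rewrite /= conjSg.
by move=> k; rewrite mem_conjG !conj_pairE; exact: e.
Qed.

(** Again a double use: g = 1 gives independence of the representative of an A-orbit, general g the
    G-invariance of the family of marks. *)
Lemma mark_term_conj (X : gam F G) P (x : X) g a : in_M' GG G P -> g \in G ->
  mark_term (conj_pair g P) (fact g a x) =
  fconj F g (conj_pair g P).1 P.1 (mark_term P x).
Proof.
move=> MP Gg; have [[sPG _] gP] := MP; have [_ ggP] := conj_in_M' HS gG Gg MP.
rewrite /mark_term (asbool_equiv_eq (pair_le_conj P x a Gg)).
case: asboolP => [[sP _]|_]; last by rewrite linear0.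
have gx := gam_stab x; have gy := gam_stab (fact g a x).
have sy : (conj_pair g P).1 \subset stab (fact g a x).
  by rewrite group_stab_act //= conjSg.
have [_ S1] := SS_conj_diag HS gG sPG gP Gg.
have [_] := SS_conj_diag HS gG (stab_sub x) gx Gg.
rewrite -(group_stab_act x a Gg) => S2.
rewrite (gsec_act x a Gg).
rewrite (fmapM HS _ ggP gy gx (adm_vi HS gy sy ggP) S2 _ erefl); last first.
  apply/fintype.subsetP => y; rewrite group_stab_act // mem_conjG => sxy.
  by apply/mem_p1; exists (y ^ g)%g; rewrite mem_conj_diag conjgK eqxx.
rewrite (fmapM HS _ ggP gP gx S1 (adm_vi HS gx sP gP) _ erefl); last first.
  by apply/fintype.subsetP => k Pk; apply/mem_p1; exists k; rewrite mem_diag eqxx.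
congr (fmap _ _ _ _ _); apply: prel_ext; [exact: star_supported|exact: star_supported|].
move=> [k l] c; rewrite !star_prel ?k2_diag ?k2_conj_diag //.
split=> -[m [b [d [p q ->]]]].
  move: q; move/diag_prel: p => [<- Pk ->] /conj_diag_prel[ek sl ->].
  have Pl : l \in P.1 by move: Pk; rewrite mem_conjG ek conjgKV.
  by exists l, 1%ab, 1%ab; split=> //; [apply/conj_diag_prel|apply/diag_prel].
move/conj_diag_prel: p => [-> Pm ->]; move/diag_prel: q => [<- _ ->].
exists (m ^ g^-1)%g, 1%ab, 1%ab; split=> //.
  by apply/diag_prel; rewrite mem_conjG conjgKV.
by apply/conj_diag_prel; split=> //; exact: (fintype.subsetP sP).
Qed.

Lemma mark_term_act (X : gam F G) P (x y : X) : in_M' GG G P -> aorb x y ->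
  mark_term P x = mark_term P y.
Proof.
move=> MP [a ->]; have := mark_term_conj y a MP (group1 G).
by rewrite conj_pair1 fconj1 //; case: MP.
Qed.

Lemma mark_sum_reps (X : gam F G) P (I J : finType) (s : I -> X) (t : J -> X) :
  in_M' GG G P -> reps (@aorb _ _ _ X) s -> reps (@aorb _ _ _ X) t ->
  \sum_i mark_term P (s i) = \sum_j mark_term P (t j).
Proof.
move=> MP sP tP.
apply: (sum_reps (@aorb_sym _ _ _ X) (@aorb_trans _ _ _ X) (P := xpredT)
  (f := fun x => mark_term P x) sP tP) => x y xy.
by rewrite (mark_term_act MP xy).
Qed.

Section Val.
Variable X : gam F G.
Let rr := cid (svalP (cid (aorb_reps_exist X))).
Let r := sval rr.
Let rP : reps (@aorb _ _ _ X) r := svalP rr.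

Definition mark_val P : fobj F P.1 :=
  if pselect (in_M' GG G P) then \sum_i mark_term P (r i) else 0.

Lemma mark_valE P (J : finType) (t : J -> X) : in_M' GG G P ->
  reps (@aorb _ _ _ X) t -> mark_val P = \sum_j mark_term P (t j).
Proof.
by move=> MP tP; rewrite /mark_val; case: pselect => [?|//]; exact: mark_sum_reps.
Qed.

Lemma mark_val_out P : ~ in_M' GG G P -> mark_val P = 0.
Proof. by move=> nP; rewrite /mark_val; case: pselect. Qed.

(** If the mark at (K, lambda) is nonzero, lambda is the restriction to K of the homomorphism of
    some representative; so K and an index determine the pair. *)
Lemma mark_val_fin : finite_set [set P | mark_val P <> 0]%classic.
Proof.
pose f (K : {group gT}) i : gpair A gT :=
  (K, [ffun k => if k \in K then stab_char (r i) k else 1%ab]).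
apply: (@sub_finite_set _ _ [set f K i | K in setT & i in setT]%classic); last first.
  by apply: finite_image2; exact: finite_finset.
move=> P /= nz; have MP : in_M' GG G P by apply: contrapT => /mark_val_out.
move: nz; rewrite (mark_valE MP rP) => nz.
have [i nzi] : exists i, mark_term P (r i) <> 0.
  by apply: contrapT => no; apply: nz; rewrite big1 // => i _;
    apply: contrapT => e; apply: no; exists i.
move: nzi; rewrite /mark_term; case: asboolP => // -[sP e] _.
exists P.1 => //; exists i => //; rewrite /f [RHS]surjective_pairing.
congr (_, _); apply/ffunP => k; rewrite ffunE.
by case: ifP => [/e //|/negbT nk]; have [[_ [_ ->]]] := MP.
Qed.

Lemma mark_val_inv g P : g \in G -> in_M' GG G P ->
  fconj F g (conj_pair g P).1 P.1 (mark_val P) = mark_val (conj_pair g P).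
Proof.
move=> Gg MP; have MgP := conj_in_M' HS gG Gg MP; rewrite (mark_valE MP rP) linear_sum.
have tP : reps (@aorb _ _ _ X) (fun i => fact g 1%ab (r i)).
  have [rS rI] := rP; split=> [x|i j [a]].
    have [i [a e]] := rS (fact g^-1%g 1%ab x).
    exists i, a; rewrite -factCA // -e -factM ?groupV // mulgV amul1a.
    by rewrite fact1.
  by rewrite -factCA // => /(fact_inj Gg) e; apply: rI; exists a.
rewrite (mark_valE MgP tP); apply: eq_bigr => i _.
by rewrite mark_term_conj.
Qed.

Definition mark_fam : F_upper F G := FUpperFam mark_val_out mark_val_fin mark_val_inv.

Lemma mark_famE P (J : finType) (t : J -> X) : in_M' GG G P ->
  reps (@aorb _ _ _ X) t -> mark_fam P = \sum_j mark_term P (t j).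
Proof. exact: mark_valE. Qed.
End Val.

(** The equality of the stabilizers is part of [gam_mor]; equivariance carries the scalars over, and
    they are unique. *)
Lemma gam_mor_stab (X Y : gam F G) (f : X -> Y) x : gam_mor f ->
  stab_pair (f x) = stab_pair x.
Proof.
move=> [fE fs]; have es : stab x = stab (f x) by exact: (congr1 (fun z => tag z) (fs x)).
apply: prel_ext; try exact: stab_supported.
have imp g a : prel (stab_pair x) g a -> prel (stab_pair (f x)) g a.
  by move=> /stab_prel[Gg e]; apply/stab_prel; rewrite -fE // e fE.
move=> g a; split; last exact: imp.
move=> fga; have sg : g \in stab x by rewrite es; case: fga.
have h : prel (stab_pair x) g (stab_char x g) by [].
by rewrite (prel_uniq fga (imp _ _ h)).
Qed.

Lemma mark_term_mor (X Y : gam F G) (f : X -> Y) x P : gam_mor f ->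
  mark_term P (f x) = mark_term P x.
Proof.
move=> fM; have [fE fs] := fM; rewrite /mark_term gam_mor_stab //.
by case: ifP => // _; rewrite /fres (tag_fmap _ _ (fs x)).
Qed.

Lemma mark_rel (X : gam F G) Xs : gam_rel X Xs ->
  mark_fam X = \sum_(Y <- Xs) mark_fam Y.
Proof.
case=> [{}X Y f fM fB|{}X Y Z i j iM jM ijB|{}X s r t sK rK tK sE rE tE e].
- rewrite big_seq1; apply: fupper_eq => P MP.
  have [n [r rP]] := aorb_reps_exist X; have [fE _] := fM; have [g fK gK] := fB.
  have frP : reps (@aorb _ _ _ Y) (f \o r).
    have [rS rI] := rP; split=> [y|k l [a /= e]].
      have [k [a e]] := rS (g y); exists k, a.
      by rewrite -(gK y) e fE.
    by apply: rI; exists a; apply: (can_inj fK); rewrite fE.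
  rewrite (mark_famE MP rP) (mark_famE MP frP); apply: eq_bigr => k _.
  by rewrite /= mark_term_mor.
- rewrite big_cons big_seq1; apply: fupper_eq => P MP.
  rewrite [RHS](_ : _ = mark_fam X P + mark_fam Y P) //.
  have [n [r rP]] := aorb_reps_exist X; have [m [s sP]] := aorb_reps_exist Y.
  have [iE _] := iM; have [jE _] := jM; have ijI := bij_inj ijB; have [ij _ ijK] := ijB.
  pose t (k : 'I_n + 'I_m) : Z := match k with inl k => i (r k) | inr k => j (s k) end.
  have tP : reps (@aorb _ _ _ Z) t.
    have [rS rI] := rP; have [sS sI] := sP; split.
      move=> z; rewrite -(ijK z); case: (ij z) => w.
        by have [k [a ->]] := rS w; exists (inl k), a; rewrite iE.
      by have [k [a ->]] := sS w; exists (inr k), a; rewrite jE.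
    move=> [k|k] [l|l] [a] /=; rewrite -?iE -?jE // => e0.
    + congr inl; apply: rI; exists a.
      by have [] : inl (r k) = inl (fact 1%g a (r l)) :> X + Y by exact: ijI.
    + by have : inl (r k) = inr (fact 1%g a (s l)) :> X + Y by exact: ijI.
    + by have : inr (s k) = inl (fact 1%g a (r l)) :> X + Y by exact: ijI.
    + congr inr; apply: sI; exists a.
      by have [] : inr (s k) = inr (fact 1%g a (s l)) :> X + Y by exact: ijI.
  rewrite (mark_famE MP tP) (mark_famE MP rP) (mark_famE MP sP) big_sumType.
  by congr (_ + _); apply: eq_bigr => k _; rewrite /= mark_term_mor.
- rewrite big_cons big_seq1; apply: fupper_eq => P MP.
  rewrite [RHS](_ : _ = mark_fam (Gam sK sE) P + mark_fam (Gam rK rE) P) //.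
  have [n [q qP]] := aorb_reps_exist X.
  rewrite (mark_famE (X := Gam tK tE) MP qP) (mark_famE (X := Gam sK sE) MP qP).
  rewrite (mark_famE (X := Gam rK rE) MP qP) -big_split; apply: eq_bigr => k _.
  by rewrite /mark_term /=; case: ifP => _; rewrite ?addr0 // e linearD.
Qed.

(** The target is regarded as a module over the integers to match the presentation of F_+;
    compatibility with R is [mark_funZ]. *)
Definition mark_fun (c : F_plus F G) : F_upper F G :=
  plift (fun X => mark_fam X : ssrint.zmodule (Fupper F G)) c.

Lemma mark_fun_cls X : mark_fun (gam_cls X) = mark_fam X.
Proof. by rewrite /mark_fun [LHS]plift_gen // => ? ? /mark_rel. Qed.

Lemma mark_funD : {morph mark_fun : c d / c + d}.
Proof. by move=> c d; rewrite /mark_fun [LHS]pliftD // => ? ? /mark_rel. Qed.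

Lemma mark_fun0 : mark_fun 0 = 0.
Proof. by rewrite /mark_fun [LHS]plift0 // => ? ? /mark_rel. Qed.

Lemma mark_funN c : mark_fun (- c) = - mark_fun c.
Proof. by apply/eqP; rewrite -addr_eq0 -mark_funD addNr mark_fun0. Qed.

Lemma mark_funZ r c : mark_fun (r *: c) = r *: mark_fun c.
Proof.
elim/fplus_ind: c => [X||c d IH IH'|c IH].
- rewrite scale_cls !mark_fun_cls; apply: fupper_eq => P MP.
  have [n [q qP]] := aorb_reps_exist X.
  rewrite (mark_famE (X := gam_scale r X) MP qP).
  rewrite [RHS](_ : _ = r *: mark_fam X P) // (mark_famE MP qP) scaler_sumr.
  apply: eq_bigr => k _; rewrite /mark_term /=; case: ifP => _; rewrite ?scaler0 //.
  by rewrite linearZ.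
- by rewrite scaler0 mark_fun0 scaler0.
- by rewrite scalerDr !mark_funD IH IH' scalerDr.
- by rewrite scalerN !mark_funN IH scalerN.
Qed.
End Obj.

(** * Commutation of the mark maps with [U] *)

Section Comm.
Variables (gT hT : finGroupType) (G : {group gT}) (H : {group hT}).
Hypotheses (gG : GG G) (gH : GG H).
Variables (U : biset A G H) (SU : stab_in SL U).
Let kU := stab_in_hfree HS gH SU.

Lemma tens_aorb_reps (X : fibset A H) (I J : finType) (r : I -> U) (s : J -> X) :
  reps (@horb _ _ _ _ _ U) r -> reps (@aorb _ _ _ X) s ->
  reps (@aorb _ _ _ (tens_fib U X)) (fun p => tp kU (r p.1) (s p.2)).
Proof.
move=> [rS rI] [sS sI]; split=> [y|[i j] [i' j'] [b]].
  have [u [x ->]] := tp_surj kU y; have [i [h [a [Hh eu]]]] := rS u.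
  have [j [b ev]] := sS (fact h^-1%g a x).
  exists (i, j), b; rewrite [RHS]tp_actA -ev.
  apply/tp_eq; exists h^-1%g, a; rewrite groupV; split=> //.
  by rewrite eu -factM ?in1X ?groupV // !pairE mulVg amulVa -pair1 fact1.
rewrite tp_actA => /esym/tp_eq[h [a [Hh /= ei ej]]].
have ii' : i = i' by apply: rI; exists h, (ainv a).
rewrite -ii' in ei *; have [|h1 a1] := hfree_act kU (a := ainv a) (b := 1%ab) (u := r i) Hh.
  by rewrite -ei fact1.
have ea : a = 1%ab by rewrite -[a]ainvK a1 ainv1.
rewrite ea h1 fact1 in ej.
by congr (_, _); apply: sI; exists b.
Qed.

(** Restricting U(s)(u (x) x) to K, or restricting s(x) to K^u and then applying (K x H)_u, amounts
    to the same pair: phi_u on (K x H)_u, now between K and H_x. *)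
Lemma mark_term_tens (X : gam F H) (u : U) (x : X) P Q :
  in_M' GG G P -> lifts_to P u Q ->
  mark_term (X := tgam HS gG gH SU X) P (tp kU u x) =
  fmap F P.1 Q.1 (cut_pair P.1 (stab_pair u)) (mark_term Q x).
Proof.
move=> MP lQ; have MQ := lift_in_M' HS gH SU MP lQ; rewrite /mark_term.
case: asboolP => [/lift_tp[Q' [lQ' leQ]]|no]; last first.
  case: asboolP => [leQ|_]; last by rewrite linear0.
  by case: no; apply/lift_tp; exists Q.
rewrite -(lift_uniq lQ lQ') in leQ; rewrite asboolT //=.
have [sPy _] : pair_le P (stab_pair (tp kU u x)) by apply/lift_tp; exists Q.
have [sQ _] := leQ; have [sP eQ _ _] := lQ.
have [_ gP] := MP; have [_ gQ] := MQ; have gx := gam_stab x.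
have [gy Sy] := tp_SS HS gH SU u x.
have S1 := lift_SS HS gH SU MP lQ.
rewrite tsec_tp /tens_val.
rewrite (fmapM HS _ gP gy gx (adm_vi HS gy sPy gP) Sy _ erefl); last exact: sd_p1.
rewrite (fmapM HS _ gP gQ gx S1 (adm_vi HS gx sQ gQ) _ erefl); last first.
  by apply/fintype.subsetP => k Pk; apply/mem_p1; exists k; rewrite mem_diag eqxx.
congr (fmap _ _ _ _ _); apply: prel_ext; [exact: star_supported|exact: star_supported|].
move=> [k l] c; rewrite !star_prel ?k2_diag //; last exact: (adm_k2 HS gP gQ S1).
split=> -[m [a [b [p q ->]]]].
  move: q; move/diag_prel: p => [<- Pk ->] /(sd_prel HS gH SU)[pu sl].
  exists l, b, 1%ab; rewrite amul1a amula1; split=> //; first exact/cut_prel.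
  by apply/diag_prel; split=> //; rewrite eQ; apply/mem_coimg; exists k => //; case: pu.
move/cut_prel: p => [Pk pu]; move/diag_prel: q => [<- Qm ->].
exists k, 1%ab, a; rewrite amul1a amula1; split=> //; first exact/diag_prel.
by apply/(sd_prel HS gH SU); split=> //; exact: (fintype.subsetP sQ).
Qed.

Lemma mark_commutes (c : F_plus F H) :
  upper_map HS gG gH SU (mark_fun gH c) = mark_fun gG (plus_map HS gG gH SU c).
Proof.
have [um0 umD umN] := @linear_morph R (F_upper F H) (F_upper F G) _
  (upper_map_linear HS gG gH SU).
elim/fplus_ind: c => [X||c d IH IH'|c IH].
- rewrite plus_map_cls !mark_fun_cls; apply: fupper_eq => P MP.
  have [n [r rP]] := horb_reps_exist U; have [m [s sP]] := aorb_reps_exist X.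
  rewrite (upper_mapE _ _ _ _ _ MP rP).
  rewrite (mark_famE gG (X := tgam HS gG gH SU X) MP (tens_aorb_reps rP sP)).
  rewrite -(pair_bigA _ (fun i j => mark_term (X := tgam HS gG gH SU X) P (tp kU (r i) (s j)))) /=.
  apply: eq_bigr => i _; have [[Q lQ]|no] := pselect (exists Q, lifts_to P (r i) Q).
    rewrite (upper_term_lift HS gH SU _ MP lQ).
    have MQ := lift_in_M' HS gH SU MP lQ.
    rewrite (mark_famE gH MQ sP) linear_sum; apply: eq_bigr => j _.
    by rewrite (mark_term_tens _ MP lQ).
  rewrite (upper_term_none HS gH SU _ MP no) big1 // => j _.
  rewrite /mark_term; case: asboolP => // /lift_tp[Q [lQ _]].
  by case: no; exists Q.
- by rewrite plus_map0 !mark_fun0 um0.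
- by rewrite plus_mapD !mark_funD -IH -IH' umD.
- by rewrite plus_mapN !mark_funN -IH umN.
Qed.
End Comm.
End Mark.

(** * Extension to the Burnside modules *)

(** The proof of linearity is an argument so that the instance below can find it from the term. *)
Definition linear_fun (R : pzRingType) (M N : lmodType R) (f : M -> N) of linear f :=
  f.
HB.instance Definition _ (R : pzRingType) (M N : lmodType R) (f : M -> N)
  (fl : linear f) := GRing.isLinear.Build R M N _ (linear_fun fl) fl.

Section Extension.
Local Open Scope ring_scope.
Variables (A : abgroup) (R : comPzRingType) (GG : group_class) (SS : pair_family A).
Hypothesis HS : admissible GG SS.
Variables (gT hT : finGroupType) (G : {group gT}) (H : {group hT}).
Hypotheses (gG : GG G) (gH : GG H).
Notation SL := (S_lower GG SS).

(* Restricting to the part of a biset whose stabilizing pairs lie in S_+ extends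
   an additive function of the bisets over S_+ to all bisets. *)
Section Good.
Variable U : biset A G H.

Definition good_car := {u : U | SL G H (stab_pair u)}.

Lemma good_act_subproof x a (u : good_car) : x \in setX_group G H ->
  SL G H (stab_pair (fact x a (sval u))).
Proof. by move=> GHx; rewrite stab_act //; apply: SL_conj => //; exact: svalP u. Qed.

Definition good_act := ext_act (fun x (GHx : x \in setX_group G H) a (u : good_car) =>
  exist _ (fact x a (sval u)) (good_act_subproof a u GHx) : good_car).

Lemma good_actE x a u : x \in setX_group G H -> sval (good_act x a u) = fact x a (sval u).
Proof. by move=> GHx; rewrite /good_act (ext_actE _ GHx). Qed.

Lemma good_inj : injective (fun u : good_car => sval u).
Proof. by case=> u p [v q] /= e; exact: eq_exist. Qed.

Lemma good_act1 u : good_act 1%g 1%ab u = u.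
Proof. by apply: good_inj; rewrite good_actE ?group1 // fact1. Qed.

Lemma good_actM : {in setX_group G H &, forall x y a b u,
  good_act (x * y)%g (a * b)%ab u = good_act x a (good_act y b u)}.
Proof.
by move=> x y Gx Gy a b u; apply: good_inj; rewrite !good_actE ?groupM // factM.
Qed.

Lemma good_free a u : good_act 1%g a u = u -> a = 1%ab.
Proof. by move=> /(congr1 sval); rewrite good_actE ?group1 // => /ffree. Qed.

Lemma good_fin : exists (n : nat) (r : 'I_n -> good_car),
  forall u, exists i a, u = good_act 1%g a (r i).
Proof.
have [[u0]|no] := pselect (inhabited good_car); last first.
  exists 0%N, (fun i : 'I_0 => False_rect _ (notF (ltn_ord i))).
  by move=> u; case: no.
have [n [r rS]] := ffin U.
exists n, (fun i => if pselect (SL G H (stab_pair (r i))) is left p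
                    then exist _ (r i) p : good_car else u0) => u.
have [i [a e]] := rS (sval u); exists i, a; apply: good_inj; rewrite good_actE ?group1 //.
case: pselect => [p //|[]].
have -> : r i = fact 1%g (ainv a) (sval u) by rewrite e fact_fact1 amulVa fact1.
by rewrite stab_act ?group1 // conj_pair1; exact: svalP u.
Qed.

Definition good : biset A G H := FibSet _ _ good_act1 good_actM good_free good_fin.

Definition to_good (u : U) (p : SL G H (stab_pair u)) : good := exist _ u p.

Lemma good_val_equivariant : equivariant (fun u : good => sval u).
Proof. by move=> x a u GHx; rewrite good_actE. Qed.

Lemma good_stab_in : stab_in SL good.
Proof.
move=> u; rewrite -(stab_pair_inj u good_val_equivariant good_inj); exact: svalP u.
Qed.

Lemma good_iso : stab_in SL U -> fib_iso good U.
Proof.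
move=> SU; exists (fun u : good => sval u); split; first exact: good_val_equivariant.
by apply: inj_surj_bij => [|u]; [exact: good_inj|exists (to_good (SU u))].
Qed.
End Good.

Lemma good_map (U V : biset A G H) (f : U -> V) : equivariant f -> injective f ->
  exists g : good U -> good V,
  [/\ equivariant g, injective g & forall u, sval (g u) = f (sval u)].
Proof.
move=> fE fI.
have h (u : good U) : SL G H (stab_pair (f (sval u))).
  by rewrite stab_pair_inj //; exact: svalP u.
exists (fun u => to_good (h u)); split=> //.
  by move=> x a u GHx; apply: good_inj; rewrite /= !good_actE //= fE.
by move=> u v /(congr1 sval) /= /fI /good_inj.
Qed.

Lemma good_iso_iso (U V : biset A G H) : fib_iso U V -> fib_iso (good U) (good V).
Proof.
move=> [f [fE [f' fK f'K]]]; have fI := can_inj fK.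
have [g [gE gI ge]] := good_map fE fI; exists g; split=> //.
apply: inj_surj_bij => // v.
have h : SL G H (stab_pair (f' (sval v))).
  by rewrite -(stab_pair_inj (f' (sval v)) fE fI) f'K; exact: svalP v.
by exists (to_good h); apply: good_inj; rewrite ge /= f'K.
Qed.

Lemma good_sum (U V : biset A G H) :
  fib_iso (sum_fib (good U) (good V)) (good (sum_fib U V)).
Proof.
have [g [gE gI ge]] := good_map (@inl_equivariant _ _ _ U V) (@inl_inj' _ _).
have [k [kE kI ke]] := good_map (@inr_equivariant _ _ _ U V) (@inr_inj' _ _).
pose t (w : sum_fib (good U) (good V)) := match w with inl u => g u | inr v => k v end.
exists t; split; first by move=> x a [u|v] GHx; [exact: gE|exact: kE].
apply: inj_surj_bij => [[u|u] [v|v]|[[u|v] p]].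
- by move=> /gI ->.
- by move=> /(congr1 sval); rewrite ge ke.
- by move=> /(congr1 sval); rewrite ge ke.
- by move=> /kI ->.
- have h : SL G H (stab_pair u).
    by rewrite -(stab_pair_inj u (@inl_equivariant _ _ _ U V) (@inl_inj' _ _)).
  by exists (inl (to_good h)); apply: good_inj; rewrite ge.
- have h : SL G H (stab_pair v).
    by rewrite -(stab_pair_inj v (@inr_equivariant _ _ _ U V) (@inr_inj' _ _)).
  by exists (inr (to_good h)); apply: good_inj; rewrite ke.
Qed.

Variables (M N : lmodType R) (Phi : forall U : biset A G H, stab_in SL U -> M -> N).
Hypothesis Phi_linear : forall U (SU : stab_in SL U), linear (Phi SU).
Hypothesis Phi_iso : forall U V (SU : stab_in SL U) (SV : stab_in SL V) c,
  fib_iso U V -> Phi SU c = Phi SV c.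
Hypothesis Phi_sum : forall U V (SU : stab_in SL U) (SV : stab_in SL V)
  (SUV : stab_in SL (sum_fib U V)) c, Phi SUV c = Phi SU c + Phi SV c.

Definition extend (f : BR A R G H) (c : M) : N :=
  plift (fun U => Phi (@good_stab_in U) c) f.

Lemma sum_stab_in (U V : biset A G H) :
  stab_in SL U -> stab_in SL V -> stab_in SL (sum_fib U V).
Proof.
move=> SU SV [u|v].
  by rewrite (stab_pair_inj u (@inl_equivariant _ _ _ U V) (@inl_inj' _ _)).
by rewrite (stab_pair_inj v (@inr_equivariant _ _ _ U V) (@inr_inj' _ _)).
Qed.

(** Isomorphisms and the inclusions into a disjoint union do not change stabilizing pairs, so the
    relations of the Burnside module restrict to the parts over S_+. *)
Lemma extend_rel c (U : biset A G H) Us : fib_rel U Us ->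
  Phi (@good_stab_in U) c = \sum_(V <- Us) Phi (@good_stab_in V) c.
Proof.
case=> [{}U V UV|{}U V].
  by rewrite big_seq1; apply/Phi_iso/good_iso_iso.
have SUV := sum_stab_in (@good_stab_in U) (@good_stab_in V).
rewrite big_cons big_seq1 -(Phi_sum _ _ SUV).
by apply/esym/Phi_iso/good_sum.
Qed.

Lemma extend_cls (U : biset A G H) (SU : stab_in SL U) c :
  extend (cls R U) c = Phi SU c.
Proof.
by rewrite /extend plift_gen; [exact/Phi_iso/good_iso|exact: extend_rel].
Qed.

Lemma extend_linearl c : linear (extend^~ c).
Proof.
by move=> a f g; rewrite /extend pliftD ?pliftZ //; exact: extend_rel.
Qed.

Lemma extend_linear f : linear (extend f).
Proof.
move=> a c d.
have [l0 lD _] := linear_morph (extend_linearl c).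
have [m0 mD _] := linear_morph (extend_linearl d).
have [n0 nD _] := linear_morph (extend_linearl (a *: c + d)).
elim/presented_ind: f => [U||f g IH IH'|r f IH].
- rewrite /extend !plift_gen; first exact: Phi_linear; exact: extend_rel.
- by rewrite n0 l0 m0 scaler0 addr0.
- by rewrite nD lD mD IH IH' scalerDr addrACA.
- have e x : extend (r *: f) x = r *: extend f x.
    by have [x0 _ _] := linear_morph (extend_linearl x);
      have := extend_linearl x r f 0; rewrite x0 !addr0.
  by rewrite !e IH scalerDr !scalerA mulrC.
Qed.

(** Reduces statements on morphisms of the category to bisets over S_+, where [extend] is given by
    [Phi]. *)
Lemma is_mor_ind (Q : BR A R G H -> Prop) :
  (forall U, stab_in SL U -> Q (cls R U)) -> Q 0 ->
  (forall r f g, Q f -> Q g -> Q (r *: f + g)) -> forall f, is_mor SL f -> Q f.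
Proof.
move=> Qc Q0 Ql _ [n [r [P [SP ->]]]].
elim: n r P SP => [|n IH] r P SP; first by rewrite big_ord0.
rewrite big_ord_recl; apply: Ql; last by apply: IH => i; exact: SP.
have PM : in_M (setX_group G H) (P ord0) by case: (SP ord0).
by rewrite (tclsE R PM); apply/Qc/stab_in_trans.
Qed.
End Extension.

(** * From functions of bisets to functors *)

Section BisetFunctor.
Local Open Scope ring_scope.
Variables (A : abgroup) (R : comPzRingType) (GG : group_class) (SS : pair_family A).
Hypothesis HS : admissible GG SS.
Notation SL := (S_lower GG SS).

Variables (M : fun_obj R)
  (Phi : forall (gT hT : finGroupType) (G : {group gT}) (H : {group hT}),
     GG G -> GG H -> forall U : biset A G H, stab_in SL U -> M H -> M G).
Hypothesis Phi_linear : forall gT hT (G : {group gT}) (H : {group hT})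
  (gG : GG G) (gH : GG H) U (SU : stab_in SL U), linear (Phi gG gH SU).
Hypothesis Phi_iso : forall gT hT (G : {group gT}) (H : {group hT})
  (gG : GG G) (gH : GG H) U V (SU : stab_in SL U) (SV : stab_in SL V) c,
  fib_iso U V -> Phi gG gH SU c = Phi gG gH SV c.
Hypothesis Phi_sum : forall gT hT (G : {group gT}) (H : {group hT})
  (gG : GG G) (gH : GG H) U V (SU : stab_in SL U) (SV : stab_in SL V)
  (SUV : stab_in SL (sum_fib U V)) c,
  Phi gG gH SUV c = Phi gG gH SU c + Phi gG gH SV c.
Hypothesis Phi_id : forall gT (G : {group gT}) (gG : GG G) (U : biset A G G)
  (SU : stab_in SL U) (u : U) c, generates u -> stab_pair u = triv_pair (diag G) ->
  Phi gG gG SU c = c.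
Hypothesis Phi_comp : forall gT hT kT (G : {group gT}) (H : {group hT}) (K : {group kT})
  (gG : GG G) (gH : GG H) (gK : GG K) (U : biset A G H) (V : biset A H K)
  (SU : stab_in SL U) (SV : stab_in SL V) (SW : stab_in SL (tens U V)) c,
  Phi gG gK SW c = Phi gG gH SU (Phi gH gK SV c).

Lemma zero_linear (N N' : lmodType R) : linear (fun _ : N => 0 : N').
Proof. by move=> a x y; rewrite scaler0 addr0. Qed.

Definition extend_mor : fun_mor A M := fun gT hT G H f =>
  if pselect (GG G) is left gG then
    if pselect (GG H) is left gH then
      linear_fun (extend_linear HS gG gH (Phi_linear gG gH) (Phi_iso gG gH)
                    (Phi_sum gG gH) f)
    else linear_fun (@zero_linear _ _)
  else linear_fun (@zero_linear _ _).

Lemma extend_morE gT hT (G : {group gT}) (H : {group hT}) (gG : GG G) (gH : GG H) f c :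
  extend_mor f c = extend HS gG gH (Phi gG gH) f c.
Proof.
rewrite /extend_mor; case: pselect => // gG'; case: pselect => // gH' /=.
by rewrite (Prop_irrelevance gG gG') (Prop_irrelevance gH gH').
Qed.

Lemma extend_mor_cls gT hT (G : {group gT}) (H : {group hT}) (gG : GG G) (gH : GG H)
    (U : biset A G H) (SU : stab_in SL U) c : extend_mor (cls R U) c = Phi gG gH SU c.
Proof.
by rewrite (extend_morE gG gH) (extend_cls HS gG gH (Phi_iso gG gH) (Phi_sum gG gH) SU).
Qed.

Lemma extend_mor_linear gT hT (G : {group gT}) (H : {group hT}) (gG : GG G) (gH : GG H) c :
  linear (fun f : BR A R G H => extend_mor f c).
Proof.
move=> r f g; rewrite !(extend_morE gG gH).
exact: (extend_linearl HS gG gH (Phi_iso gG gH) (Phi_sum gG gH)).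
Qed.

(** For the composition law, both sides are bilinear in (f, g), so by [is_mor_ind] applied twice it
    suffices to treat classes of bisets over S_+; their tensor product is again over S_+ by
    [stab_in_tens]. *)
Lemma extend_mor_functor : is_functor GG SL extend_mor.
Proof.
split.
- by move=> gT hT G H gG gH r f g _ _ x; exact: (extend_mor_linear gG gH).
- move=> gT G gG x; have SD := SL_diag HS gG; have [DM _ _] := SD.
  rewrite /idB (tclsE R DM) (extend_mor_cls gG gG (stab_in_trans HS gG gG SD)).
  by apply: Phi_id (trans_base_generates (PG := DM)) _; exact: stab_trans_base.
- move=> gT hT kT G H K gG gH gK f g Mf Mg x.
  have [f0 fD _] := linear_morph (extend_mor_linear gG gH (extend_mor g x)).
  move: f Mf; apply: (is_mor_ind HS gG gH); last first.
  + move=> r f f' IH IH'; rewrite compBl (extend_mor_linear gG gK) IH IH'.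
    by rewrite (extend_mor_linear gG gH).
  + rewrite f0 /compB plift0; last by move=> ? ? /compB_rell.
    by have [] := linear_morph (extend_mor_linear gG gK x).
  move=> U SU; move: g Mg {f0 fD}; apply: (is_mor_ind HS gH gK); last first.
  + move=> r g g' IH IH'; rewrite compBr (extend_mor_linear gG gK) IH IH'.
    by rewrite (extend_mor_linear gH gK) linearP.
  + have -> : compB (cls R U) (0 : BR A R H K) = 0.
      by have [] := linear_morph (f := fun g : BR A R H K => compB (cls R U) g)
        (fun r => compBr r (cls R U)).
    have [-> _ _] := linear_morph (extend_mor_linear gG gK x).
    by have [-> _ _] := linear_morph (extend_mor_linear gH gK x); rewrite linear0.
  move=> V SV; have SW := stab_in_tens HS gH gK SU SV.
  rewrite compB_cls (extend_mor_cls gG gK SW) (extend_mor_cls gH gK SV).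
  by rewrite (extend_mor_cls gG gH SU) (Phi_comp gG gH gK SU SV SW).
Qed.
End BisetFunctor.

(** * The functors F_+ and F^+ and the mark morphism *)

Section Main.
Local Open Scope ring_scope.
Variables (A : abgroup) (R : comPzRingType) (GG : group_class) (SS : pair_family A).
Hypothesis HS : admissible GG SS.
Variable F : functor R GG SS.
Notation SL := (S_lower GG SS).

Lemma plus_map_linear gT hT (G : {group gT}) (H : {group hT}) (gG : GG G) (gH : GG H)
    (U : biset A G H) (SU : stab_in SL U) :
  linear (plus_map HS (F := F) gG gH SU : F_plus F H -> F_plus F G).
Proof. by move=> r c d; rewrite plus_mapD plus_mapZ. Qed.

Lemma mark_fun_linear gT (G : {group gT}) (gG : GG G) :
  linear (mark_fun HS (F := F) gG : F_plus F G -> F_upper F G).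
Proof. by move=> r c d; rewrite mark_funD mark_funZ. Qed.

Definition plus_mor : fun_mor A (F_plus F) :=
  extend_mor HS plus_map_linear (plus_map_iso HS (F := F)) (plus_map_sum HS (F := F)).

Definition upper_mor : fun_mor A (F_upper F) :=
  extend_mor HS (upper_map_linear HS (F := F)) (upper_map_iso HS (F := F))
    (upper_map_sum HS (F := F)).

Definition mark gT (G : {group gT}) : {linear F_plus F G -> F_upper F G} :=
  if pselect (GG G) is left gG then linear_fun (mark_fun_linear gG)
  else linear_fun (@zero_linear _ _ _).

Lemma markE gT (G : {group gT}) (gG : GG G) c : mark G c = mark_fun HS gG c.
Proof.
by rewrite /mark; case: pselect => // gG' /=; rewrite (Prop_irrelevance gG gG').
Qed.

Lemma is_mor_upper gT hT (G : {group gT}) (H : {group hT}) (f : BR A R G H) :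
  GG G -> GG H -> is_mor (S_upper GG SS) f -> is_mor SL f.
Proof.
move=> gG gH [n [r [P [SP ->]]]]; exists n, r, P; split=> // i.
exact/(S_lower_upper HS G gH).
Qed.

Lemma plus_mor_functor : is_functor GG SL plus_mor.
Proof.
apply: extend_mor_functor.
  by move=> gT G gG U SU u c; exact: plus_map_id.
by move=> gT hT kT G H K gG gH gK U V SU SV SW c; exact: plus_map_comp.
Qed.

Lemma upper_mor_functor : is_functor GG (S_upper GG SS) upper_mor.
Proof.
have [Fl Fi Fc] : is_functor GG SL upper_mor.
  apply: extend_mor_functor.
    by move=> gT G gG U SU u c; exact: upper_map_id.
  by move=> gT hT kT G H K gG gH gK U V SU SV SW c; exact: upper_map_comp.
split=> //.
  move=> gT hT G H gG gH r f g /(is_mor_upper gG gH) Mf /(is_mor_upper gG gH) Mg.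
  exact: Fl.
move=> gT hT kT G H K gG gH gK f g /(is_mor_upper gG gH) Mf /(is_mor_upper gH gK) Mg.
exact: Fc.
Qed.

Section Bisets.
Variables (gT hT : finGroupType) (G : {group gT}) (H : {group hT}).
Hypotheses (gG : GG G) (gH : GG H).
Variables (U : biset A G H) (SU : stab_in SL U).

Lemma plus_mor_cls c : plus_mor (cls R U) c = plus_map HS gG gH SU c.
Proof. exact: extend_mor_cls. Qed.

Lemma upper_mor_cls x : upper_mor (cls R U) x = upper_map HS gG gH SU x.
Proof. exact: extend_mor_cls. Qed.

Lemma is_Fplus_map_plus_mor : is_Fplus_map U (plus_mor (cls R U)).
Proof.
move=> X; exists (tsec HS gH SU (X := X)), (tsec_stab HS gH SU (X := X)).
exists (tsec_gam_eq HS gG gH SU (X := X)); split; last first.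
  by rewrite plus_mor_cls plus_map_cls.
by move=> y u x /(is_tens_tp (stab_in_hfree HS gH SU)) ->; exact: tsec_tp.
Qed.

Lemma is_Fupper_map_upper_mor : is_Fupper_map U (upper_mor (cls R U)).
Proof.
move=> x P MP n r /biset_repsE rP.
by rewrite upper_mor_cls (upper_mapE _ _ _ _ _ MP rP) [RHS]big_mkcond.
Qed.

Lemma mark_mor_cls c :
  upper_mor (cls R U) (mark H c) = mark G (plus_mor (cls R U) c).
Proof.
by rewrite upper_mor_cls plus_mor_cls (markE gH) (markE gG) mark_commutes.
Qed.
End Bisets.

Lemma is_mark_map_mark gT (G : {group gT}) : GG G -> is_mark_map (mark G).
Proof.
move=> gG X P MP n r /orbit_repsE rP.
by rewrite (markE gG) mark_fun_cls (mark_famE HS gG MP rP) [RHS]big_mkcond.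
Qed.

(** Both sides are linear in f, so the case of bisets over S_+ in [mark_mor_cls] is enough. *)
Lemma mark_mor gT hT (G : {group gT}) (H : {group hT}) (f : BR A R G H) :
  GG G -> GG H -> is_mor SL f ->
  forall c, upper_mor f (mark H c) = mark G (plus_mor f c).
Proof.
move=> gG gH Mf c; move: f Mf.
have pl := extend_mor_linear HS plus_map_linear (plus_map_iso HS (F := F))
  (plus_map_sum HS (F := F)) gG gH c.
have ul := extend_mor_linear HS (upper_map_linear HS (F := F)) (upper_map_iso HS (F := F))
  (upper_map_sum HS (F := F)) gG gH (mark H c).
apply: (is_mor_ind HS gG gH).
- by move=> U SU; exact: mark_mor_cls.
- have [p0 _ _] := linear_morph pl; have [u0 _ _] := linear_morph ul.
  by rewrite [LHS]u0 [X in mark G X]p0 linear0.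
- move=> r f g IH IH'.
  by rewrite [LHS]ul [X in mark G X]pl linearP; congr (_ *: _ + _).
Qed.
End Main.

Theorem theorem6p1 (A : abgroup) (R : comPzRingType) (GG : group_class)
    (SS : pair_family A)
    (S_M : family_in_M GG SS)
    (S_i : axiom_i GG SS) (S_ii : axiom_ii GG SS) (S_iii : axiom_iii GG SS)
    (S_iv : axiom_iv GG SS) (S_vi : axiom_vi GG SS) (S_vii : axiom_vii GG SS)
    (S_viii : axiom_viii GG SS) (S_k2 : condition_k2 GG SS)
    (F : functor R GG SS) :
  (* S_+ = S^+, so that D_+ = D^+ =: E *)
  (forall (gT hT : finGroupType) (G : {group gT}) (H : {group hT}),
     GG gT G -> GG hT H ->
     forall P, S_lower GG SS G H P <-> S_upper GG SS G H P) /\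
  exists (Fp : fun_mor A (F_plus F)) (Fu : fun_mor A (F_upper F))
         (m : forall (gT : finGroupType) (G : {group gT}),
                {linear F_plus F G -> F_upper F G}),
    is_functor GG (S_lower GG SS) Fp /\
    is_functor GG (S_upper GG SS) Fu /\
    (forall (gT hT : finGroupType) (G : {group gT}) (H : {group hT})
            (U : biset A G H), GG gT G -> GG hT H ->
       stab_in (S_lower GG SS) U ->
       is_Fplus_map U (Fp gT hT G H (cls R U)) /\
       is_Fupper_map U (Fu gT hT G H (cls R U))) /\
    (forall (gT : finGroupType) (G : {group gT}), GG gT G ->
       is_mark_map (m gT G)) /\
    (* F^+([U]) o m_{F, H} = m_{F, G} o F_+([U]) *)
    (forall (gT hT : finGroupType) (G : {group gT}) (H : {group hT})
            (U : biset A G H), GG gT G -> GG hT H ->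
       stab_in (S_lower GG SS) U ->
       forall c : F_plus F H,
         Fu gT hT G H (cls R U) (m hT H c) = m gT G (Fp gT hT G H (cls R U) c)) /\
    (* m_F : F_+ -> F^+ is a morphism of functors on E *)
    (forall (gT hT : finGroupType) (G : {group gT}) (H : {group hT})
            (f : BR A R G H), GG gT G -> GG hT H ->
       is_mor (S_lower GG SS) f ->
       forall c : F_plus F H,
         Fu gT hT G H f (m hT H c) = m gT G (Fp gT hT G H f c)).
Proof.
have HS : admissible GG SS by split.
split; first by move=> gT hT G H gG gH P; exact: S_lower_upper.
exists (plus_mor HS F), (upper_mor HS F), (mark HS F).
split; first exact: plus_mor_functor.
split; first exact: upper_mor_functor.
split.
  move=> gT hT G H U gG gH SU; split.
    exact: is_Fplus_map_plus_mor.
  exact: is_Fupper_map_upper_mor.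
split; first by move=> gT G gG; exact: is_mark_map_mark.
split.
  by move=> gT hT G H U gG gH SU c; exact: mark_mor_cls.
by move=> gT hT G H f gG gH Mf; exact: mark_mor.
Qed.
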